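(* Let $P$ be a local Poisson bivector on the formal space of maps described by $\hat{\mathcal A}$, and let $\{f(\mathbf x),g(\mathbf y)\}$ be the bracket of densities $f,g\in\hat{\mathcal A}$ induced by $P$. Then the formal Fourier transform $$\{f_{\boldsymbol\lambda}g\}(\mathbf y):=\int e^{\boldsymbol\lambda\cdot(\mathbf x-\mathbf y)}\{f(\mathbf x),g(\mathbf y)\}\,\mathrm d\mathbf x$$ is the $\lambda$-bracket of a ($d$-dimensional) Poisson Vertex Algebra on $\hat{\mathcal A}$.
   Context: Algebra. Let $d,n\ge1$ and let $U$ be a coordinate chart of an $n$-dimensional manifold with coordinates $u^1,\dots,u^n$. $\hat{\mathcal A}$ is the algebra of polynomials in the variables $u^i_I$ ($1\le i\le n$, $I\in\mathbb Z^d_{\ge0}$, $I\ne0$) with coefficients in $C^\infty(U)$; $u^i_0=u^i$. Total derivatives: $\partial_\alpha=\sum_{i,I}u^i_{I+E_\alpha}\frac{\partial}{\partial u^i_I}$, $\alpha=1,\dots,d$; $\boldsymbol\partial^I=\prod_\alpha\partial_\alpha^{I_\alpha}$. $\hat{\mathcal F}=\hat{\mathcal A}/\sum_\alpha\partial_\alpha\hat{\mathcal A}$, with quotient map $\int$. Variational derivative: $\frac{\delta f}{\delta u^i}=\sum_I(-1)^{|I|}\boldsymbol\partial^I\frac{\partial f}{\partial u^i_I}$. Local Poisson bivector. This is an $n\times n$ matrix of differential operators $P^{ij}=\sum_SP^{ij}_S\boldsymbol\partial^S$ (finite sums, $P^{ij}_S\in\hat{\mathcal A}$) that is skewsymmetric,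 $P^{ji}_S=\sum_T(-1)^{|T|+1}\binom TS\boldsymbol\partial^{T-S}P^{ij}_T$ (multi-index binomials are products of ordinary ones), and satisfies the Schouten relation $[P,P]=0$; equivalently, $\{\int f,\int g\}=\int\sum\frac{\delta g}{\delta u^j}P^{ji}_S\boldsymbol\partial^S\frac{\delta f}{\delta u^i}$ is a Lie bracket on $\hat{\mathcal F}$. Bracket of densities. On coordinate functions, $\{u^i(\mathbf x),u^j(\mathbf y)\}=\sum_SP^{ji}_S(\mathbf y)\,\boldsymbol\partial_{\mathbf y}^S\delta(\mathbf x-\mathbf y)$, and in general $$\{f(\mathbf x),g(\mathbf y)\}=\sum_{i,j,L,M}\frac{\partial f}{\partial u^i_L}(\mathbf x)\frac{\partial g}{\partial u^j_M}(\mathbf y)\,\boldsymbol\partial_{\mathbf x}^L\boldsymbol\partial_{\mathbf y}^M\{u^i(\mathbf x),u^j(\mathbf y)\}.$$ Here $\mathbf x,\mathbf y$ are $d$-dimensional variables, $f(\mathbf x)$ denotes $f$ evaluated along a map at $\mathbf x$ (so that $\partial_\alpha$ becomes $\partial/\partial x^\alpha$), integration by parts produces no boundary terms, $\int f(\mathbf x)\delta(\mathbf x-\mathbf y)\mathrm d\mathbf x=f(\mathbf y)$, and $\partial_{x^\alpha}\delta(\mathbf x-\mathbf y)=-\partial_{y^\alpha}\delta(\mathbf x-\mathbf y)$. The $\lambda_\alpha$ are formal parameters, and the result of the integral is regarded as an element of $\hat{\mathcal A}[\lambda_1,\dots,\lambda_d]$. Poisson Vertex Algebra. A $\lambda$-bracket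 of rank $d$ is an $\mathbb R$-bilinear map $\hat{\mathcal A}\times\hat{\mathcal A}\to\mathbb R[\lambda_1,\dots,\lambda_d]\otimes\hat{\mathcal A}$ such that $\{\partial_\alpha f_{\boldsymbol\lambda}g\}=-\lambda_\alpha\{f_{\boldsymbol\lambda}g\}$; $\{f_{\boldsymbol\lambda}\partial_\alpha g\}=(\lambda_\alpha+\partial_\alpha)\{f_{\boldsymbol\lambda}g\}$; $\{f_{\boldsymbol\lambda}gh\}=\{f_{\boldsymbol\lambda}g\}h+\{f_{\boldsymbol\lambda}h\}g$; $\{fg_{\boldsymbol\lambda}h\}=\{f_{\boldsymbol\lambda+\boldsymbol\partial}h\}g+\{g_{\boldsymbol\lambda+\boldsymbol\partial}h\}f$, where for $\{f_{\boldsymbol\lambda}g\}=\sum_NC_N\boldsymbol\lambda^N$ one sets $\{f_{\boldsymbol\lambda+\boldsymbol\partial}g\}h=\sum_NC_N(\boldsymbol\lambda+\boldsymbol\partial)^Nh$. It defines a Poisson Vertex Algebra if moreover $\{g_{\boldsymbol\lambda}f\}=-\sum_N(-\boldsymbol\lambda-\boldsymbol\partial)^NC_N$ (skewsymmetry) and $\{f_{\boldsymbol\lambda}\{g_{\boldsymbol\mu}h\}\}-\{g_{\boldsymbol\mu}\{f_{\boldsymbol\lambda}h\}\}=\{\{f_{\boldsymbol\lambda}g\}_{\boldsymbol\lambda+\boldsymbol\mu}h\}$ (PVA-Jacobi identity). *)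

(* Defs.v *)
(* The notations of multinomials clash with those of MathComp-Analysis. *)
From HB Require Import structures.
From mathcomp Require Import all_boot all_order all_algebra finmap.
From mathcomp Require Import boolp classical_sets functions cardinality.
From mathcomp Require Import reals topology normedtype derive.
From mathcomp.multinomials Require Import -(notations) monalg.
From mathcomp.multinomials Require Import -(notations) mpoly.

Set Implicit Arguments.
Unset Strict Implicit.
Unset Printing Implicit Defensive.

Import Order.TTheory GRing.Theory Num.Theory.
Import numFieldNormedType.Exports.

Local Open Scope classical_set_scope.
Local Open Scope ring_scope.

(* A coordinate chart is identified with the open set of its coordinates. *)
Record chart (R : realType) (n : nat) := Chart {
  chart_set :> set 'rV[R]_n;
  chart_open : open chart_set;
  chart_neq0 : chart_set !=set0 }.

Arguments chart_open {R n} c.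
Arguments chart_neq0 {R n} c.

Section SmoothFunctions.
Variables (R : realType) (n : nat).

Definition partial (i : 'I_n) (f : 'rV[R]_n -> R) : 'rV[R]_n -> R :=
  fun x => 'D_(delta_mx 0 i) (f : 'rV[R]_n -> R^o) x.

(* [C^k] near the points of [U]; values outside [U] are irrelevant when [U] is
   open. *)
Fixpoint is_Ck (U : set 'rV[R]_n) (k : nat) (f : 'rV[R]_n -> R) : Prop :=
  (forall x, U x -> {for x, continuous f}) /\
  if k is k'.+1 then
    forall i, (forall x, U x -> derivable (f : 'rV[R]_n -> R^o) x (delta_mx 0 i))
              /\ is_Ck U k' (partial i f)
  else True.

Variables (U : set 'rV[R]_n) (Uo : open U).

Lemma near_open (f g : 'rV[R]_n -> R) x :
  U x -> (forall y, U y -> f y = g y) -> \near x, f x = g x.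
Proof.
move=> Ux fg; near=> y; apply: fg; near: y.
exact: (open_nbhs_nbhs (conj Uo Ux)).
Unshelve. all: by end_near. Qed.

Lemma partial_eq i (f g : 'rV[R]_n -> R) :
  (forall x, U x -> f x = g x) ->
  forall x, U x -> partial i f x = partial i g x.
Proof. by move=> fg x Ux; exact/near_eq_derive/near_open. Qed.

Lemma is_Ck_eq k (f g : 'rV[R]_n -> R) :
  (forall x, U x -> f x = g x) -> is_Ck U k f -> is_Ck U k g.
Proof.
elim: k f g => [|k IH] f g fg [cf df]; split=> //.
- move=> x Ux; rewrite /prop_for /continuous_at -fg//.
  exact: (cvg_trans (near_eq_cvg (near_open Ux fg)) (cf x Ux)).
- move=> x Ux; rewrite /prop_for /continuous_at -fg//.
  exact: (cvg_trans (near_eq_cvg (near_open Ux fg)) (cf x Ux)).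
- move=> i; have [dfi ci] := df i; split=> [x Ux|].
    exact: (near_eq_derivable (near_open Ux fg) (dfi x Ux)).
  exact: (IH _ _ (partial_eq i fg)).
Qed.

Lemma is_CkS k (f : 'rV[R]_n -> R) : is_Ck U k.+1 f -> is_Ck U k f.
Proof.
elim: k f => [|k IH] f [cf df]; split=> // i.
by have [? /IH] := df i.
Qed.

Lemma is_Ck_cst k (c : R) : is_Ck U k (cst c).
Proof.
elim: k c => [|k IH] c; split=> //; try by move=> x _; exact: cst_continuous.
move=> i; split=> [x _|]; first exact: derivable_cst.
by apply: (@is_Ck_eq _ (cst 0)) (IH 0) => x _; rewrite /partial derive_cst.
Qed.

Lemma is_CkD k (f g : 'rV[R]_n -> R) :
  is_Ck U k f -> is_Ck U k g -> is_Ck U k (f \+ g).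
Proof.
elim: k f g => [|k IH] f g [cf df] [cg dg]; split=> //.
- by move=> x Ux; exact: (continuousD (cf x Ux) (cg x Ux)).
- by move=> x Ux; exact: (continuousD (cf x Ux) (cg x Ux)).
- move=> i; have [dfi ci] := df i; have [dgi ei] := dg i.
  split=> [x Ux|]; first by apply: derivableD; [exact: dfi|exact: dgi].
  apply: is_Ck_eq (IH _ _ ci ei) => x Ux.
  by rewrite /partial deriveD//; [exact: dfi|exact: dgi].
Qed.

Lemma is_CkM k (f g : 'rV[R]_n -> R) :
  is_Ck U k f -> is_Ck U k g -> is_Ck U k (f \* g).
Proof.
elim: k f g => [|k IH] f g Cf Cg; have [cf df] := Cf; have [cg dg] := Cg.
  by split=> // x Ux; exact: (continuousM (cf x Ux) (cg x Ux)).
split=> [x Ux|i]; first exact: (continuousM (cf x Ux) (cg x Ux)).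
have [dfi ci] := df i; have [dgi ei] := dg i.
split=> [x Ux|]; first by apply: derivableM; [exact: dfi|exact: dgi].
apply: is_Ck_eq (is_CkD (IH _ _ (is_CkS Cf) ei) (IH _ _ (is_CkS Cg) ci)) => x Ux.
by rewrite /partial deriveM//; [exact: dfi|exact: dgi].
Qed.

Lemma is_Ck_coord k (i : 'I_n) : is_Ck U k (fun x : 'rV[R]_n => x 0 i).
Proof.
have [f fE] : exists f : {linear 'rV[R]_n -> R^o}, f = (fun x => x 0 i) :> (_ -> _).
  have @f : {linear 'rV[R]_n -> R^o}.
    by exists (fun x : 'rV[R]_n => x 0 i); do 2![eexists]; do ?[constructor];
       rewrite ?mxE// => ? *; rewrite ?mxE//; move=> ?; rewrite !mxE.
  by exists f.
have cf : continuous f by rewrite fE; exact: coord_continuous.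
have df x v : is_derive x v f (f v).
  apply: DeriveDef; first exact/diff_derivable/linear_differentiable.
  by rewrite deriveE ?diff_lin//; exact: linear_differentiable.
rewrite -fE; case: k => [|k]; split=> //; try by move=> x _; exact: cf.
move=> j.
split=> [x _|]; first by have [] := df x (delta_mx 0 j).
apply: is_Ck_eq (is_Ck_cst k (f (delta_mx 0 j))) => x _.
by rewrite /partial derive_val.
Qed.

End SmoothFunctions.

Section SmoothRing.
Variables (R : realType) (n : nat) (U : chart R n).
Local Notation V := (chart_set U).

(* ['valL_ 0 f] is the extension by zero of a function [f] defined on [U]. *)
Lemma extE (f : V -> R) x (Vx : V x) :
  'valL_ 0 f x = f (exist _ x (mem_set Vx)).
Proof.
rewrite /valL_ /= oinv_set_val.
case: insubP => [y _ yx|/negP[]]; last exact: mem_set.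
by congr (f _); exact: val_inj.
Qed.

Definition smooth : {pred (V -> R)} :=
  fun f => `[< forall k, is_Ck U k ('valL_ 0 f) >].

Lemma smoothP (f : V -> R) (g : 'rV[R]_n -> R) :
  (forall x, f x = g (val x)) -> (forall k, is_Ck U k g) -> f \in smooth.
Proof.
move=> fg Cg; apply/asboolP => k.
by apply: (is_Ck_eq (chart_open U)) (Cg k) => x Ux; rewrite extE fg.
Qed.

Lemma smooth_subring : subring_closed smooth.
Proof.
have Cext (f : V -> R) : f \in smooth -> forall k, is_Ck U k ('valL_ 0 f).
  by move/asboolP.
have eE (f : V -> R) x : 'valL_ 0 f (val x) = f x.
  case: x => x Vx; rewrite (extE f (set_mem Vx))/=.
  by congr (f _); exact: val_inj.
split.
- by apply: (smoothP (g := cst 1)) => // k; exact: is_Ck_cst (chart_open U) _ _.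
- move=> f g /Cext sf /Cext sg.
  apply: (smoothP (g := 'valL_ 0 f \+ (cst (-1) \* 'valL_ 0 g))) => [x|k].
    by rewrite -[LHS]/(f x - g x) -(eE f) -(eE g) /= mulN1r.
  apply: is_CkD => //; first exact: chart_open.
  by apply: is_CkM => //; [exact: chart_open|exact: is_Ck_cst (chart_open U) _ _].
- move=> f g /Cext sf /Cext sg.
  apply: (smoothP (g := 'valL_ 0 f \* 'valL_ 0 g)) => [x|k].
    by rewrite -[LHS]/(f x * g x) -(eE f) -(eE g).
  by apply: is_CkM => //; exact: chart_open.
Qed.

Record Cinf := MkCinf { Cinf_fun :> V -> R; _ : Cinf_fun \in smooth }.

HB.instance Definition _ := [isSub for Cinf_fun].
HB.instance Definition _ := [Choice of Cinf by <:].
HB.instance Definition _ :=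
  GRing.SubChoice_isSubComPzRing.Build _ _ Cinf smooth_subring.

Lemma Cinf_neq0 : 1 != 0 :> Cinf.
Proof.
have [x Vx] := chart_neq0 U.
apply/eqP => /(congr1 Cinf_fun)/(congr1 (@^~ (exist _ x (mem_set Vx)))) /eqP.
by rewrite oner_eq0.
Qed.

HB.instance Definition _ := GRing.PzSemiRing_isNonZero.Build Cinf Cinf_neq0.

Lemma const_smooth (c : R) : (fun=> c) \in smooth.
Proof.
by apply: (smoothP (g := cst c)) => // k; exact: is_Ck_cst (chart_open U) _ _.
Qed.

Definition Cinf_const (c : R) : Cinf := MkCinf (const_smooth c).

Lemma coord_smooth (i : 'I_n) : (fun x : V => val x 0 i) \in smooth.
Proof.
apply: (smoothP (g := fun x => x 0 i)) => // k.
exact: is_Ck_coord (chart_open U) _ _.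
Qed.

Definition Cinf_coord (i : 'I_n) : Cinf := MkCinf (coord_smooth i).

Lemma partial_smooth (i : 'I_n) (f : Cinf) :
  (fun x : V => partial i ('valL_ 0 f) (val x)) \in smooth.
Proof.
apply: (smoothP (g := partial i ('valL_ 0 f))) => // k.
have /asboolP/(_ k.+1) [_ Cf] := valP f.
by have [] := Cf i.
Qed.

Definition Cinf_partial (i : 'I_n) (f : Cinf) : Cinf :=
  MkCinf (partial_smooth i f).

End SmoothRing.

(* The pair [(i, I)] stands for the jet variable [u^i_I]. *)
Definition jet (d n : nat) : choiceType := ('I_n * multinom d)%type.

Definition jetvar (d n : nat) : choiceType :=
  {v : jet d n | v.2 != @mnm0 d}.

(* Differential polynomials: the variables are the [u^i_I] with [I != 0], while
   the [u^i] enter through the smooth coefficients. *)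
Definition Ahat (d : nat) (R : realType) (n : nat) (U : chart R n) :
  comNzRingType := malg (cmonom (jetvar d n)) (Cinf U).

Section DifferentialPolynomials.
Variables (d : nat) (R : realType) (n : nat) (U : chart R n).
Local Notation A := (Ahat d U).
Local Notation jet := (jet d n).
Local Notation jetvar := (jetvar d n).

Definition smooth_coef (c : Cinf U) : A := malgC c.

Definition realc (c : R) : A := smooth_coef (Cinf_const U c).

Definition uvar (v : jet) : A :=
  if insub v is Some w then mkmalgU (ucm (w : jetvar)) 1
  else smooth_coef (Cinf_coord U v.1).

Definition pd_var (w : jetvar) (f : A) : A :=
  \sum_(m <- monalg.msupp f)
     mkmalgU (divcm m (ucm w)) (monalg.mcoeff m f *+ cmonom_val m w).

Definition pd_coef (i : 'I_n) (f : A) : A :=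
  \sum_(m <- monalg.msupp f) mkmalgU m (Cinf_partial i (monalg.mcoeff m f)).

(* [pd (i, I) f] is the partial derivative of [f] with respect to [u^i_I]. *)
Definition pd (v : jet) (f : A) : A :=
  if insub v is Some w then pd_var w f else pd_coef v.1 f.

Lemma finite_pd (f : A) : finite_set [set v | pd v f != 0].
Proof.
pose s1 := [seq (i, @mnm0 d) | i <- enum 'I_n].
pose s2 := flatten [seq [seq val w | w <- finsupp (cmonom_val m)]
                       | m <- monalg.msupp f].
apply: (@sub_finite_set _ _ [set` (s1 ++ s2)]); last exact: finite_seq.
move=> -[i I] /=; rewrite /pd mem_cat; case: insubP => [w /= _ wE|/negPn/eqP I0].
  move=> df; apply/orP; right; apply/flatten_mapP.
  apply: contrapT => h; case/negP: df; apply/eqP/big1_seq => m /andP[_ mf].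
  rewrite (_ : cmonom_val m w = 0%N) ?mulr0n ?monalgU0//.
  apply: contrapT => /eqP mw; apply: h; exists m => //.
  by rewrite -wE map_f// mem_finsupp.
by move=> _; rewrite /= in I0; rewrite I0 map_f// mem_enum.
Qed.

(* The finitely many jet variables on which [f] depends. *)
Definition jetsupp (f : A) : {fset jet} := fset_set [set v | pd v f != 0].

(* [mpow D I] is the product of the [D a ^+ I a] for [D] a family of (commuting)
   operators. *)
Definition mpow (T : Type) (D : 'I_d -> T -> T) (I : multinom d) (x : T) : T :=
  foldr (fun a => iter (I a) (D a)) x (enum 'I_d).

Definition td (a : 'I_d) (f : A) : A :=
  \sum_(v <- jetsupp f) uvar (v.1, mnm_add v.2 (mnm1 a)) * pd v f.

Definition vder (i : 'I_n) (f : A) : A :=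
  \sum_(v <- jetsupp f | v.1 == i)
     (-1) ^+ mdeg v.2 * mpow td v.2 (pd v f).

(* Local functionals are represented by their densities: [eqF f g] is the
   equality of the classes of [f] and [g] in the quotient of [A] by the sum of
   the images of the [td a]. *)
Definition eqF (f g : A) : Prop :=
  exists h : 'I_d -> A, f - g = \sum_a td a (h a).

(* The operation on local functionals given on densities by [B] is well defined
   and is a Lie bracket. *)
Record lie_bracketF (B : A -> A -> A) : Prop := LieBracketF {
  lieF_wd : forall f f' g g',
    eqF f f' -> eqF g g' -> eqF (B f g) (B f' g');
  lieF_linl : forall c f f' g,
    eqF (B (realc c * f + f') g) (realc c * B f g + B f' g);
  lieF_linr : forall c f g g',
    eqF (B f (realc c * g + g')) (realc c * B f g + B f g');
  lieF_alt : forall f, eqF (B f f) 0;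
  lieF_jacobi : forall f g h,
    eqF (B f (B g h) + B g (B h f) + B h (B f g)) 0 }.

(* A differential operator [\sum_S Q_S \partial^S] is given by its symbol, the
   polynomial with coefficients the [Q_S]. *)
Definition diffop := mpoly d A.

Definition dapp (Q : diffop) (f : A) : A :=
  \sum_(S <- msupp Q) mcoeff S Q * mpow td S f.

Definition mbinom (T S : multinom d) : nat := \prod_(a < d) 'C(T a, S a).

(* [mnm_sub] is truncated, but [mbinom T S] vanishes unless [S <= T]. *)
Definition skew_diffop (P : 'M[diffop]_n) : Prop :=
  forall i j S, mcoeff S (P j i) =
    \sum_(T <- msupp (P i j))
       (-1) ^+ (mdeg T).+1 *
       (mpow td (mnm_sub T S) (mcoeff T (P i j)) *+ mbinom T S).

(* The density of the bracket of the local functionals of densities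
   [f] and [g]. *)
Definition functional_bracket (P : 'M[diffop]_n) (f g : A) : A :=
  \sum_i \sum_j vder j g * dapp (P j i) (vder i f).

Definition local_poisson_bivector (P : 'M[diffop]_n) : Prop :=
  skew_diffop P /\ lie_bracketF (functional_bracket P).

(* [(a, b, L, M)] stands for [a(x) b(y) \partial_x^L \partial_y^M \delta(x-y)],
   and a sequence for the sum of its terms. *)
Definition kernel := seq (A * A * multinom d * multinom d).

Definition delta : kernel := [:: (1, 1, @mnm0 d, @mnm0 d)].

Definition kmulx (f : A) (K : kernel) : kernel :=
  [seq let: (a, b, L, M) := t in (f * a, b, L, M) | t <- K].

Definition kmuly (g : A) (K : kernel) : kernel :=
  [seq let: (a, b, L, M) := t in (a, g * b, L, M) | t <- K].

Definition kdx (c : 'I_d) (K : kernel) : kernel :=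
  flatten [seq let: (a, b, L, M) := t in
               [:: (td c a, b, L, M); (a, b, mnm_add L (mnm1 c), M)] | t <- K].

Definition kdy (c : 'I_d) (K : kernel) : kernel :=
  flatten [seq let: (a, b, L, M) := t in
               [:: (a, td c b, L, M); (a, b, L, mnm_add M (mnm1 c))] | t <- K].

Definition coord_bracket (P : 'M[diffop]_n) (i j : 'I_n) : kernel :=
  flatten [seq kmuly (mcoeff N (P j i)) (mpow kdy N delta)
              | N <- msupp (P j i)].

Definition density_bracket (P : 'M[diffop]_n) (f g : A) : kernel :=
  flatten [seq kmulx (pd v f) (kmuly (pd w g)
                 (mpow kdx v.2 (mpow kdy w.2 (coord_bracket P v.1 w.1))))
              | v <- jetsupp f, w <- jetsupp g].

Definition lamX (a : 'I_d) : mpoly d A := mpolyX A (mnm1 a).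

(* The operator [\lambda_a + \partial_a]. *)
Definition lamD (a : 'I_d) (p : mpoly d A) : mpoly d A :=
  lamX a * p + map_mpoly (td a) p.

(* The integral of [e^{\lambda.(x-y)} a(x) b(y) \partial_x^L \partial_y^M
   \delta(x-y)] in [x].  One first replaces [\partial_y^M \delta] by
   [(-1)^|M| \partial_x^M \delta].  Integrating by parts, [\partial_x^{L+M}]
   is moved to [e^{\lambda.(x-y)} a(x)] with the sign [(-1)^|L+M|]; as
   [\partial_x (e^{\lambda.(x-y)} p(x)) = e^{\lambda.(x-y)}
   ((\lambda + \partial) p)(x)] this yields
   [e^{\lambda.(x-y)} ((\lambda + \partial)^{L+M} a)(x)], which is evaluated
   at [x = y]. *)
Definition fourier_term (t : A * A * multinom d * multinom d) : mpoly d A :=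
  let: (a, b, L, M) := t in
  (-1) ^+ mdeg M * ((-1) ^+ mdeg (mnm_add L M) *
    (mpolyC d b * mpow lamD (mnm_add L M) (mpolyC d a))).

Definition fourier (K : kernel) : mpoly d A := \sum_(t <- K) fourier_term t.

Definition induced_lambda_bracket (P : 'M[diffop]_n) (f g : A) : mpoly d A :=
  fourier (density_bracket P f g).

(* [plusD p h] is [\sum_N p_N (\lambda + \partial)^N h]. *)
Definition plusD (p : mpoly d A) (h : A) : mpoly d A :=
  \sum_(N <- msupp p) mpolyC d (mcoeff N p) * mpow lamD N (mpolyC d h).

Record is_lambda_bracket (br : A -> A -> mpoly d A) : Prop := IsLambdaBracket {
  lam_linl : forall c f f' g,
    br (realc c * f + f') g = mpolyC d (realc c) * br f g + br f' g;
  lam_linr : forall c f g g',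
    br f (realc c * g + g') = mpolyC d (realc c) * br f g + br f g';
  lam_sesquil : forall a f g, br (td a f) g = - (lamX a * br f g);
  lam_sesquir : forall a f g, br f (td a g) = lamD a (br f g);
  lam_leibnizr : forall f g h,
    br f (g * h) = br f g * mpolyC d h + br f h * mpolyC d g;
  lam_leibnizl : forall f g h,
    br (f * g) h = plusD (br f h) g + plusD (br g h) f }.

(* Polynomials in [\lambda] and [\mu] have [d + d] variables: the [\lambda_a]
   followed by the [\mu_a]. *)
Definition lam2 (a : 'I_d) : mpoly (d + d) A := mpolyX A (mnm1 (lshift d a)).
Definition mu2 (a : 'I_d) : mpoly (d + d) A := mpolyX A (mnm1 (rshift d a)).

Definition subst2 (z : 'I_d -> mpoly (d + d) A) (p : mpoly d A) :
  mpoly (d + d) A := mmap (@mpolyC (d + d) A) z p.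

Record is_PVA (br : A -> A -> mpoly d A) : Prop := IsPVA {
  PVA_lambda_bracket : is_lambda_bracket br;
  PVA_skew : forall f g,
    br g f = - \sum_(N <- msupp (br f g))
                 mpow (fun a p => - lamD a p) N (mpolyC d (mcoeff N (br f g)));
  PVA_jacobi : forall f g h,
    \sum_(N <- msupp (br g h))
       subst2 lam2 (br f (mcoeff N (br g h))) * mmap1 mu2 N
    - \sum_(N <- msupp (br f h))
        subst2 mu2 (br g (mcoeff N (br f h))) * mmap1 lam2 N
    = \sum_(N <- msupp (br f g))
        mmap1 lam2 N *
        subst2 (fun a => lam2 a + mu2 a) (br (mcoeff N (br f g)) h) }.

End DifferentialPolynomials.

(* Main.v *)
Require Import Defs.
From HB Require Import structures.
From mathcomp Require Import all_boot all_order all_algebra finmap.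
From mathcomp Require Import boolp classical_sets functions cardinality.
From mathcomp Require Import reals topology normedtype derive.
From mathcomp.multinomials Require Import -(notations) monalg.
From mathcomp.multinomials Require Import -(notations) mpoly.
From mathcomp Require Import ring zify.

Set Implicit Arguments.
Unset Strict Implicit.
Unset Printing Implicit Defensive.

Import Order.TTheory GRing.Theory Num.Theory.
Import numFieldNormedType.Exports.

Local Open Scope classical_set_scope.
Local Open Scope ring_scope.

(* Attach a weight to every density, a density of weight [w] standing for its
   product by a formal exponential [e^{w.x}]: the total derivatives become
   [w_a + \partial_a], and the usual formulas for variational derivatives and
   evolutionary vector fields make sense for all weights.
   In these terms [{f_\lambda g}] is the evolutionary derivative of [g] along the
   Hamiltonian vector field of [e^{\lambda.x} f], and the Jacobi identity says
   that the vector field of characteristic [J(\delta f, \delta g)] vanishes, where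
   [J] is a bidifferential operator whose coefficients do not depend on the
   weights.  So it suffices to show [J = 0], using only [J(\delta f, \delta g)] for
   [f] and [g] of weight zero.

   Put [Z = J(\delta f, \delta g)].  The Jacobi identity for functionals says that
   [D_Z h] is a total divergence for all [h].  This does not give [Z = 0] ([Z = u_x]
   is a counterexample), but it does bound the order of [Z]: the variational
   derivative of [D_Z v^(r+1)] vanishes for every [r] and every jet variable
   [v = u^k_K], and an iterated commutator with [v] extracts from this, when
   [|K|] is large, the top-order partial derivatives of [Z^k], which are zero as
   soon as the order of [Z] is at least [2].  Now take [f] and [g] to be squares
   of jet variables of large and widely separated orders: the coefficients of [J]
   are, up to nonzero factors, second derivatives of [Z] with respect to
   high-order jet variables, hence they vanish. *)

(** * Smooth coefficients *)

(** Everything below rests on commuting partial derivatives, which for the smooth coefficients means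
    Schwarz's theorem. Two facts shape the rest. [J] contains no Frechet derivative of its arguments
    because that of a variational derivative is self-adjoint; this is where it matters that [xi] and
    [eta] are variational derivatives. Once [J] is known to be a bidifferential operator, it can be
    evaluated on arbitrary arguments. The threshold [2] for the order of [Z] comes from comparing
    two operators. With [Y = D^K Z^k], the variational derivative of [v^r Y] is the sum of an
    operator of order up to [q + |K|], produced by the jet variables of [Y], and one of order [|K|],
    produced by [v], multiplied by [r]. A commutator of length [q + |K|] sees the second one only
    through a commutator of length [q + |K| - 1], which vanishes exactly when that exceeds [|K|],
    that is when [q > 1]. Squares serve as test densities since the variational derivative of
    [(u_K)^2] is a single jet variable up to sign and a factor [2], of an order that can be chosen
    freely. *)

Section Schwarz.
Variables (R : realType) (n : nat).
Implicit Types (f : 'rV[R]_n -> R^o) (x v w : 'rV[R]_n) (U : set 'rV[R]_n).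

Lemma is_derive_line f x v (s : R) :
  derivable f (s *: v + x) v ->
  is_derive s 1 (fun t : R => f (t *: v + x) : R^o) ('D_v f (s *: v + x)).
Proof.
move=> df; pose q (h : R) := h^-1 *: ((f \o shift (s *: v + x)) (h *: v) -
  f (s *: v + x)).
have qE : (fun h : R => h^-1 *: (((fun t : R => f (t *: v + x) : R^o) \o shift s)
    (h *: 1) - f (s *: v + x))) = q.
  by apply/funext => h; rewrite /q /= addrA -scalerDl [h *: 1]mulr1.
by apply: DeriveDef; rewrite /derivable /derive qE.
Qed.

(** Two uses of the mean value theorem: along [v], for the difference of [f] on two parallel
    segments, then along [w], for the derivative of [f] in the direction [v]. *)
Lemma mixed_difference f x v w (r : R) : 0 < r ->
  (forall s t, 0 <= s <= r -> 0 <= t <= r ->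
     derivable f (s *: v + (t *: w + x)) v /\
     derivable ('D_v f : _ -> R^o) (t *: w + (s *: v + x)) w) ->
  exists s t, [/\ 0 <= s <= r, 0 <= t <= r &
    f (r *: v + (r *: w + x)) - f (r *: v + x) - f (r *: w + x) + f x =
    'D_w ('D_v f : _ -> R^o) (t *: w + (s *: v + x)) * r * r].
Proof.
move=> r0 df.
have r01 : 0 <= r <= r by rewrite ltW/=.
have r00 : 0 <= (0:R) <= r by rewrite lexx ltW.
pose g1 (s : R) := f (s *: v + (r *: w + x)) : R^o.
pose g2 (s : R) := f (s *: v + x) : R^o.
pose dg (s : R) := 'D_v f (s *: v + (r *: w + x)) - 'D_v f (s *: v + x).
have dgP s : 0 <= s <= r -> is_derive s 1 (g1 - g2 : R -> R^o) (dg s).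
  move=> sr; apply: is_deriveB; apply: is_derive_line.
    exact: (df s r sr r01).1.
  by have := (df s 0 sr r00).1; rewrite scale0r add0r; apply.
have [||s sr E] := @MVT_segment R (g1 - g2) dg 0 r (ltW r0).
- move=> s; rewrite in_itv/= => /andP[s0 s1]; apply: dgP.
  by rewrite !ltW.
- apply: derivable_within_continuous => s; rewrite in_itv/= => sr.
  by have [] := dgP s sr.
rewrite in_itv/= in sr.
pose k (t : R) := 'D_v f (t *: w + (s *: v + x)) : R^o.
pose dk (t : R) := 'D_w ('D_v f : _ -> R^o) (t *: w + (s *: v + x)).
have dkP t : 0 <= t <= r -> is_derive t 1 k (dk t).
  by move=> tr; apply: is_derive_line; have [] := df s t sr tr.
have [||t tr F] := @MVT_segment R k dk 0 r (ltW r0).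
- move=> t; rewrite in_itv/= => /andP[s0 s1]; apply: dkP.
  by rewrite !ltW.
- apply: derivable_within_continuous => t; rewrite in_itv/= => tr.
  by have [] := dkP t tr.
rewrite in_itv/= in tr.
exists s, t; split=> //.
move: E; rewrite -![(g1 - g2 : R -> R) _]/(_ - _) /g1 /g2 !scale0r !add0r subr0.
have -> : dg s = dk t * r.
  have := F; rewrite subr0 => <-; rewrite /dg /k scale0r add0r.
  by rewrite (_ : s *: v + (r *: w + x) = r *: w + (s *: v + x)) // addrCA.
rewrite -/(dk t) => <-; ring.
Qed.

(** The second difference is symmetric in [v] and [w], so the two mixed derivatives take a common
    value at two points near [x]; continuity brings both points to [x]. *)
Lemma derive_comm U f x v w : open U -> U x ->
  (forall y, U y -> derivable f y v /\ derivable f y w) ->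
  (forall y, U y -> derivable ('D_v f : _ -> R^o) y w /\
                    derivable ('D_w f : _ -> R^o) y v) ->
  {for x, continuous ('D_w ('D_v f : _ -> R^o))} ->
  {for x, continuous ('D_v ('D_w f : _ -> R^o))} ->
  'D_w ('D_v f : _ -> R^o) x = 'D_v ('D_w f : _ -> R^o) x.
Proof.
move=> Uo Ux df ddf c1 c2; apply/eqP; rewrite -subr_eq0 -normr_le0.
apply/ler_addgt0Pr => e e0; rewrite add0r.
have e20 : 0 < e / 2 by rewrite divr_gt0.
pose P1 y := `|'D_w ('D_v f : _ -> R^o) x - 'D_w ('D_v f : _ -> R^o) y| < e / 2.
pose P2 y := `|'D_v ('D_w f : _ -> R^o) x - 'D_v ('D_w f : _ -> R^o) y| < e / 2.
have N1 : nbhs x P1 := @cvgr_dist_lt _ _ _ _ (nbhs_filter x) _ _ c1 _ e20.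
have N2 : nbhs x P2 := @cvgr_dist_lt _ _ _ _ (nbhs_filter x) _ _ c2 _ e20.
have [d d0 dP] := iffLR (nbhs_normP _ _)
  (filterI (open_nbhs_nbhs (conj Uo Ux)) (filterI N1 N2)).
rewrite /= in d0.
have dU y : `|x - y| < d -> U y by move=> /dP[].
(* The summand [1] keeps [M] positive when [v] and [w] vanish; with [r = d / (2 M)] the whole
   parallelogram stays within distance [d] of [x]. *)
pose M := `|v| + `|w| + 1.
have M0 : 0 < M by rewrite ltr_wpDl// addr_ge0.
pose r := d / (M * 2).
have r0 : 0 < r by rewrite divr_gt0// mulr_gt0.
have rP s t : 0 <= s <= r -> 0 <= t <= r -> `|x - (s *: v + (t *: w + x))| < d.
  move=> /andP[s0 sr] /andP[t0 tr].
  have -> : x - (s *: v + (t *: w + x)) = - (s *: v + t *: w).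
    by rewrite addrA opprD addrCA subrr addr0.
  rewrite normrN (le_lt_trans (ler_normD _ _))// !normrZ !ger0_norm//.
  apply: (@le_lt_trans _ _ (r * M)); last first.
    rewrite /r invfM mulrA mulrAC divfK ?gt_eqF// ltr_pdivrMr//.
    by rewrite ltr_pMr// ltr1n.
  rewrite /M -addrA mulrDr lerD// ?ler_wpM2r//.
  rewrite mulrDr mulr1 -[X in X <= _]addr0 lerD// ?ler_wpM2r//.
  exact: ltW.
have rP' s' t' : 0 <= s' <= r -> 0 <= t' <= r ->
    `|x - (s' *: w + (t' *: v + x))| < d.
  by move=> *; rewrite addrCA; exact: rP.
have [s [t [sr tr E1]]] := @mixed_difference f x v w r r0 (fun s t sr tr =>
  conj (df _ (dU _ (rP s t sr tr))).1
    (ddf _ (dU _ (rP' t s tr sr))).1).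
have [s' [t' [sr' tr' E2]]] := @mixed_difference f x w v r r0 (fun s t sr tr =>
  conj (df _ (dU _ (rP' s t sr tr))).2
    (ddf _ (dU _ (rP t s tr sr))).2).
have [_ [A _]] := dP _ (rP' t s tr sr); have [_ [_ B]] := dP _ (rP t' s' tr' sr').
have mulrrI (a b : R) : a * r * r = b * r * r -> a = b.
  by move=> ab; do 2!apply: (mulIf (lt0r_neq0 r0)).
have swapE : f (r *: w + (r *: v + x)) = f (r *: v + (r *: w + x)).
  by congr (f _); exact: addrCA.
rewrite swapE in E2; move: E1 E2 A B.
rewrite /P1 /P2.
move: ('D_w _ (t *: w + _)) ('D_v _ (t' *: v + _)) => a b.
move: ('D_w _ x) ('D_v _ x) => a' b'.
move: (f x) (f _) (f _) (f _) => f0 f1 f2 f3 E1 E2 A B.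
have {E1 E2} EE : a = b.
  by apply: mulrrI; rewrite -E1 -E2; congr (_ + _); exact: addrAC.
rewrite -{b}EE in B.
apply: ltW; rewrite [ltRHS]splitr -(subrKA a) (le_lt_trans (ler_normD _ _))//.
by rewrite ltrD// distrC.
Qed.

End Schwarz.

Section SmoothPartial.
Variables (R : realType) (n : nat) (U : chart R n).
Local Notation V := (chart_set U).
Implicit Types (f g : Cinf U) (i j : 'I_n).
Local Notation ext := (valL_ 0).

Lemma ext_val f (x : V) : ext f (val x) = f x.
Proof.
case: x => x Vx; rewrite (extE f (set_mem Vx))/=.
by congr (Cinf_fun f _); exact: val_inj.
Qed.

Lemma CinfP f g : (forall x : V, f x = g x) -> f = g.
Proof. by move=> fg; apply: val_inj; apply/funext. Qed.

Lemma is_Ck_ext f k : is_Ck U k (ext f).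
Proof. by have /asboolP := valP f. Qed.

Lemma derivable_ext f x i : V x ->
  derivable (ext f : _ -> R^o) x (delta_mx 0 i).
Proof. by move=> Vx; have [_ /(_ i)[+ _]] := is_Ck_ext f 1; apply. Qed.

Lemma ext_eq f (h : 'rV[R]_n -> R) : (forall x : V, f x = h (val x)) ->
  forall x, V x -> ext f x = h x.
Proof. by move=> fh x Vx; rewrite (extE _ Vx) fh. Qed.

Lemma Cinf_partialE f (h : 'rV[R]_n -> R) i : (forall x : V, f x = h (val x)) ->
  forall x : V, Cinf_partial i f x = partial i h (val x).
Proof.
move=> fh x.
by rewrite /= (partial_eq (chart_open U) _ (ext_eq fh))//; exact: (set_valP x).
Qed.

Lemma Cinf_partialD i f g :
  Cinf_partial i (f + g) = Cinf_partial i f + Cinf_partial i g.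
Proof.
apply: CinfP => x; have Vx := set_valP x.
rewrite (@Cinf_partialE _ (ext f \+ ext g)) => [|y]; last first.
  by rewrite -[LHS]/(f y + g y) -(ext_val f) -(ext_val g).
by rewrite /partial deriveD//; exact: derivable_ext.
Qed.

Lemma Cinf_partialM i f g :
  Cinf_partial i (f * g) = Cinf_partial i f * g + f * Cinf_partial i g.
Proof.
apply: CinfP => x; have Vx := set_valP x.
rewrite (@Cinf_partialE _ (ext f \* ext g)) => [|y]; last first.
  by rewrite -[LHS]/(f y * g y) -(ext_val f) -(ext_val g).
rewrite /partial deriveM//; [|exact: derivable_ext..].
rewrite !ext_val addrC; congr (_ + _); exact: mulrC.
Qed.

Lemma Cinf_partial_const i (c : R) :
  Cinf_partial i (Cinf_const U c) = 0.
Proof.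
apply: CinfP => x; rewrite (@Cinf_partialE _ (cst c))//.
by rewrite /partial derive_cst.
Qed.

Lemma Cinf_partial_coord i j : Cinf_partial i (Cinf_coord U j) = (i == j)%:R.
Proof.
apply: CinfP => x; rewrite (@Cinf_partialE _ (fun x => x 0 j))//.
have [f fE] : exists f : {linear 'rV[R]_n -> R^o}, f = (fun x => x 0 j) :> (_ -> _).
  have @f : {linear 'rV[R]_n -> R^o}.
    by exists (fun x : 'rV[R]_n => x 0 j); do 2![eexists]; do ?[constructor];
       rewrite ?mxE// => ? *; rewrite ?mxE//; move=> ?; rewrite !mxE.
  by exists f.
have cf : continuous f by rewrite fE; exact: coord_continuous.
rewrite /partial -fE deriveE ?diff_lin//; last exact: linear_differentiable.
by rewrite fE mxE eqxx eq_sym; case: eqP.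
Qed.

Lemma Cinf_partial_comm i j f :
  Cinf_partial i (Cinf_partial j f) = Cinf_partial j (Cinf_partial i f).
Proof.
apply: CinfP => x; have Vx := set_valP x.
rewrite (@Cinf_partialE (Cinf_partial j f) (partial j (ext f)) i (fun=> erefl)).
rewrite (@Cinf_partialE (Cinf_partial i f) (partial i (ext f)) j (fun=> erefl)).
have [_ df] := is_Ck_ext f 2.
apply: (derive_comm (chart_open U) Vx).
- by move=> y Vy; split; exact: derivable_ext.
- move=> y Vy; split; first exact: (((df j).2.2 i).1 y Vy).
  exact: (((df i).2.2 j).1 y Vy).
- exact: (((df j).2.2 i).2.1 _ Vx).
- exact: (((df i).2.2 j).2.1 _ Vx).
Qed.

End SmoothPartial.

(** * Partial derivatives of differential polynomials *)

Section MonomialDerivations.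
Variables (K : conomType) (G : comNzRingType).
Local Notation malgKG := (malg K G).

Lemma raddf_fsum (V W : zmodType) (D : V -> W) (I : Type) (s : seq I) (F : I -> V) :
  (forall a b, D (a + b) = D a + D b) ->
  D (\sum_(k <- s) F k) = \sum_(k <- s) D (F k).
Proof.
move=> DD; apply: (big_morph D DD); apply: (addrI (D 0)).
by rewrite -DD !addr0.
Qed.

Lemma malg_leibniz (D : malgKG -> malgKG) :
  (forall f g, D (f + g) = D f + D g) ->
  (forall k l c e, D (mkmalgU k c * mkmalgU l e) =
     D (mkmalgU k c) * mkmalgU l e + mkmalgU k c * D (mkmalgU l e)) ->
  forall f g, D (f * g) = D f * g + f * D g.
Proof.
move=> DD DU f g.
have Dsum I (s : seq I) F := @raddf_fsum _ _ D I s F DD.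
rewrite (monalgE f); rewrite mulr_suml Dsum [in X in _ = X + _]Dsum !mulr_suml.
rewrite -big_split; apply: eq_bigr => k _ /=.
rewrite (monalgE g) mulr_sumr !Dsum !mulr_sumr -big_split.
by apply: eq_bigr => l _; exact: DU.
Qed.

Lemma mkmalgUM (k l : K) (c e : G) :
  mkmalgU k c * mkmalgU l e = mkmalgU (mmul k l) (c * e) :> malgKG.
Proof. exact: fgmulUU. Qed.

End MonomialDerivations.

Section MonomialDerivation.
Variables (K : conomType) (G : comNzRingType).
Local Notation B := (malg K G).
Local Notation coef := monalg.mcoeff.
Implicit Types (f g : B) (k l m : K) (c : G).

(* The derivation with respect to the variable [x] of the monoid of monomials,
   [e] being the exponent of [x] and [dv] the division by [x]. *)
Record monom_var (x : K) (e : K -> nat) (dv : K -> K) : Prop := MonomVar {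
  mvarD : forall k l, e (mmul k l) = (e k + e l)%N;
  mvar_e1 : e x = 1%N;
  mvar_mulK : forall m, dv (mmul m x) = m;
  mvar_divK : forall m, (0 < e m)%N -> mmul (dv m) x = m }.

Definition malg_deriv (e : K -> nat) (dv : K -> K) f : B :=
  \sum_(m <- monalg.msupp f) mkmalgU (dv m) (coef m f *+ e m).

Section OneVariable.
Variables (x : K) (e : K -> nat) (dv : K -> K).
Hypothesis xP : monom_var x e dv.
Local Notation D := (malg_deriv e dv).

Lemma mvar_divl k l : (0 < e k)%N -> dv (mmul k l) = mmul (dv k) l.
Proof.
move=> ek; rewrite -{1}(mvar_divK xP ek) -mulmA (mulmC x) mulmA.
exact: (mvar_mulK xP).
Qed.

(** Only [mmul m x] contributes: [dv] inverts multiplication by [x] on monomials of positive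
    exponent, and its values elsewhere are multiplied by [e k = 0]. *)
Lemma mcoeff_malg_deriv f m : coef m (D f) = coef (mmul m x) f *+ (e m).+1.
Proof.
rewrite /malg_deriv raddf_sum /=.
under eq_bigr do rewrite monalg.mcoeffU.
have other k : k != mmul m x -> coef k f *+ e k *+ (dv k == m) = 0.
  move=> km; have [->|ek] := posnP (e k); first by rewrite mulr0n mul0rn.
  by case: eqP => // km'; rewrite -km' (mvar_divK xP)// eqxx in km.
have [mf|mf] := boolP (mmul m x \in monalg.msupp f).
  rewrite (big_fsetD1 _ mf) /= (mvarD xP) (mvar_e1 xP) addn1 (mvar_mulK xP) eqxx.
  rewrite big1_fset ?addr0// => k.
  by rewrite in_fsetD1 => /andP[km _] _; exact: other.
rewrite (monalg.mcoeff_outdom mf) mul0rn big1_fset// => k kf _.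
by apply: other; apply: contraNneq mf => <-.
Qed.

Lemma malg_derivU m c : D (mkmalgU m c) = mkmalgU (dv m) (c *+ e m).
Proof.
rewrite /malg_deriv msuppU; case: eqP => [->|_].
  by rewrite big_seq_fset0 mul0rn monalgU0.
by rewrite big_seq_fset1 mcoeffUU.
Qed.

Lemma malg_derivD f g : D (f + g) = D f + D g.
Proof.
by apply/malgP => m; rewrite [RHS]monalg.mcoeffD !mcoeff_malg_deriv
  monalg.mcoeffD mulrnDl.
Qed.

Lemma malg_derivM f g : D (f * g) = D f * g + f * D g.
Proof.
apply: malg_leibniz => {f g}; first exact: malg_derivD.
move=> k l c c'; rewrite mkmalgUM !malg_derivU !mkmalgUM (mvarD xP) mulrnDr.
rewrite monalgUD; congr (_ + _).
- rewrite mulrnAl; have [->|ek] := posnP (e k).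
    by rewrite !mulr0n !monalgU0.
  by rewrite mvar_divl.
- rewrite mulrnAr; have [->|el] := posnP (e l).
    by rewrite !mulr0n !monalgU0.
  by rewrite mulmC mvar_divl// mulmC.
Qed.

Lemma malg_derivC c : D (mkmalgU mone c) = 0.
Proof.
rewrite malg_derivU (_ : e mone = 0%N) ?mulr0n ?monalgU0//.
by apply/eqP; rewrite -(eqn_add2l (e mone)) -(mvarD xP) mul1m addn0.
Qed.

Lemma malg_deriv_var : D (mkmalgU x 1) = 1.
Proof.
by rewrite malg_derivU (mvar_e1 xP) -[x]mul1m (mvar_mulK xP).
Qed.

End OneVariable.

Lemma malg_deriv_comm x e dv x' e' dv' f :
  monom_var x e dv -> monom_var x' e' dv' -> e x' = 0%N -> e' x = 0%N ->
  malg_deriv e dv (malg_deriv e' dv' f) = malg_deriv e' dv' (malg_deriv e dv f).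
Proof.
move=> xP xP' ex' e'x; apply/malgP => m.
rewrite !(mcoeff_malg_deriv xP, mcoeff_malg_deriv xP').
rewrite (mvarD xP) (mvarD xP') ex' e'x !addn0 -!mulrnA mulnC.
by rewrite -!mulmA (mulmC x).
Qed.

End MonomialDerivation.

Lemma cmonom_var (I : choiceType) (w : I) :
  @monom_var (cmonom I) (ucm w) (fun m => cmonom_val m w)
    (fun m => divcm m (ucm w)).
Proof.
split=> [k l||m|m mw].
- by rewrite monalg.cmM.
- by rewrite monalg.cmUU.
- by apply/eqP/monalg.cmP => v; rewrite monalg.divcmE monalg.cmM addnK.
- apply/eqP/monalg.cmP => v.
  rewrite monalg.cmM monalg.divcmE monalg.cmU; case: eqVneq => [<-|_].
    by rewrite subnK.
  by rewrite subn0 addn0.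
Qed.

Lemma cmU_neq (I : choiceType) (w w' : I) : w != w' ->
  cmonom_val (ucm w') w = 0%N.
Proof. by move=> ww'; rewrite monalg.cmU eq_sym (negPf ww'). Qed.

Section CoefficientDerivation.
Variables (K : conomType) (G : comNzRingType).
Local Notation B := (malg K G).
Local Notation coef := monalg.mcoeff.
Implicit Types (f g : B) (m : K) (c : G).

Definition malg_map (D : G -> G) f : B :=
  \sum_(m <- monalg.msupp f) mkmalgU m (D (coef m f)).

Lemma addf0 (V W : zmodType) (D : V -> W) :
  (forall a b, D (a + b) = D a + D b) -> D 0 = 0.
Proof. by move=> DD; apply: (addrI (D 0)); rewrite -DD !addr0. Qed.

Section OneDerivation.
Variable D : G -> G.
Hypothesis DD : forall a b, D (a + b) = D a + D b.
Hypothesis DM : forall a b, D (a * b) = D a * b + a * D b.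

Lemma mcoeff_malg_map f m : coef m (malg_map D f) = D (coef m f).
Proof.
rewrite /malg_map raddf_sum /=.
under eq_bigr do rewrite monalg.mcoeffU.
have [mf|mf] := boolP (m \in monalg.msupp f).
  rewrite (big_fsetD1 _ mf) /= eqxx big1_fset ?addr0// => k.
  by rewrite in_fsetD1 => /andP[/negPf->].
rewrite (monalg.mcoeff_outdom mf) (addf0 DD) big1_fset// => k kf _.
by case: eqP => // km; rewrite -km kf in mf.
Qed.

Lemma malg_mapD f g : malg_map D (f + g) = malg_map D f + malg_map D g.
Proof.
by apply/malgP => m; rewrite [RHS]monalg.mcoeffD !mcoeff_malg_map
  monalg.mcoeffD DD.
Qed.

Lemma malg_mapU m c : malg_map D (mkmalgU m c) = mkmalgU m (D c).
Proof.
apply/malgP => k; rewrite mcoeff_malg_map !monalg.mcoeffU.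
by case: eqP => //= _; rewrite (addf0 DD).
Qed.

Lemma malg_mapM f g : malg_map D (f * g) = malg_map D f * g + f * malg_map D g.
Proof.
apply: malg_leibniz => {f g}; first exact: malg_mapD.
by move=> k l c e; rewrite mkmalgUM !malg_mapU !mkmalgUM -monalgUD DM.
Qed.

Lemma malg_map_deriv x e dv f : monom_var x e dv ->
  malg_map D (malg_deriv e dv f) = malg_deriv e dv (malg_map D f).
Proof.
move=> xP; apply/malgP => m.
rewrite mcoeff_malg_map !(mcoeff_malg_deriv xP) mcoeff_malg_map.
elim: (e m).+1 => [|k IH]; last by rewrite !mulrS DD IH.
exact: (addf0 DD).
Qed.

End OneDerivation.

Lemma malg_map_comm (D D' : G -> G) f :
  (forall a b, D (a + b) = D a + D b) ->
  (forall a b, D' (a + b) = D' a + D' b) ->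
  (forall a, D (D' a) = D' (D a)) ->
  malg_map D (malg_map D' f) = malg_map D' (malg_map D f).
Proof.
by move=> DD DD' DC; apply/malgP => m; rewrite !mcoeff_malg_map.
Qed.

End CoefficientDerivation.

Section PartialDerivatives.
Variables (d : nat) (R : realType) (n : nat) (U : chart R n).
Local Notation A := (Ahat d U).
Implicit Types (f g : A) (w : jetvar d n) (i : 'I_n) (m : cmonom (jetvar d n)).
Local Notation coef := monalg.mcoeff.

Lemma pd_varD w f g : pd_var w (f + g) = pd_var w f + pd_var w g.
Proof. exact: (malg_derivD (cmonom_var w)). Qed.

Lemma pd_varM w f g : pd_var w (f * g) = pd_var w f * g + f * pd_var w g.
Proof. exact: (malg_derivM (cmonom_var w)). Qed.

Lemma pd_varC w (c : Cinf U) : pd_var w (smooth_coef d c) = 0.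
Proof. exact: (malg_derivC (cmonom_var w)). Qed.

Lemma pd_var_var w w' : pd_var w (mkmalgU (ucm w') 1 : A) = (w == w')%:R.
Proof.
have [->|ww'] := eqVneq w w'; first exact: (malg_deriv_var _ (cmonom_var w')).
apply: etrans (malg_derivU _ _ _ _) _.
by rewrite cmU_neq// mulr0n monalgU0.
Qed.

Lemma pd_var_comm w w' f : pd_var w (pd_var w' f) = pd_var w' (pd_var w f).
Proof.
have [->//|ww'] := eqVneq w w'.
apply: (malg_deriv_comm _ (cmonom_var w) (cmonom_var w')); rewrite cmU_neq//.
by rewrite eq_sym.
Qed.

Lemma pd_coefD i f g : pd_coef i (f + g) = pd_coef i f + pd_coef i g.
Proof. exact: (malg_mapD (@Cinf_partialD _ _ U i)). Qed.

Lemma pd_coefM i f g : pd_coef i (f * g) = pd_coef i f * g + f * pd_coef i g.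
Proof.
exact: (malg_mapM (@Cinf_partialD _ _ U i) (@Cinf_partialM _ _ U i)).
Qed.

Lemma pd_coefC i (c : Cinf U) :
  pd_coef i (smooth_coef d c) = smooth_coef d (Cinf_partial i c).
Proof. exact: (malg_mapU (@Cinf_partialD _ _ U i)). Qed.

Lemma pd_coef_var i w : pd_coef i (mkmalgU (ucm w) 1 : A) = 0.
Proof.
apply: etrans (malg_mapU (@Cinf_partialD _ _ U i) _ _) _.
rewrite (_ : 1 = Cinf_const U 1); last exact: CinfP.
by rewrite Cinf_partial_const; exact: monalgU0.
Qed.

Lemma pd_coef_comm i j f : pd_coef i (pd_coef j f) = pd_coef j (pd_coef i f).
Proof.
exact: (malg_map_comm _ (@Cinf_partialD _ _ U i) (@Cinf_partialD _ _ U j)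
  (@Cinf_partial_comm _ _ U i j)).
Qed.

Lemma pd_coef_var_comm i w f : pd_coef i (pd_var w f) = pd_var w (pd_coef i f).
Proof.
exact: (malg_map_deriv (@Cinf_partialD _ _ U i) _ (cmonom_var w)).
Qed.

Implicit Types (u v : jet d n).

Lemma pdD v f g : pd v (f + g) = pd v f + pd v g.
Proof. by rewrite /pd; case: insub => [w|]; [exact: pd_varD|exact: pd_coefD]. Qed.

Lemma pdM v f g : pd v (f * g) = pd v f * g + f * pd v g.
Proof. by rewrite /pd; case: insub => [w|]; [exact: pd_varM|exact: pd_coefM]. Qed.

Lemma pd_comm u v f : pd u (pd v f) = pd v (pd u f).
Proof.
rewrite /pd; case: insub => [w|]; case: insub => [w'|].
- exact: pd_var_comm.
- by rewrite pd_coef_var_comm.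
- by rewrite pd_coef_var_comm.
- exact: pd_coef_comm.
Qed.

Lemma pd_realc v (c : R) : pd v (realc d U c) = 0.
Proof.
rewrite /pd /realc; case: insub => [w|]; first exact: pd_varC.
by rewrite pd_coefC Cinf_partial_const; exact: monalgU0.
Qed.

Lemma pd_uvar u v : pd u (uvar U v) = (u == v)%:R.
Proof.
rewrite /pd /uvar; case: insubP => [w /= u0 wu|u0];
  case: insubP => [w' /= v0 wv|v0].
- by rewrite -wu -wv (inj_eq val_inj); exact: pd_var_var.
- rewrite pd_varC.
  by case: eqVneq => // uv; rewrite -uv u0 in v0.
- rewrite pd_coef_var.
  by case: eqVneq => // uv; rewrite uv v0 in u0.
- rewrite pd_coefC Cinf_partial_coord.
  move: u v u0 v0 => [i I] [j J] /= /negPn/eqP-> /negPn/eqP->.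
  rewrite xpair_eqE eqxx andbT; case: eqP => _ //=.
  exact: monalgU0.
Qed.

Lemma realcM (a b : R) : realc d U (a * b) = realc d U a * realc d U b.
Proof. by rewrite /realc /smooth_coef mkmalgUM mul1m; congr mkmalgU; exact: val_inj. Qed.

Lemma realcD (a b : R) : realc d U (a + b) = realc d U a + realc d U b.
Proof. by rewrite /realc /smooth_coef -monalgUD; congr mkmalgU; exact: val_inj. Qed.

Lemma realc1 : realc d U 1 = 1.
Proof. by rewrite /realc /smooth_coef; congr mkmalgU; exact: val_inj. Qed.

(** Positive integers are invertible among the real constants. This removes the multiplicities and
    factorials that appear when coefficients are extracted. *)
Lemma Ahat_mulIn (f : A) k : (0 < k)%N -> f *+ k = 0 -> f = 0.
Proof.
move=> k0 fk; have kE : realc d U k%:R = k%:R.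
  by elim: k {k0 fk} => [|k IH]; rewrite ?mulrS -?IH -?realc1 -?realcD//;
     apply: (addrI (realc d U 0)); rewrite -realcD !addr0.
rewrite -[f]mul1r -realc1 -(@mulVf _ (k%:R : R)) ?pnatr_eq0 -?lt0n//.
by rewrite realcM kE -mulrA mulr_natl fk mulr0.
Qed.

End PartialDerivatives.

(** * Rings with commuting partial derivatives *)

Definition addf (V W : zmodType) (D : V -> W) := forall a b, D (a + b) = D a + D b.

Lemma addf_sum (V W : zmodType) (D : V -> W) (I : Type) (s : seq I) (P : pred I)
    (F : I -> V) : addf D ->
  D (\sum_(k <- s | P k) F k) = \sum_(k <- s | P k) D (F k).
Proof. by move=> DD; apply: (big_morph D DD); exact: addf0. Qed.

Lemma addfN (V W : zmodType) (D : V -> W) a : addf D -> D (- a) = - D a.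
Proof. by move=> DD; apply: (addrI (D a)); rewrite -DD !subrr; exact: addf0. Qed.

Lemma addfMn (V W : zmodType) (D : V -> W) a m : addf D -> D (a *+ m) = D a *+ m.
Proof. by move=> DD; elim: m => [|m IH]; [exact: addf0|rewrite !mulrS DD IH]. Qed.

(** Finite supports give a meaning to sums over all variables. Total derivatives are left for later,
    since those of [Ahat] are themselves such sums. *)
Record pdRing (J : choiceType) := PdRing {
  pr_sort :> comNzRingType;
  par : J -> pr_sort -> pr_sort;
  par_add : forall v, addf (par v);
  parM : forall v p q, par v (p * q) = par v p * q + p * par v q;
  parC : forall u v p, par u (par v p) = par v (par u p);
  par_fin : forall p, finite_set [set v | par v p != 0] }.

Section PdRing.
Variables (J : choiceType) (C : pdRing J).
Implicit Types (p q : C) (v w : J).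

Lemma par0 v : par v (0 : C) = 0. Proof. exact: addf0 (@par_add _ _ _). Qed.

Lemma parD v p q : par v (p + q) = par v p + par v q.
Proof. exact: par_add. Qed.

Lemma parN v p : par v (- p) = - par v p.
Proof. exact: addfN (@par_add _ _ _). Qed.

Lemma par1 v : par v (1 : C) = 0.
Proof.
have := parM v (1 : C) 1; rewrite !mulr1 mul1r => E.
by apply: (addrI (par v 1)); rewrite -E addr0.
Qed.

Definition dsupp p : {fset J} := fset_set [set v | par v p != 0].

Lemma mem_dsupp v p : (v \in dsupp p) = (par v p != 0).
Proof. by rewrite in_fset_set; [apply/idP/idP; rewrite inE|exact: par_fin]. Qed.

(** Total derivatives, evolutionary derivations and Euler operators all have this form with [phi v]
    additive. Additivity allows the index set to be enlarged, so that elements with different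
    supports can be compared. *)
Definition dsum (V : zmodType) (phi : J -> C -> V) p : V :=
  \sum_(v <- dsupp p) phi v (par v p).

Lemma dsum_seq2 p q (t : seq J) : exists s, [/\ uniq s,
  forall v, v \in dsupp p -> v \in s, forall v, v \in dsupp q -> v \in s &
  forall v, v \in t -> v \in s].
Proof.
exists (undup ((dsupp p : seq J) ++ (dsupp q : seq J) ++ t)).
by rewrite undup_uniq; split=> // v vp; rewrite mem_undup !mem_cat vp ?orbT.
Qed.

Section Dsum.
Variable V : zmodType.
Implicit Types phi psi : J -> C -> V.

Lemma dsumE phi p (s : seq J) : (forall v, addf (phi v)) -> uniq s ->
  (forall v, v \in dsupp p -> v \in s) ->
  dsum phi p = \sum_(v <- s) phi v (par v p).
Proof.
move=> phiD us ps; rewrite (bigID (mem (dsupp p)))/= [X in _ + X]big1 ?addr0.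
  rewrite -big_filter; apply: perm_big; apply: uniq_perm.
  - exact: fset_uniq.
  - exact: filter_uniq.
  by move=> v; rewrite mem_filter /= andb_idr//; exact: ps.
by move=> v; rewrite mem_dsupp negbK => /eqP->; exact: addf0 (phiD v).
Qed.

Lemma eq_dsum phi psi p : (forall v a, phi v a = psi v a) ->
  dsum phi p = dsum psi p.
Proof. by move=> E; apply: eq_bigr => v _; exact: E. Qed.

Lemma dsumD phi : (forall v, addf (phi v)) -> addf (dsum phi).
Proof.
move=> phiD p q.
have [s [us sp sq spq]] := dsum_seq2 p q (dsupp (p + q)).
rewrite !(dsumE phiD us)// -big_split; apply: eq_bigr => v _.
by rewrite parD phiD.
Qed.

Lemma dsumM phi p q : (forall v, addf (phi v)) ->
  dsum phi (p * q) = dsum (fun v a => phi v (a * q)) p +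
                     dsum (fun v a => phi v (p * a)) q.
Proof.
move=> phiD.
have [s [us sp sq spq]] := dsum_seq2 p q (dsupp (p * q)).
rewrite (dsumE phiD us)// (@dsumE (fun v a => phi v (a * q)) _ s)//; last first.
  by move=> v a b; rewrite mulrDl phiD.
rewrite (@dsumE (fun v a => phi v (p * a)) _ s)//; last first.
  by move=> v a b; rewrite mulrDr phiD.
rewrite -big_split; apply: eq_bigr => v _.
by rewrite parM phiD.
Qed.

Lemma dsum_split phi psi p :
  dsum (fun v a => phi v a + psi v a) p = dsum phi p + dsum psi p.
Proof. exact: big_split. Qed.

Lemma dsum_sum (I : Type) (s : seq I) (P : pred I) (F : I -> J -> C -> V) p :
  dsum (fun v a => \sum_(i <- s | P i) F i v a) p =
  \sum_(i <- s | P i) dsum (F i) p.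
Proof. exact: exchange_big. Qed.

Lemma dsum_const phi p : (forall v, par v p = 0) -> dsum phi p = 0.
Proof.
move=> p0; rewrite /dsum big_seq big1// => v.
by rewrite mem_dsupp p0 eqxx.
Qed.

(** Symmetry of second derivatives is used twice: to exchange the sums, and to see that a derivative
    of [p] involves no variable absent from [p]. *)
Lemma dsum_exch (F : J -> J -> C -> V) p : (forall v w, addf (F v w)) ->
  dsum (fun v a => dsum (F v) a) p = dsum (fun w b => dsum (fun v => F v w) b) p.
Proof.
move=> FD; rewrite /dsum.
have sub v u : u \in dsupp (par v p) -> u \in dsupp p.
  by rewrite !mem_dsupp parC; apply: contraNneq => ->; rewrite par0.
under eq_bigr => v _ do rewrite -/(dsum (F v) (par v p))
  (@dsumE (F v) _ (dsupp p) (FD v) (fset_uniq _) (sub v)).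
rewrite exchange_big; apply: eq_bigr => w _ /=.
rewrite -/(dsum (fun v => F v w) (par w p)).
rewrite (@dsumE (fun v => F v w) _ (dsupp p) (fun v => FD v w) (fset_uniq _) (sub w)).
by apply: eq_bigr => v _; rewrite parC.
Qed.

End Dsum.

Lemma dsum_morph (V W : zmodType) (h : V -> W) (phi : J -> C -> V) p : addf h ->
  h (dsum phi p) = dsum (fun v a => h (phi v a)) p.
Proof. by move=> hD; rewrite /dsum addf_sum. Qed.

End PdRing.

(** * Jet rings and weighted total derivatives *)

Section Mpow.
Variable d : nat.
Implicit Types (I K : multinom d) (a b : 'I_d).

Lemma mnm_ind (Q : multinom d -> Prop) : Q (@mnm0 d) ->
  (forall a I, Q I -> Q (mnm_add I (mnm1 a))) -> forall I, Q I.
Proof.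
move=> Q0 QS I; move: {2}(mdeg I) (leqnn (mdeg I)) => k.
elim: k I => [|k IH] I Ik.
  by move: Ik; rewrite leqn0 mdeg_eq0 => /eqP->.
have [->//|/eqP] := eqVneq I (@mnm0 d) => I0.
have [a Ia] : exists a, (0 < I a)%N.
  apply: contrapT => h; apply: I0; apply/mnmP => a; rewrite mnm0E.
  by apply/eqP; rewrite -leqn0 leqNgt; apply/negP => Ia; apply: h; exists a.
have aI : mnm_add (mnm_sub I (mnm1 a)) (mnm1 a) = I.
  by apply: submK; rewrite lep1mP -lt0n.
rewrite -aI; apply/QS/IH; move: Ik; rewrite -{1}aI mdegD mdeg1; lia.
Qed.

Section MpowT.
Variables (T : Type) (D : 'I_d -> T -> T).

Lemma mpow0 x : mpow D (@mnm0 d) x = x.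
Proof. by rewrite /mpow; elim: (enum 'I_d) => //= a s ->; rewrite mnm0E. Qed.

Lemma mpow_morph (S : Type) (D' : 'I_d -> S -> S) (h : T -> S) I x :
  (forall a y, h (D a y) = D' a (h y)) -> h (mpow D I x) = mpow D' I (h x).
Proof.
move=> hD; rewrite /mpow; elim: (enum 'I_d) => //= a s <-.
by elim: (I a) => //= k IH; rewrite hD IH.
Qed.

Lemma eq_mpow (D' : 'I_d -> T -> T) I x :
  (forall a y, D a y = D' a y) -> mpow D I x = mpow D' I x.
Proof. exact: (@mpow_morph _ D' id). Qed.

Hypothesis DC : forall a b x, D a (D b x) = D b (D a x).

Lemma mpowS a I x : mpow D (mnm_add I (mnm1 a)) x = D a (mpow D I x).
Proof.
have iterC b c k y : D b (iter k (D c) y) = iter k (D c) (D b y).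
  by elim: k => //= k IH; rewrite DC IH.
have foldC b (J : multinom d) s y :
    D b (foldr (fun a => iter (J a) (D a)) y s) =
    foldr (fun a => iter (J a) (D a)) (D b y) s.
  by elim: s => //= c s IH; rewrite iterC IH.
rewrite /mpow; have := mem_enum 'I_d a; rewrite inE.
elim: (enum 'I_d) (enum_uniq 'I_d) => //= b s IH /andP[bs us].
rewrite inE => /orP[/eqP ab|sa].
  rewrite -ab mnmDE mnm1E eqxx addn1 /=; congr (D a (iter _ _ _)).
  have {bs} : a \notin s by rewrite ab.
  elim: s {IH us} => //= c s IH; rewrite inE negb_or => /andP[ac sa].
  by rewrite mnmDE mnm1E (negPf ac) addn0 IH.
rewrite IH// mnmDE mnm1E; case: eqVneq => [ab|ab]; last by rewrite addn0 iterC.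
by rewrite -ab sa in bs.
Qed.

(** With [mpowS], a new factor may be peeled off on either side, although [mpow] composes its
    factors in a fixed order of the indices. *)
Lemma mpowSr a I x : mpow D (mnm_add I (mnm1 a)) x = mpow D I (D a x).
Proof. by rewrite mpowS (@mpow_morph _ D (D a)). Qed.

Lemma mpow_comm I a x : D a (mpow D I x) = mpow D I (D a x).
Proof. exact: mpow_morph. Qed.

End MpowT.

Lemma mpow_addf (V : zmodType) (D : 'I_d -> V -> V) I :
  (forall a, addf (D a)) -> addf (mpow D I).
Proof.
move=> DD x y; rewrite /mpow; elim: (enum 'I_d) => //= a s ->.
by elim: (I a) => //= k ->; rewrite DD.
Qed.

Lemma mpowN (B : pzRingType) (D : 'I_d -> B -> B) I x : (forall a, addf (D a)) ->
  (forall a b y, D a (D b y) = D b (D a y)) ->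
  mpow (fun a y => - D a y) I x = (-1) ^+ mdeg I * mpow D I x.
Proof.
move=> DD DC; elim/mnm_ind: I => [|a I IH].
  by rewrite !mpow0 mdeg0 mul1r.
rewrite !mpowS// => [|b c y]; last by rewrite !(addfN _ (DD _)) DC.
rewrite IH mdegD mdeg1 addn1 exprS mulN1r mulNr; congr (- _).
by rewrite -signr_odd; case: odd; rewrite ?mul1r ?mulN1r// (addfN _ (DD a)).
Qed.

End Mpow.

(* The structure shared by [Ahat] and by the polynomials in formal parameters
   with coefficients in [Ahat]. *)
Record jetRing (d n : nat) := JetRing {
  jr_base :> pdRing (jet d n);
  tdr : 'I_d -> jr_base -> jr_base;
  tdr_add : forall a, addf (tdr a);
  tdrM : forall a p q, tdr a (p * q) = tdr a p * q + p * tdr a q;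
  tdrC : forall a b p, tdr a (tdr b p) = tdr b (tdr a p);
  par_tdr : forall i I a p, par (i, I) (tdr a p) =
    tdr a (par (i, I) p) +
    (if (0 < I a)%N then par (i, mnm_sub I (mnm1 a)) p else 0) }.

Section JetRing.
Variables (d n : nat) (C : jetRing d n).
Implicit Types (p q : C) (a b : 'I_d) (i j l : 'I_n) (I K : multinom d).
Implicit Types (w : 'I_d -> C) (X Y : 'I_n -> C).
Local Notation jet := (jet d n).

(* [tdw w] is the total derivative of the factors of the elements of weight [w],
   i.e. those multiplied by a formal [e^{w.x}]. *)
Definition tdw w a p := w a * p + tdr a p.
Definition ntdw w a p := - tdw w a p.

(** Weights are to behave like formal parameters; this is what makes the operators [tdw w a] commute
    with each other. *)
Definition const_weight w :=
  forall a, (forall v, par v (w a) = 0) /\ (forall b, tdr b (w a) = 0).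

Lemma tdwD w a : addf (tdw w a).
Proof. by move=> p q; rewrite /tdw mulrDr tdr_add addrACA. Qed.

Lemma ntdwD w a : addf (ntdw w a).
Proof. by move=> p q; rewrite /ntdw tdwD opprD. Qed.

Lemma mtdwD w I : addf (mpow (tdw w) I).
Proof. exact: mpow_addf (@tdwD w). Qed.

Lemma mntdwD w I : addf (mpow (ntdw w) I).
Proof. exact: mpow_addf (@ntdwD w). Qed.

(** Weights add under products, as exponents do, so the Leibniz rule involves three weights. *)
Lemma tdwM w w' W a p q : (forall b, W b = w b + w' b) ->
  tdw W a (p * q) = tdw w a p * q + p * tdw w' a q.
Proof. by move=> WE; rewrite /tdw WE tdrM; ring. Qed.

Lemma tdrN a p : tdr a (- p) = - tdr a p. Proof. exact: addfN (@tdr_add _ _ _ _). Qed.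

Lemma tdwN w a p : tdw w a (- p) = - tdw w a p. Proof. exact: addfN (@tdwD _ _). Qed.

Section Constant.
Variable w : 'I_d -> C.
Hypothesis wc : const_weight w.

Lemma tdwC a b p : tdw w a (tdw w b p) = tdw w b (tdw w a p).
Proof.
rewrite /tdw !tdr_add !tdrM (wc a).2 (wc b).2 !mul0r !add0r tdrC; ring.
Qed.

Lemma ntdwC a b p : ntdw w a (ntdw w b p) = ntdw w b (ntdw w a p).
Proof. by rewrite /ntdw !tdwN tdwC. Qed.

Lemma par_tdw i I a p : par (i, I) (tdw w a p) = tdw w a (par (i, I) p) +
  (if (0 < I a)%N then par (i, mnm_sub I (mnm1 a)) p else 0).
Proof. by rewrite /tdw parD parM (wc a).1 mul0r add0r par_tdr addrA. Qed.

(** The commutator of the partial derivative in [u^i_I] with the total derivative is the partial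
    derivative in [u^i_{I - E_a}]; shifting the index by [E_a] gives the second term. The shift is
    injective and misses only indices with [I a = 0], where the commutator vanishes. *)
Lemma dsum_tdw (V : zmodType) (phi : jet -> C -> V) a p :
  (forall v, addf (phi v)) ->
  dsum phi (tdw w a p) = dsum (fun v c => phi v (tdw w a c)) p +
    dsum (fun v => phi (v.1, mnm_add v.2 (mnm1 a))) p.
Proof.
move=> phiD; pose sh (v : jet) : jet := (v.1, mnm_add v.2 (mnm1 a)).
have shI : injective sh.
  move=> [i I] [j K] E; have E1 : i = j := congr1 (fun v : jet => v.1) E.
  have E2 : mnm_add I (mnm1 a) = mnm_add K (mnm1 a) := congr1 (fun v : jet => v.2) E.
  by rewrite E1 (addIm E2).
have [s [us sp sq st]] := dsum_seq2 p (tdw w a p) (map sh (dsupp p)).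
rewrite (dsumE phiD us)// (@dsumE _ _ _ (fun v c => phi v (tdw w a c)) p s)//;
  last by move=> v c c'; rewrite tdwD phiD.
pose F (v : jet) := phi v (if (0 < v.2 a)%N then par (v.1, mnm_sub v.2 (mnm1 a)) p else 0).
transitivity (\sum_(v <- s) (phi v (tdw w a (par v p)) + F v)).
  by apply: eq_bigr => -[i I] _; rewrite par_tdw phiD.
rewrite big_split; congr (_ + _).
rewrite (bigID (mem (map sh (dsupp p))))/= [X in _ + X]big1 ?addr0 => [|v vs].
  rewrite -big_filter.
  have -> : dsum (fun v => phi (sh v)) p = \sum_(v <- map sh (dsupp p)) F v.
    rewrite big_map; apply: eq_bigr => -[i I] _.
    by rewrite /F /= mnmDE mnm1E eqxx addn1 /= addmK.
  apply: perm_big; apply: uniq_perm; first exact: filter_uniq.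
    by rewrite map_inj_uniq// fset_uniq.
  by move=> v; rewrite mem_filter andb_idr//; exact: st.
rewrite /F; case: ifP => [v0|_]; last exact: addf0 (phiD v).
have [->|pv] := eqVneq (par (v.1, mnm_sub v.2 (mnm1 a)) p) 0.
  exact: addf0 (phiD v).
case/negP: vs; apply/mapP; exists (v.1, mnm_sub v.2 (mnm1 a)).
  by rewrite -[_ \in _]/(_ \in dsupp p) mem_dsupp.
by case: v v0 {pv} => i I /= v0; rewrite /sh /= submK// lep1mP -lt0n.
Qed.

End Constant.
End JetRing.

(** * Evolutionary derivations and variational derivatives *)

Section JetCalculus.
Variables (d n : nat) (C : jetRing d n).
Implicit Types (p q f g x y : C) (a b : 'I_d) (i j l : 'I_n) (I K : multinom d).
Implicit Types (w W : 'I_d -> C) (X Y : 'I_n -> C) (u v : jet d n).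

Definition wadd w w' a := w a + w' a.

Lemma const_wadd w w' : const_weight w -> const_weight w' -> const_weight (wadd w w').
Proof.
move=> wc wc' a; split=> [v|b]; rewrite /wadd.
  by rewrite parD (wc a).1 (wc' a).1 addr0.
by rewrite tdr_add (wc a).2 (wc' a).2 addr0.
Qed.

Lemma eq_tdw w w' a p : w =1 w' -> tdw w a p = tdw w' a p.
Proof. by move=> ww; rewrite /tdw ww. Qed.

(* The evolutionary derivation of characteristic [X]. *)
Definition evol w X p := dsum (fun v x => mpow (tdw w) v.2 (X v.1) * x) p.

(* The higher Euler operator [x |-> \sum_I (- \partial)^I (x * dp/du^l_I)]; for
   [x = 1] it is the variational derivative. *)
Definition gvar w l x p :=
  dsum (fun v y => if v.1 == l then mpow (ntdw w) v.2 (x * y) else 0) p.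

Definition vari w l p := gvar w l 1 p.

Lemma evol_addf w X v : addf (fun x : C => mpow (tdw w) v.2 (X v.1) * x).
Proof. by move=> x y; rewrite mulrDr. Qed.

Lemma gvar_addf w l x v :
  addf (fun y : C => if v.1 == l then mpow (ntdw w) v.2 (x * y) else 0).
Proof. by move=> y z; case: eqP; rewrite ?addr0// mulrDr mntdwD. Qed.

Lemma evolD w X : addf (evol w X).
Proof. exact: dsumD (evol_addf w X). Qed.

Lemma evol0 w X : evol w X 0 = 0. Proof. exact: addf0 (@evolD _ _). Qed.

Lemma evolM w X p q : evol w X (p * q) = evol w X p * q + p * evol w X q.
Proof.
rewrite /evol dsumM; last exact: evol_addf.
rewrite (@dsum_morph _ _ _ _ (fun x => x * q))//; last by move=> ? ?; rewrite mulrDl.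
rewrite (@dsum_morph _ _ _ _ (fun x => p * x))//; last by move=> ? ?; rewrite mulrDr.
by congr (_ + _); apply: eq_dsum => v x; [exact: mulrA|exact: mulrCA].
Qed.

Lemma evol_const w X p : (forall v, par v p = 0) -> evol w X p = 0.
Proof. exact: dsum_const. Qed.

Lemma evol_constl w X c p : (forall v, par v c = 0) ->
  evol w X (c * p) = c * evol w X p.
Proof. by move=> c0; rewrite evolM evol_const// mul0r add0r. Qed.

Lemma eq_evol w w' X Y p : w =1 w' -> X =1 Y -> evol w X p = evol w' Y p.
Proof.
move=> ww XY; apply: eq_dsum => v x; rewrite XY; congr (_ * _).
by apply: eq_mpow => a y; exact: eq_tdw.
Qed.

Lemma evol_DX w X Y p : evol w (fun j => X j + Y j) p = evol w X p + evol w Y p.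
Proof.
by rewrite -dsum_split; apply: eq_dsum => v x; rewrite mtdwD mulrDl.
Qed.

(** The shifted sum in [dsum_tdw] is exactly the part of the Leibniz rule where the outer derivative
    falls on the prolonged characteristic. *)
Lemma evol_tdw w w' W X a p : const_weight w -> const_weight w' ->
  W =1 wadd w w' -> evol w X (tdw w' a p) = tdw W a (evol w X p).
Proof.
move=> wc wc' WE; rewrite /evol dsum_tdw//; last exact: evol_addf.
rewrite (@dsum_morph _ _ _ _ (tdw W a)); last exact: tdwD.
rewrite -dsum_split; apply: eq_dsum => v x.
rewrite (@tdwM _ _ _ w w')//= mpowS; last exact: tdwC.
by rewrite addrC.
Qed.

Lemma evol_ntdw w w' W X a p : const_weight w -> const_weight w' ->
  W =1 wadd w w' -> evol w X (ntdw w' a p) = ntdw W a (evol w X p).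
Proof.
move=> wc wc' WE.
by rewrite /ntdw (addfN _ (@evolD _ _)) (@evol_tdw w w' W).
Qed.

(** Each composite has a first-order part, where one field differentiates the characteristic of the
    other, and a second-order part symmetric in the two fields, which cancels. *)
Lemma evol_comm w w' W X Y p : const_weight w -> const_weight w' ->
  W =1 wadd w w' ->
  evol w X (evol w' Y p) - evol w' Y (evol w X p) =
  evol W (fun j => evol w X (Y j) - evol w' Y (X j)) p.
Proof.
move=> wc wc' WE.
have main w1 w2 X1 X2 : const_weight w1 -> const_weight w2 -> W =1 wadd w1 w2 ->
  evol w1 X1 (evol w2 X2 p) = evol W (fun j => evol w1 X1 (X2 j)) p +
    dsum (fun v x => dsum (fun u y => mpow (tdw w1) u.2 (X1 u.1) *
      mpow (tdw w2) v.2 (X2 v.1) * y) x) p.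
  move=> c1 c2 E; rewrite {2}/evol dsum_morph; last exact: evolD.
  rewrite -dsum_split; apply: eq_dsum => v x.
  rewrite evolM; congr (_ * _ + _).
    by apply: mpow_morph => a y; exact: evol_tdw.
  rewrite /evol dsum_morph; last by move=> ? ?; rewrite mulrDr.
  by apply: eq_dsum => u y; rewrite mulrCA mulrA.
rewrite (main w w')// (main w' w)//; last by move=> a; rewrite WE /wadd addrC.
rewrite dsum_exch; last by move=> v u x y; rewrite mulrDr.
have -> z1 z2 z3 z4 : z3 = z4 -> z1 + z3 - (z2 + z4) = z1 - z2 :> C.
- by move=> ->; rewrite opprD addrACA subrr addr0.
- apply/eqP; rewrite subr_eq -evol_DX; apply/eqP.
  by apply: eq_evol => // j; rewrite subrK.
- by apply: eq_dsum => v x; apply: eq_dsum => u y; congr (_ * _); rewrite mulrC.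
Qed.

Lemma gvarD w l x : addf (gvar w l x).
Proof. exact: dsumD (@gvar_addf w l x). Qed.

Lemma gvarDl w l p : addf (fun x => gvar w l x p).
Proof.
move=> x y; rewrite -dsum_split; apply: eq_dsum => v z.
by case: eqP; rewrite ?addr0// mulrDl mntdwD.
Qed.

Lemma gvarM w l x p q : gvar w l x (p * q) = gvar w l (x * p) q + gvar w l (x * q) p.
Proof.
rewrite /gvar dsumM; last exact: gvar_addf.
by rewrite addrC; congr (_ + _); apply: eq_dsum => v y; rewrite mulrA// mulrAC.
Qed.

Lemma gvar_const w l x p : (forall v, par v p = 0) -> gvar w l x p = 0.
Proof. exact: dsum_const. Qed.

(** Integration by parts: after reindexing, what remains under the outer derivatives is
    [x * tdw w' a y - tdw W a (x * y)], that is [- tdw w a x * y]. *)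
Lemma gvar_tdw w w' W l a x p : const_weight w -> const_weight w' ->
  W =1 wadd w w' -> gvar W l x (tdw w' a p) = gvar W l (ntdw w a x) p.
Proof.
move=> wc wc' WE.
have Wc : const_weight W.
  by move=> b; rewrite WE; exact: const_wadd.
rewrite /gvar dsum_tdw//; last exact: gvar_addf.
rewrite -dsum_split; apply: eq_dsum => v y /=.
case: eqP => _; last by rewrite addr0.
rewrite mpowSr; last exact: ntdwC.
rewrite -mntdwD {2}/ntdw (@tdwM _ _ _ w w')//; congr (mpow _ _ _).
by rewrite /ntdw mulNr opprD addrCA subrr addr0.
Qed.

Lemma gvar_ntdw w w' W l a x p : const_weight w -> const_weight w' ->
  W =1 wadd w w' -> gvar W l x (ntdw w' a p) = gvar W l (tdw w a x) p.
Proof.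
move=> wc wc' WE; rewrite /ntdw (addfN _ (@gvarD _ _ _)) (@gvar_tdw w w')//.
by rewrite /ntdw (addfN _ (@gvarDl _ _ _)) opprK.
Qed.

Lemma gvar_mtdw w w' W l I x p : const_weight w -> const_weight w' ->
  W =1 wadd w w' ->
  gvar W l x (mpow (tdw w') I p) = gvar W l (mpow (ntdw w) I x) p.
Proof.
move=> wc wc' WE; elim/mnm_ind: I x => [|a I IH] x; first by rewrite !mpow0.
rewrite mpowS; last exact: tdwC.
rewrite (@gvar_tdw w w')// IH mpowSr//; exact: ntdwC.
Qed.

Lemma gvar_mntdw w w' W l I x p : const_weight w -> const_weight w' ->
  W =1 wadd w w' ->
  gvar W l x (mpow (ntdw w') I p) = gvar W l (mpow (tdw w) I x) p.
Proof.
move=> wc wc' WE; elim/mnm_ind: I x => [|a I IH] x; first by rewrite !mpow0.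
rewrite mpowS; last exact: ntdwC.
rewrite (@gvar_ntdw w w')// IH mpowSr//; exact: tdwC.
Qed.

(** By parts, the derivative falls on [1], which has weight zero and is annihilated. *)
Lemma vari_tdw w l a p : const_weight w -> vari w l (tdw w a p) = 0.
Proof.
move=> wc; rewrite /vari (@gvar_tdw (fun=> 0) w).
- have -> : ntdw (fun=> 0) a (1 : C) = 0.
    rewrite /ntdw /tdw mul0r add0r.
    have := tdrM a (1 : C) 1; rewrite !mulr1 mul1r => E.
    by rewrite (_ : tdr a 1 = 0) ?oppr0//; apply: (addrI (tdr a 1)); rewrite -E addr0.
  exact: addf0 (@gvarDl _ _ _).
- move=> b; split=> [v|c]; first exact: par0.
  exact: addf0 (@tdr_add _ _ _ _).
- exact: wc.
- by move=> b; rewrite /wadd add0r.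
Qed.

Definition hvar W w l X p :=
  dsum (fun v y => if v.1 == l then mpow (ntdw W) v.2 (evol w X y) else 0) p.

Lemma dsum_gvar W w l X p :
  dsum (fun v y => gvar W l (mpow (tdw w) v.2 (X v.1)) y) p = hvar W w l X p.
Proof.
rewrite /gvar dsum_exch; last by move=> v u; exact: gvar_addf.
apply: eq_dsum => u y; case: eqP => _; last by rewrite /dsum big1.
by rewrite /evol (dsum_morph _ _ (@mntdwD _ _ _ _ _)).
Qed.

Lemma evol_vari w w' W X l p : const_weight w -> const_weight w' ->
  W =1 wadd w w' -> evol w X (vari w' l p) = hvar W w l X p.
Proof.
move=> wc wc' WE; rewrite /vari /gvar dsum_morph; last exact: evolD.
apply: eq_dsum => v y; case: eqP => _; last exact: evol0.
by rewrite mul1r; apply: mpow_morph => a x; exact: evol_ntdw.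
Qed.

(** The left side is the adjoint of the Frechet derivative of the variational derivative, applied to
    [X]. As [evol_vari] gives the same value to the Frechet derivative itself, this is the Helmholtz
    self-adjointness condition. *)
Lemma sum_gvar_vari W w w' l X p : const_weight w -> const_weight w' ->
  W =1 wadd w w' ->
  \sum_i gvar W l (X i) (vari w' i p) = hvar W w l X p.
Proof.
move=> wc wc' WE; rewrite -dsum_gvar.
have E i : gvar W l (X i) (vari w' i p) =
    dsum (fun v y => if v.1 == i then gvar W l (mpow (tdw w) v.2 (X i)) y else 0) p.
  rewrite {1}/vari {2}/gvar dsum_morph; last exact: gvarD.
  apply: eq_dsum => v y; case: eqP => _; last exact: addf0 (@gvarD _ _ _).
  by rewrite mul1r (@gvar_mntdw w w').
under eq_bigr do rewrite E.
rewrite -dsum_sum; apply: eq_dsum => v y.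
by rewrite (bigD1 v.1)//= eqxx big1 ?addr0// => i /negPf; rewrite eq_sym => ->.
Qed.

(** The two terms correspond to differentiating the partial derivatives of [p] or the characteristic
    [X]; the second is the adjoint Frechet derivative of [X] applied to the variational derivative
    of [p]. *)
Lemma vari_evol w w' W X l p : const_weight w -> const_weight w' ->
  W =1 wadd w w' ->
  vari W l (evol w X p) = hvar W w l X p + \sum_j gvar W l (vari w' j p) (X j).
Proof.
move=> wc wc' WE; rewrite /vari {1}/evol dsum_morph; last exact: gvarD.
rewrite (@eq_dsum _ _ _ _ (fun v y => gvar W l (mpow (tdw w) v.2 (X v.1)) y +
    gvar W l (mpow (ntdw w') v.2 y) (X v.1))) => [|v y]; last first.
  rewrite gvarM !mul1r (@gvar_mtdw w' w)// => a; by rewrite WE /wadd addrC.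
rewrite dsum_split dsum_gvar; congr (_ + _).
have E j : gvar W l (gvar w' j 1 p) (X j) =
    dsum (fun v y => if v.1 == j then gvar W l (mpow (ntdw w') v.2 y) (X j) else 0) p.
  rewrite {2}/gvar (@dsum_morph _ _ _ _ (fun z => gvar W l z (X j))); last exact: gvarDl.
  apply: eq_dsum => v y; case: eqP => _; first by rewrite mul1r.
  exact: addf0 (@gvarDl _ _ _).
under [RHS]eq_bigr do rewrite E.
rewrite -dsum_sum; apply: eq_dsum => v y.
by rewrite (bigD1 v.1)//= eqxx big1 ?addr0// => i /negPf; rewrite eq_sym => ->.
Qed.

End JetCalculus.

(** * Hamiltonian vector fields *)

Record jetMor (d n : nat) (B C : jetRing d n) := JetMor {
  jm :> {rmorphism B -> C};
  jm_par : forall v p, jm (par v p) = par v (jm p);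
  jm_tdr : forall a p, jm (tdr a p) = tdr a (jm p) }.

Section Bivector.
Variables (d n : nat) (B C : jetRing d n) (io : jetMor B C).
Variable P : 'M[mpoly d B]_n.
Implicit Types (p q f g x y : C) (a b : 'I_d) (i j k l : 'I_n).
Implicit Types (w W : 'I_d -> C) (X Y xi eta : 'I_n -> C) (Q : mpoly d B).

Definition act w Q x :=
  \sum_(S <- msupp Q) io (mcoeff S Q) * mpow (tdw w) S x.

Definition hamil w xi k := \sum_i act w (P k i) (xi i).

Lemma actD w Q : addf (act w Q).
Proof.
by move=> x y; rewrite -big_split; apply: eq_bigr => S _; rewrite mtdwD mulrDr.
Qed.

Lemma eq_act w w' Q x : w =1 w' -> act w Q x = act w' Q x.
Proof.
move=> ww; apply: eq_bigr => S _; congr (_ * _).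
by apply: eq_mpow => a y; exact: eq_tdw.
Qed.

Lemma hamilD w xi eta k :
  hamil w (fun i => xi i + eta i) k = hamil w xi k + hamil w eta k.
Proof. by rewrite -big_split; apply: eq_bigr => i _; rewrite actD. Qed.

Lemma hamilN w xi k : hamil w (fun i => - xi i) k = - hamil w xi k.
Proof. by rewrite -sumrN; apply: eq_bigr => i _; rewrite (addfN _ (@actD _ _)). Qed.

Lemma eq_hamil w w' xi eta k : w =1 w' -> xi =1 eta ->
  hamil w xi k = hamil w' eta k.
Proof. by move=> ww xe; apply: eq_bigr => i _; rewrite xe; exact: eq_act. Qed.

Lemma evol_hamil w w' W X eta k : const_weight w -> const_weight w' ->
  W =1 wadd w w' -> evol w X (hamil w' eta k) =
  \sum_j \sum_(S <- msupp (P k j))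
     evol w X (io (mcoeff S (P k j))) * mpow (tdw w') S (eta j) +
  hamil W (fun j => evol w X (eta j)) k.
Proof.
move=> wc wc' WE; rewrite (addf_sum _ _ _ (@evolD _ _ _ _ _)) -big_split.
apply: eq_bigr => j _; rewrite (addf_sum _ _ _ (@evolD _ _ _ _ _)) -big_split.
apply: eq_bigr => S _ /=; rewrite evolM; congr (_ + _ * _).
by apply: mpow_morph => a y; exact: evol_tdw.
Qed.

(** The condition that the adjoint of [P] is [- P], expressed through the action of the operators
    rather than their coefficients. *)
Definition skew_adjoint := forall w i j x, const_weight w ->
  \sum_(S <- msupp (P j i)) mpow (ntdw w) S (x * io (mcoeff S (P j i))) =
  - act w (P i j) x.

(* The characteristic of the derivation [h |-> {f, {g, h}} - {g, {f, h}} -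
   {{f, g}, h}], for [f] and [g] of weights [w] and [w'] and of variational
   derivatives [xi] and [eta]; cf. [jacobiator]. *)
Definition jac w w' xi eta k :=
  \sum_j \sum_(S <- msupp (P k j))
     evol w (hamil w xi) (io (mcoeff S (P k j))) * mpow (tdw w') S (eta j)
  - \sum_i \sum_(S <- msupp (P k i))
     evol w' (hamil w' eta) (io (mcoeff S (P k i))) * mpow (tdw w) S (xi i)
  - hamil (wadd w w') (fun l => \sum_j \sum_i \sum_(S <- msupp (P j i))
     gvar (wadd w w') l (eta j * mpow (tdw w) S (xi i)) (io (mcoeff S (P j i)))) k.

Hypothesis Pskew : skew_adjoint.

(** Product rule: either the coefficients of [P] are differentiated, or [xi] is; in the second case
    [P] passes to [eta] by adjunction, with a sign. *)
Lemma sum_gvar_hamil w w' l xi eta : const_weight w -> const_weight w' ->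
  \sum_j gvar (wadd w w') l (eta j) (hamil w xi j) =
  \sum_j \sum_i \sum_(S <- msupp (P j i))
     gvar (wadd w w') l (eta j * mpow (tdw w) S (xi i)) (io (mcoeff S (P j i)))
  - \sum_i gvar (wadd w w') l (hamil w' eta i) (xi i).
Proof.
move=> wc wc'.
have -> : \sum_i gvar (wadd w w') l (hamil w' eta i) (xi i) =
    - \sum_j \sum_i \sum_(S <- msupp (P j i)) gvar (wadd w w') l
        (mpow (ntdw w') S (eta j * io (mcoeff S (P j i)))) (xi i).
  rewrite exchange_big -sumrN; apply: eq_bigr => i _.
  rewrite /hamil (addf_sum _ _ _ (@gvarDl _ _ _ _ _ _)) -sumrN.
  apply: eq_bigr => j _; rewrite -(addf_sum _ _ _ (@gvarDl _ _ _ _ _ _)).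
  by rewrite Pskew// (addfN _ (@gvarDl _ _ _ _ _ _)) opprK.
rewrite opprK -big_split; apply: eq_bigr => j _.
rewrite (addf_sum _ _ _ (@gvarD _ _ _ _ _ _)) -big_split; apply: eq_bigr => i _.
rewrite (addf_sum _ _ _ (@gvarD _ _ _ _ _ _)) -big_split; apply: eq_bigr => S _ /=.
rewrite gvarM addrC (@gvar_mtdw _ _ _ w' w)// => a; exact: addrC.
Qed.

(** Expanding the third term by [vari_evol] produces the Frechet derivatives of [xi] and [eta] in
    adjoint form. Self-adjointness matches them with those in the first two terms, and only
    derivatives of the coefficients of [P] survive. *)
Lemma jacobiator w w' f g k : const_weight w -> const_weight w' ->
  let xi i := vari w i f in let eta j := vari w' j g in
  evol w (hamil w xi) (hamil w' eta k) - evol w' (hamil w' eta) (hamil w xi k)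
  - hamil (wadd w w') (fun l => vari (wadd w w') l (evol w (hamil w xi) g)) k
  = jac w w' xi eta k.
Proof.
move=> wc wc' xi eta.
rewrite (@evol_hamil w w' (wadd w w'))// (@evol_hamil w' w (wadd w w'))//; last first.
  by move=> a; exact: addrC.
rewrite [X in _ - X = _](_ : _ =
    hamil (wadd w w') (fun j => evol w (hamil w xi) (eta j)) k
  + hamil (wadd w w') (fun l => \sum_j \sum_i \sum_(S <- msupp (P j i))
     gvar (wadd w w') l (eta j * mpow (tdw w) S (xi i)) (io (mcoeff S (P j i)))) k
  - hamil (wadd w w') (fun j => evol w' (hamil w' eta) (xi j)) k); last first.
  rewrite -hamilN -!hamilD; apply: eq_hamil => // l.
  rewrite (@vari_evol _ _ _ w w')// sum_gvar_hamil// addrA.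
  rewrite (@evol_vari _ _ _ w w' (wadd w w'))//.
  rewrite (@evol_vari _ _ _ w' w (wadd w w'))//; last by move=> a; exact: addrC.
  by congr (_ + _ - _); apply: sum_gvar_vari => // a; exact: addrC.
rewrite /jac; move: (\sum_j _) (hamil _ _ _) (\sum_i _) (hamil _ _ _) (hamil _ _ _).
by move=> *; ring.
Qed.

End Bivector.

(** * Examples of jet rings *)

Lemma mcoeff_map_addf (k : nat) (R S : nzRingType) (h : R -> S) (p : mpoly k R) m :
  addf h -> mcoeff m (map_mpoly h p) = h (mcoeff m p).
Proof.
move=> hD; pose h' : {additive R -> S} := HB.pack h
  (GRing.isZmodMorphism.Build R S h (fun x y => etrans (hD x (- y))
    (congr1 (fun z => h x + z) (addfN y hD)))).
exact: (mcoeff_map_mpoly h').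
Qed.

Section PolynomialJets.
Variables (d n k : nat) (B : jetRing d n).
Local Notation MP := (mpoly k B).
Implicit Types (p q : MP) (v : jet d n) (a : 'I_d).

Definition mder (D : B -> B) : MP -> MP := map_mpoly D.

Section Derivation.
Variable D : B -> B.
Hypothesis DD : addf D.
Hypothesis DM : forall x y, D (x * y) = D x * y + x * D y.

Lemma mcoeff_mder m p : mcoeff m (mder D p) = D (mcoeff m p).
Proof. exact: mcoeff_map_addf. Qed.

Lemma mderD : addf (mder D).
Proof. by move=> p q; apply/mpolyP => m; rewrite !(mcoeff_mder, mcoeffD) DD. Qed.

Lemma mderM p q : mder D (p * q) = mder D p * q + p * mder D q.
Proof.
apply/mpolyP => m; rewrite mcoeffD mcoeff_mder !mcoeffM addf_sum// -big_split.
by apply: eq_bigr => x _; rewrite DM !mcoeff_mder.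
Qed.

Lemma mderC (c : B) : mder D (mpolyC k c) = mpolyC k (D c).
Proof.
apply/mpolyP => m; rewrite mcoeff_mder !mcoeffC; case: eqP; rewrite ?mulr1//.
by rewrite !mulr0 addf0.
Qed.

Lemma mderX (I : multinom k) : mder D (mpolyX B I) = 0.
Proof.
apply/mpolyP => m; rewrite mcoeff_mder mcoeffX mcoeff0.
have D0 := addf0 DD; case: eqP => //= _.
have := DM 1 1; rewrite !mulr1 mul1r => E.
by apply: (addrI (D 1)); rewrite -E addr0.
Qed.

End Derivation.

Lemma mder_comm (D D' : B -> B) p : addf D -> addf D' ->
  (forall x, D (D' x) = D' (D x)) ->
  mder D (mder D' p) = mder D' (mder D p).
Proof.
move=> DD DD' DC; apply/mpolyP => m.
by rewrite (mcoeff_mder DD) !(mcoeff_mder DD') (mcoeff_mder DD) DC.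
Qed.

Lemma mder_fin p : finite_set [set v | mder (par v) p != 0].
Proof.
pose s := flatten [seq (dsupp (mcoeff m p) : seq (jet d n)) | m <- msupp p].
apply: (@sub_finite_set _ _ [set` s]); last exact: finite_seq.
move=> v /= pv; apply: contrapT => vs; case/negP: pv; apply/eqP/mpolyP => m.
rewrite mcoeff_mder ?mcoeff0; last exact: par_add.
apply/eqP; apply: contrapT => /negP pm; apply: vs; apply/flatten_mapP; exists m.
  by rewrite mcoeff_msupp; apply: contraNneq pm => ->; rewrite par0.
by rewrite -[_ \in _]/(_ \in dsupp _) mem_dsupp.
Qed.

Definition mpoly_pdRing : pdRing (jet d n) :=
  @PdRing (jet d n) MP (fun v => mder (par v))
    (fun v => mderD (@par_add _ _ v))
    (fun v => mderM (@par_add _ _ v) (@parM _ _ v))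
    (fun u v p => mder_comm p (@par_add _ _ u) (@par_add _ _ v) (parC u v))
    mder_fin.

Lemma mder_par_tdr i (I : multinom d) a (p : MP) :
  mder (par (i, I)) (mder (tdr a) p) =
  mder (tdr a) (mder (par (i, I)) p) +
  (if (0 < I a)%N then mder (par (i, mnm_sub I (mnm1 a))) p else 0).
Proof.
have Ep v := mcoeff_mder (@par_add _ B v).
have Et := mcoeff_mder (@tdr_add _ _ B a).
apply/mpolyP => m; rewrite mcoeffD (Ep (i, I)) 2!Et (Ep (i, I)) par_tdr.
by congr (_ + _); case: ifP => _; [rewrite Ep|rewrite mcoeff0].
Qed.

Definition mpoly_jetRing : jetRing d n :=
  @JetRing d n mpoly_pdRing (fun a => mder (tdr a))
    (fun a => mderD (@tdr_add _ _ _ a))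
    (fun a => mderM (@tdr_add _ _ _ a) (@tdrM _ _ _ a))
    (fun a b p => mder_comm p (@tdr_add _ _ _ a) (@tdr_add _ _ _ b) (tdrC a b))
    mder_par_tdr.

Definition mpolyC_jetMor : jetMor B mpoly_jetRing :=
  @JetMor d n B mpoly_jetRing (@mpolyC k B : {rmorphism B -> MP})
    (fun v c => esym (mderC (@par_add _ _ v) c))
    (fun a c => esym (mderC (@tdr_add _ _ _ a) c)).

Lemma const_weightX (w : 'I_d -> MP) :
  (forall a, exists I, w a = mpolyX B I) ->
  @const_weight d n mpoly_jetRing w.
Proof.
move=> wX a; have [I ->] := wX a; split=> [v|b]; apply: mderX.
- exact: par_add.
- exact: parM.
- exact: tdr_add.
- exact: tdrM.
Qed.

End PolynomialJets.

Section TotalDerivative.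
Variables (d n : nat) (C : pdRing (jet d n)) (uv : jet d n -> C).
Hypothesis par_uv : forall u v, par u (uv v) = (u == v)%:R.
Implicit Types (f g : C) (a b : 'I_d) (i j : 'I_n) (u v : jet d n).

Definition jshift a v : jet d n := (v.1, mnm_add v.2 (mnm1 a)).

Definition total a f := dsum (fun v x => uv (jshift a v) * x) f.

Lemma total_addf a v : addf (fun x => uv (jshift a v) * x).
Proof. by move=> x y; rewrite mulrDr. Qed.

Lemma total_add a : addf (total a).
Proof. exact: dsumD (total_addf a). Qed.

Lemma total_const a f : (forall v, par v f = 0) -> total a f = 0.
Proof. exact: dsum_const. Qed.

Lemma totalM a f g : total a (f * g) = total a f * g + f * total a g.
Proof.
rewrite /total dsumM; last exact: total_addf.
rewrite (@dsum_morph _ _ _ _ (fun x => x * g)); last by move=> x y; rewrite mulrDl.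
rewrite (@dsum_morph _ _ _ _ (fun x => f * x)); last by move=> x y; rewrite mulrDr.
congr (_ + _); apply: eq_dsum => v x; [exact: mulrA|exact: mulrCA].
Qed.

Lemma total_uv a v : total a (uv v) = uv (jshift a v).
Proof.
rewrite /total (@dsumE _ _ _ _ _ [:: v])//.
- by rewrite big_seq1 par_uv eqxx mulr1.
- exact: total_addf.
- move=> u; rewrite mem_dsupp par_uv.
  by have [->|_] := eqVneq u v; rewrite ?mem_head// eqxx.
Qed.

Lemma jshiftC a b v : jshift a (jshift b v) = jshift b (jshift a v).
Proof. by rewrite /jshift /= -!addmA [mnm_add (mnm1 a) _]addmC. Qed.

(** Each composite splits into a first-order sum, symmetric because index shifts commute, and a
    second-order sum, symmetric by [dsum_exch]. *)
Lemma totalC a b f : total a (total b f) = total b (total a f).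
Proof.
have main c e : total c (total e f) =
    dsum (fun v x => uv (jshift c (jshift e v)) * x) f +
    dsum (fun v x => dsum (fun u y =>
      uv (jshift e v) * (uv (jshift c u) * y)) x) f.
  rewrite {2}/total dsum_morph; last exact: total_add.
  rewrite -dsum_split; apply: eq_dsum => v x.
  rewrite totalM total_uv; congr (_ + _).
  rewrite /total (@dsum_morph _ _ _ _ (fun y => _ * y))//.
  by move=> y z; rewrite mulrDr.
rewrite !main; congr (_ + _).
  by apply: eq_dsum => v x; rewrite jshiftC.
rewrite dsum_exch; last by move=> v u x y; rewrite !mulrDr.
by apply: eq_dsum => v x; apply: eq_dsum => u y; rewrite mulrCA.
Qed.

(** The extra term comes from differentiating the factor [uv (jshift a v)] itself, which is the
    variable [(i, I)] for at most one [v]. *)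
Lemma par_total i (I : multinom d) a f : par (i, I) (total a f) =
  total a (par (i, I) f) +
  (if (0 < I a)%N then par (i, mnm_sub I (mnm1 a)) f else 0).
Proof.
rewrite {1}/total dsum_morph; last exact: par_add.
rewrite (@eq_dsum _ _ _ _ (fun v x =>
   ((i, I) == jshift a v)%:R * x + uv (jshift a v) * par (i, I) x)); last first.
  by move=> v x; rewrite parM par_uv.
rewrite dsum_split addrC; congr (_ + _).
  rewrite /total (@dsumE _ _ _ _ _ (dsupp f) (total_addf a) (fset_uniq _)).
    by apply: eq_bigr => v _; rewrite [par v (par _ _)]parC.
  by move=> v; rewrite !mem_dsupp parC; apply: contraNneq => ->; rewrite par0.
case: ifP => Ia; last first.
  rewrite /dsum big1// => v _; case: eqP => [E|]; last by rewrite mul0r.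
  have E' : I a = (v.2 a).+1.
    have := congr1 (fun v : jet d n => v.2 a) E.
    by rewrite /= mnmDE mnm1E eqxx addn1.
  by rewrite E' in Ia.
pose v0 : jet d n := (i, mnm_sub I (mnm1 a)).
have v0E : jshift a v0 = (i, I) by rewrite /jshift /= submK// lep1mP -lt0n.
have shI v : jshift a v0 = jshift a v -> v0 = v.
  move=> E; have E1 : v0.1 = v.1 := congr1 (fun v : jet d n => v.1) E.
  have E2 : mnm_add v0.2 (mnm1 a) = mnm_add v.2 (mnm1 a) :=
    congr1 (fun v : jet d n => v.2) E.
  have {}E2 := addIm E2.
  by case: v E1 E2 {E} => j K /= <- <-.
rewrite (@dsumE _ _ _ _ _ (undup (v0 :: (dsupp f : seq _)))).
- rewrite (bigD1_seq v0) ?undup_uniq ?mem_undup ?mem_head//= -v0E eqxx mul1r.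
  rewrite big1 ?addr0// => v vv0; case: eqP => [/shI E|_]; last exact: mul0r.
  by rewrite E eqxx in vv0.
- by move=> v x y; rewrite mulrDr.
- exact: undup_uniq.
- by move=> v vf; rewrite mem_undup inE -[_ \in _]/(v \in dsupp f) vf orbT.
Qed.

End TotalDerivative.

Section DifferentialPolynomialJets.
Variables (d : nat) (R : realType) (n : nat) (U : chart R n).
Local Notation A := (Ahat d U).

Definition Ahat_pdRing : pdRing (jet d n) :=
  @PdRing (jet d n) A (@pd d R n U) (@pdD d R n U) (@pdM d R n U)
    (@pd_comm d R n U) (@finite_pd d R n U).

Definition Ahat_jetRing : jetRing d n :=
  @JetRing d n Ahat_pdRing (@td d R n U)
    (@total_add d n Ahat_pdRing (uvar U))
    (@totalM d n Ahat_pdRing (uvar U))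
    (@totalC d n Ahat_pdRing (uvar U) (@pd_uvar d R n U))
    (@par_total d n Ahat_pdRing (uvar U) (@pd_uvar d R n U)).

Lemma td_uvar (a : 'I_d) (v : jet d n) : td a (uvar U v) = uvar U (jshift a v).
Proof. exact: (@total_uv d n Ahat_pdRing (uvar U) (@pd_uvar d R n U)). Qed.

Lemma td_realc (a : 'I_d) (c : R) : td a (realc d U c) = 0.
Proof.
exact: (@total_const d n Ahat_pdRing (uvar U) a _ (fun v => pd_realc U v c)).
Qed.

End DifferentialPolynomialJets.

(** * Symbols of differential operators *)

Section MonomialSums.
Variables (k : nat) (R : nzRingType) (V : zmodType).
Implicit Types (p q : mpoly k R) (h : multinom k -> R -> V).

Definition msum h p := \sum_(m <- msupp p) h m (mcoeff m p).

Lemma msumE h p (s : seq (multinom k)) : (forall m, addf (h m)) -> uniq s ->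
  {subset msupp p <= s} -> msum h p = \sum_(m <- s) h m (mcoeff m p).
Proof.
move=> hD us ps; rewrite (bigID (mem (msupp p)))/= [X in _ + X]big1 ?addr0.
  rewrite -big_filter; apply: perm_big; apply: uniq_perm.
  - exact: msupp_uniq.
  - exact: filter_uniq.
  by move=> m; rewrite mem_filter /= andb_idr//; exact: ps.
by move=> m /memN_msupp_eq0 ->; exact: addf0 (hD m).
Qed.

Lemma msumD h : (forall m, addf (h m)) -> addf (msum h).
Proof.
move=> hD p q; pose s := undup (msupp p ++ msupp q ++ msupp (p + q)).
have us : uniq s := undup_uniq _.
rewrite !(msumE hD us) => [|m pm|m pm|m pm];
  try by rewrite mem_undup !mem_cat pm ?orbT.
by rewrite -big_split; apply: eq_bigr => m _; rewrite mcoeffD hD.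
Qed.

Lemma msumZX h (c : R) m : (forall m, addf (h m)) ->
  msum h (c *: mpolyX R m) = h m c.
Proof.
move=> hD; rewrite (@msumE _ _ [:: m])//.
  by rewrite big_seq1 mcoeffZ mcoeffX eqxx mulr1.
by move=> x /msuppZ_le; rewrite msuppX.
Qed.

Lemma mpoly_addf_eq (F G : mpoly k R -> V) : addf F -> addf G ->
  (forall c m, F (c *: mpolyX R m) = G (c *: mpolyX R m)) -> F =1 G.
Proof.
by move=> FD GD FG p; rewrite (mpolyE p) !addf_sum//; apply: eq_bigr => m _.
Qed.

End MonomialSums.

Section Symbols.
Variables (d n : nat) (B : jetRing d n).
Local Notation MP := (mpoly d B).
Implicit Types (a : 'I_d) (I K S T : multinom d).

Definition lam a : MP := mpolyX B (mnm1 a).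
Definition lamd a (p : MP) : MP := lam a * p + mder (tdr a) p.
Definition nlamd a (p : MP) : MP := - lamd a p.

Lemma mderZX (D : B -> B) (c : B) I : addf D ->
  (forall x y : B, D (x * y) = D x * y + x * D y) ->
  mder D (c *: mpolyX B I : MP) = D c *: mpolyX B I.
Proof.
by move=> DD DM; rewrite -!mul_mpolyC mderM// mderX// mulr0 addr0 mderC.
Qed.

Section Act.
Variables (C : jetRing d n) (io : jetMor B C).
Variable w : 'I_d -> C.
Hypothesis wc : const_weight w.
Implicit Types (Q : MP) (x : C).

Lemma act_addf x I : addf (fun c : B => io c * mpow (tdw w) I x).
Proof. by move=> b c; rewrite rmorphD mulrDl. Qed.

Lemma actDl x : addf (fun Q => act io w Q x).
Proof. exact: msumD (act_addf x). Qed.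

Lemma actZX c I x : act io w (c *: mpolyX B I : MP) x = io c * mpow (tdw w) I x.
Proof. exact: msumZX (act_addf x). Qed.

Lemma actZ c Q x : act io w (c *: Q) x = io c * act io w Q x.
Proof.
move: Q; apply: mpoly_addf_eq => [p q|p q|b I].
- by rewrite scalerDr actDl.
- by rewrite actDl mulrDr.
- by rewrite scalerA !actZX rmorphM mulrA.
Qed.

Lemma actCM c Q x : act io w (mpolyC d c * Q) x = io c * act io w Q x.
Proof. by rewrite mul_mpolyC actZ. Qed.

Lemma actC c x : act io w (mpolyC d c) x = io c * x.
Proof.
by rewrite -[mpolyC d c]mulr1 actCM -mpolyX0 -[mpolyX _ _]scale1r actZX rmorph1
  mul1r mpow0.
Qed.

(** On symbols, multiplication by [lam a] composes with a derivative on the right, whereas [lamd a]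
    composes with it on the left. *)
Lemma act_lam a Q x : act io w (lam a * Q) x = act io w Q (tdw w a x).
Proof.
move: Q; apply: mpoly_addf_eq => [p q|p q|b I].
- by rewrite mulrDr actDl.
- by rewrite actDl.
- rewrite -scalerAr /lam -mpolyXD addmC !actZX mpowSr//; exact: tdwC.
Qed.

Lemma act_lamd a Q x : act io w (lamd a Q) x = tdw w a (act io w Q x).
Proof.
move: Q; apply: mpoly_addf_eq => [p q|p q|b I].
- rewrite /lamd mulrDr mderD; last exact: tdr_add.
  by rewrite addrACA actDl.
- by rewrite actDl tdwD.
- rewrite /lamd actDl act_lam mderZX; [|exact: tdr_add|exact: tdrM].
  rewrite !actZX /tdw tdrM jm_tdr -mpow_comm; last exact: tdwC.
  by rewrite /tdw; ring.
Qed.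

Lemma act_mpow_lamd I Q x :
  act io w (mpow lamd I Q) x = mpow (tdw w) I (act io w Q x).
Proof. by apply: (mpow_morph (h := fun Q => act io w Q x)) => a y; exact: act_lamd. Qed.

Lemma act_mpow_nlamd I Q x :
  act io w (mpow nlamd I Q) x =
  mpow (ntdw w) I (act io w Q x).
Proof.
apply: (mpow_morph (h := fun Q => act io w Q x)) => a y.
by rewrite /nlamd (addfN _ (@actDl _)) act_lamd.
Qed.

End Act.

Definition polyB := mpoly_jetRing d B.
Definition polyC : jetMor B polyB := mpolyC_jetMor d B.

Lemma lam_const : @const_weight d n polyB lam.
Proof. by apply: const_weightX => a; exists (mnm1 a). Qed.

(** The composite of two operators is obtained by letting the first act on the symbol of the second,
    seen as an element of weight [lam]. *)
Definition symbol_comp (p q : MP) : MP := @act d n B polyB polyC lam p q.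

Lemma symbol_compA p q r : symbol_comp (symbol_comp p q) r = symbol_comp p (symbol_comp q r).
Proof.
move: p; apply: mpoly_addf_eq => [p p'|p p'|b I].
- by rewrite /symbol_comp !actDl.
- by rewrite /symbol_comp actDl.
- rewrite /symbol_comp !actZX -[X in X * _]/(mpolyC d b) actCM; congr (_ * _).
  exact: (act_mpow_lamd polyC lam_const).
Qed.

(** The formal adjoint: [c D^I] becomes [(- D)^I] preceded by multiplication by [c]. *)
Definition symbol_adj (p : MP) : MP :=
  msum (fun I c => mpow nlamd I (mpolyC d c)) p.

Lemma lamdD a : addf (lamd a).
Proof. exact: (@tdwD d n polyB lam a). Qed.

Lemma nlamd_addf a : addf (nlamd a).
Proof. exact: (@ntdwD d n polyB lam a). Qed.

Lemma nlamdC a b p : nlamd a (nlamd b p) = nlamd b (nlamd a p).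
Proof. exact: (@ntdwC d n polyB lam lam_const a b p). Qed.

Lemma lamdC a b p : lamd a (lamd b p) = lamd b (lamd a p).
Proof. exact: (@tdwC d n polyB lam lam_const a b p). Qed.

Lemma adj_addf I : addf (fun c => mpow nlamd I (mpolyC d c) : MP).
Proof.
by move=> x y; rewrite mpolyCD (mpow_addf I nlamd_addf).
Qed.

Lemma symbol_adjD : addf symbol_adj. Proof. exact: msumD adj_addf. Qed.

Lemma symbol_adjZX c I : symbol_adj (c *: mpolyX B I) = mpow nlamd I (mpolyC d c).
Proof. exact: msumZX adj_addf. Qed.

Lemma adj_lam a p : symbol_adj (lam a * p) = nlamd a (symbol_adj p).
Proof.
move: p; apply: mpoly_addf_eq => [p q|p q|b I].
- by rewrite mulrDr symbol_adjD.
- by rewrite symbol_adjD nlamd_addf.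
- rewrite -scalerAr /lam -mpolyXD addmC 2!symbol_adjZX; apply: mpowS; exact: nlamdC.
Qed.

Lemma tdr_lamd a b p : mder (tdr a) (lamd b p) = lamd b (mder (tdr a) p).
Proof.
rewrite /lamd mderD; last exact: tdr_add.
rewrite mderM; [|exact: tdr_add|exact: tdrM].
rewrite mderX; [|exact: tdr_add|exact: tdrM].
rewrite mul0r add0r; apply: (congr1 (+%R _)).
exact: (mder_comm p (@tdr_add d n B a) (@tdr_add d n B b) (tdrC a b)).
Qed.

Lemma adj_tdr a p : symbol_adj (mder (tdr a) p) = mder (tdr a) (symbol_adj p).
Proof.
have tD := @tdr_add d n B a; have mD := mderD (k := d) tD.
move: p; apply: mpoly_addf_eq => [p q|p q|b I].
- by rewrite mD symbol_adjD.
- by rewrite symbol_adjD mD.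
- rewrite mderZX//; last exact: tdrM.
  rewrite !symbol_adjZX (mpow_morph (D' := fun a q => - lamd a q)) ?mderC// => c q.
  by rewrite (addfN _ mD) tdr_lamd.
Qed.

Lemma adj_lamd a p : symbol_adj (lamd a p) = - (lam a * symbol_adj p).
Proof. by rewrite {1}/lamd symbol_adjD adj_lam adj_tdr /nlamd /lamd opprD subrK. Qed.

Lemma symbol_compDl q : addf (symbol_comp^~ q). Proof. exact: (@actDl polyB polyC lam q). Qed.
Lemma symbol_compDr p : addf (symbol_comp p). Proof. exact: (@actD d n B polyB polyC lam p). Qed.

Lemma symbol_adjCM c p : symbol_adj (mpolyC d c * p) = symbol_comp (symbol_adj p) (mpolyC d c).
Proof.
move: p; apply: mpoly_addf_eq => [p q|p q|b I].
- by rewrite mulrDr symbol_adjD.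
- by rewrite symbol_adjD symbol_compDl.
- rewrite mul_mpolyC scalerA !symbol_adjZX /symbol_comp (act_mpow_nlamd polyC lam_const).
  by rewrite actC mulrC mpolyCM.
Qed.

Lemma symbol_adjC c : symbol_adj (mpolyC d c) = mpolyC d c.
Proof. by rewrite -{1}[mpolyC d c]mulr1 mul_mpolyC -mpolyX0 symbol_adjZX mpow0. Qed.

Lemma mcoeff_lamM a S (p : MP) : mcoeff S (lam a * p) =
  if (0 < S a)%N then mcoeff (mnm_sub S (mnm1 a)) p else 0.
Proof.
case: ifP => Sa.
  rewrite -{1}(@submK _ (mnm1 a) S); last by rewrite lep1mP -lt0n.
  by rewrite mulrC addmC mcoeffMX.
move: p; apply: mpoly_addf_eq => [p q|p q|b I].
- by rewrite mulrDr mcoeffD.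
- by rewrite addr0.
- rewrite -scalerAr /lam -mpolyXD mcoeffZ mcoeffX; case: eqP => [E|]; last by rewrite mulr0.
  by rewrite -E mnmDE mnm1E eqxx in Sa.
Qed.

Lemma mpow_lamd1 I : mpow lamd I 1 = mpolyX B I.
Proof.
elim/mnm_ind: I => [|a I IH]; first by rewrite mpow0 mpolyX0.
rewrite mpowS; last exact: lamdC.
rewrite IH /lamd mderX; [|exact: tdr_add|exact: tdrM].
by rewrite addr0 /lam addmC mpolyXD.
Qed.

Lemma mbinomSl a I S : S a = 0%N -> mbinom (mnm_add I (mnm1 a)) S = mbinom I S.
Proof.
move=> Sa; apply: eq_bigr => b _; rewrite mnmDE mnm1E.
by case: eqVneq => [<-|_]; [rewrite Sa !bin0|rewrite addn0].
Qed.

Lemma mbinomS a I S : mbinom (mnm_add I (mnm1 a)) (mnm_add S (mnm1 a)) =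
  (mbinom I (mnm_add S (mnm1 a)) + mbinom I S)%N.
Proof.
rewrite /mbinom !(bigD1 (P := predT) a)//= !mnmDE mnm1E eqxx !addn1 binS mulnDl.
congr (_ * _ + _ * _)%N; apply: eq_bigr => b /negPf ba;
  by rewrite !mnmDE mnm1E eq_sym ba !addn0.
Qed.

Lemma mbinom_gt a I S : (I a < S a)%N -> mbinom I S = 0%N.
Proof. by move=> IS; rewrite /mbinom (bigD1 a)//= bin_small. Qed.

(** The binomial expansion of [(lam + D)^I c], by Pascal's rule. It identifies the coefficientwise
    skewness condition with a statement on formal adjoints. *)
Lemma mcoeff_mpow_lamd I S c : mcoeff S (mpow lamd I (mpolyC d c)) =
  mpow (@tdr d n B) (mnm_sub I S) c *+ mbinom I S.
Proof.
have tD := @tdr_add d n B.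
elim/mnm_ind: I S => [|a I IH] S.
  rewrite mpow0 mcoeffC; case: eqVneq => [->|S0].
    rewrite subm0 mpow0 mulr1 (_ : mbinom _ _ = 1%N)//.
    by rewrite /mbinom big1// => a _; rewrite mnm0E.
  have [a Sa] : exists a, (0 < S a)%N.
    apply: contrapT => h; case/eqP: S0; apply/mnmP => a; rewrite mnm0E.
    by apply/eqP; rewrite -leqn0 leqNgt; apply/negP => Sa; apply: h; exists a.
  by rewrite (@mbinom_gt a) ?mnm0E// mulr0 mulr0n.
rewrite mpowS; last exact: lamdC.
rewrite {1}/lamd mcoeffD mcoeff_lamM (mcoeff_mder (tD a)) !IH.
have [Sa|Sa] := posnP (S a).
  rewrite add0r (addfMn _ _ (tD a)) mbinomSl// -mpowS; last exact: tdrC.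
  congr (mpow _ _ _ *+ _); apply/mnmP => b; rewrite !(mnmBE, mnmDE, mnm1E).
  by case: eqVneq => [<-|_]; rewrite ?Sa ?subn0 ?addn0//.
set S' := mnm_sub S (mnm1 a).
have -> : S = mnm_add S' (mnm1 a) by rewrite submK// lep1mP -lt0n.
clearbody S'; rewrite mbinomS mulrnDr addrC (addfMn _ _ (tD a)).
rewrite (_ : mnm_sub (mnm_add I (mnm1 a)) (mnm_add S' (mnm1 a)) = mnm_sub I S'); last first.
  by apply/mnmP => b; rewrite !(mnmBE, mnmDE) subnDr.
(* When [I a <= S' a], subtracting [S' + E_a] from [I] truncates, but the binomial coefficient is
   then zero. *)
congr (_ + _); have [IS|IS] := leqP (I a) (S' a).
  rewrite (@mbinom_gt a) ?mulr0n// mnmDE mnm1E eqxx addn1; exact: IS.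
rewrite -mpowS; last exact: tdrC.
congr (mpow _ _ _ *+ _); apply/mnmP => b; rewrite !(mnmBE, mnmDE, mnm1E).
by case: eqVneq => [<-|_]; lia.
Qed.

(* The condition [skew_diffop], for a general ring. *)
Definition skew_symbols (P : 'M[MP]_n) := forall i j S, mcoeff S (P j i) =
  \sum_(T <- msupp (P i j))
     (-1) ^+ (mdeg T).+1 *
     (mpow (@tdr d n B) (mnm_sub T S) (mcoeff T (P i j)) *+ mbinom T S).

Lemma skew_adj (P : 'M[MP]_n) i j : skew_symbols P -> P j i = - symbol_adj (P i j).
Proof.
move=> Psk; apply/mpolyP => S; rewrite Psk mcoeffN /symbol_adj /msum.
rewrite (addf_sum _ _ _ (mcoeffD S)) -sumrN; apply: eq_bigr => T _.
rewrite /nlamd (mpowN _ _ lamdD); last exact: lamdC.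
rewrite exprS mulN1r mulNr -mcoeff_mpow_lamd -(signr_odd B) -(signr_odd MP); case: odd.
  by rewrite !mulN1r mcoeffN.
by rewrite !mul1r.
Qed.

Lemma skew_symbols_adjoint (C : jetRing d n) (io : jetMor B C) (P : 'M[MP]_n) :
  skew_symbols P -> skew_adjoint io P.
Proof.
move=> Psk w i j x wc; rewrite (skew_adj j i Psk) (addfN _ (actDl io w x)).
rewrite opprK /symbol_adj /msum (addf_sum _ _ _ (actDl io w x)); apply: eq_bigr => S _.
by rewrite (act_mpow_nlamd io wc) actC mulrC.
Qed.

End Symbols.

(** * The bracket of weighted densities *)

Section LambdaBracket.
Variables (d n : nat) (B C : jetRing d n) (io : jetMor B C).
Variables (P : 'M[mpoly d B]_n) (w : 'I_d -> C).
Hypothesis wc : const_weight w.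
Implicit Types (p q r x c : C) (a : 'I_d) (i j l : 'I_n) (I : multinom d).

(* For [w = \lambda], the lambda-bracket of [p] and [q]; cf. the master formula
   [{p_\lambda q} = \sum dq/du^j_M (\lambda + \partial)^M
      P^{ji}(\lambda + \partial) (- \lambda - \partial)^L dp/du^i_L]. *)
Definition wbracket p q := evol w (hamil io P w (fun i => vari w i p)) q.

Definition jconst c := (forall v, par v c = 0) /\ (forall a, tdr a c = 0).

Lemma tdw_cst a c p : jconst c -> tdw w a (c * p) = c * tdw w a p.
Proof. by move=> [_ c0]; rewrite /tdw tdrM c0; ring. Qed.

Lemma mtdw_cst I c p : jconst c -> mpow (tdw w) I (c * p) = c * mpow (tdw w) I p.
Proof. by move=> cc; apply/esym/(mpow_morph (h := *%R c)) => a y; rewrite tdw_cst. Qed.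

Lemma mntdw_cst I c p : jconst c ->
  mpow (ntdw w) I (c * p) = c * mpow (ntdw w) I p.
Proof.
move=> cc; apply/esym/(mpow_morph (h := *%R c)) => a y.
by rewrite /ntdw tdw_cst// mulrN.
Qed.

Lemma vari_cst l c p : jconst c -> vari w l (c * p) = c * vari w l p.
Proof.
move=> cc; rewrite /vari gvarM mul1r [X in _ + X]gvar_const ?addr0; last exact: cc.1.
rewrite /gvar (@dsum_morph _ _ _ _ ( *%R c)); last exact: mulrDr.
apply: eq_dsum => v y; case: eqP => _; last by rewrite mulr0.
by rewrite mul1r -mntdw_cst.
Qed.

Lemma hamil_cst c xi k : jconst c ->
  hamil io P w (fun i => c * xi i) k = c * hamil io P w xi k.
Proof.
move=> cc; rewrite /hamil mulr_sumr; apply: eq_bigr => i _.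
rewrite /act mulr_sumr; apply: eq_bigr => S _.
by rewrite mtdw_cst// mulrCA.
Qed.

Lemma evol_cstX c X p : jconst c -> evol w (fun j => c * X j) p = c * evol w X p.
Proof.
move=> cc; rewrite /evol (@dsum_morph _ _ _ _ ( *%R c)); last exact: mulrDr.
by apply: eq_dsum => v y; rewrite mtdw_cst// mulrA.
Qed.

Lemma wbracketDr p : addf (wbracket p).
Proof. exact: evolD. Qed.

Lemma wbracketDl q : addf (wbracket^~ q).
Proof.
move=> p r; rewrite /wbracket -evol_DX; apply: eq_evol => // k.
rewrite -hamilD; apply: eq_hamil => // i; exact: gvarD.
Qed.

Lemma wbracket_cstr c p q : jconst c -> wbracket p (c * q) = c * wbracket p q.
Proof. by move=> cc; rewrite /wbracket evol_constl//; exact: cc.1. Qed.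

Lemma wbracket_cstl c p q : jconst c -> wbracket (c * p) q = c * wbracket p q.
Proof.
move=> cc; rewrite /wbracket -evol_cstX//; apply: eq_evol => // k.
by rewrite -hamil_cst//; apply: eq_hamil => // i; exact: vari_cst.
Qed.

Lemma jconst_weight a : jconst (w a). Proof. exact: wc. Qed.

(** Write [tdr a p] as [tdw w a p - w a * p]: the first term is a divergence for the weight [w], and
    [w a] is a constant. *)
Lemma vari_tdr l a p : vari w l (tdr a p) = - (w a * vari w l p).
Proof.
rewrite (_ : tdr a p = tdw w a p + - (w a * p)); last by rewrite /tdw; ring.
rewrite /vari gvarD (addfN _ (@gvarD _ _ _ _ _ _)) -!/(vari _ _ _) vari_tdw// add0r.
by rewrite vari_cst//; exact: jconst_weight.
Qed.

Lemma wbracket_tdl a p q : wbracket (tdr a p) q = - (w a * wbracket p q).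
Proof.
have cc : jconst (- w a).
  by split=> [v|b]; rewrite ?parN ?tdrN ?(jconst_weight a).1 ?(jconst_weight a).2 oppr0.
rewrite /wbracket -mulNr -evol_cstX//; apply: eq_evol => // k.
by rewrite -hamil_cst//; apply: eq_hamil => // i; rewrite vari_tdr mulNr.
Qed.

Lemma wbracket_tdr a p q : wbracket p (tdr a q) = tdw w a (wbracket p q).
Proof.
have zc : @const_weight d n C (fun=> 0).
  by move=> b; split=> [v|e]; [exact: par0|exact: addf0 (@tdr_add _ _ _ _)].
rewrite /wbracket -(@evol_tdw _ _ _ w (fun=> 0) w)//; last first.
  by move=> b; rewrite /wadd addr0.
by rewrite /tdw mul0r add0r.
Qed.

Lemma wbracketMr p q r : wbracket p (q * r) = wbracket p q * r + wbracket p r * q.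
Proof. by rewrite /wbracket evolM [in X in _ + X]mulrC. Qed.

End LambdaBracket.

Section JetMorphisms.
Variables (d n : nat) (C C' : jetRing d n) (h : jetMor C C').
Variables (w : 'I_d -> C) (w' : 'I_d -> C').
Hypothesis hw : forall a, h (w a) = w' a.
Implicit Types (p q x : C) (a : 'I_d) (i l : 'I_n).

Lemma jm_addf : addf h. Proof. exact: rmorphD. Qed.

Lemma jm_dsum (phi : jet d n -> C -> C) (psi : jet d n -> C' -> C') p :
  (forall v, addf (psi v)) ->
  (forall v y, h (phi v y) = psi v (h y)) -> h (dsum phi p) = dsum psi (h p).
Proof.
move=> psiD hphi; rewrite (@dsumE _ _ _ _ _ (dsupp p) psiD (fset_uniq _)).
  rewrite (dsum_morph _ _ jm_addf); apply: eq_bigr => v _.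
  by rewrite hphi jm_par.
by move=> v; rewrite !mem_dsupp -jm_par; apply: contraNneq => ->; rewrite rmorph0.
Qed.

Lemma jm_tdw a p : h (tdw w a p) = tdw w' a (h p).
Proof. by rewrite /tdw rmorphD rmorphM hw jm_tdr. Qed.

Lemma jm_mtdw I p : h (mpow (tdw w) I p) = mpow (tdw w') I (h p).
Proof. by apply: mpow_morph => a y; exact: jm_tdw. Qed.

Lemma jm_mntdw I p : h (mpow (ntdw w) I p) = mpow (ntdw w') I (h p).
Proof. by apply: mpow_morph => a y; rewrite /ntdw rmorphN jm_tdw. Qed.

Lemma jm_evol X p : h (evol w X p) = evol w' (fun j => h (X j)) (h p).
Proof.
rewrite /evol (@jm_dsum _ (fun v z => mpow (tdw w') v.2 (h (X v.1)) * z))// => [v|v y].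
  exact: (evol_addf w' (fun j => h (X j)) v).
by rewrite rmorphM jm_mtdw.
Qed.

Lemma jm_gvar l x p : h (gvar w l x p) = gvar w' l (h x) (h p).
Proof.
rewrite /gvar (@jm_dsum _ (fun v y =>
  if v.1 == l then mpow (ntdw w') v.2 (h x * y) else 0))// => [v|v y].
  exact: gvar_addf.
by case: eqP => _; rewrite ?rmorph0// jm_mntdw rmorphM.
Qed.

Lemma jm_vari l p : h (vari w l p) = vari w' l (h p).
Proof. by rewrite /vari jm_gvar rmorph1. Qed.

Variables (B : jetRing d n) (io : jetMor B C) (io' : jetMor B C').
Hypothesis hio : forall c, h (io c) = io' c.
Variable P : 'M[mpoly d B]_n.

Lemma jm_hamil xi k : h (hamil io P w xi k) = hamil io' P w' (fun i => h (xi i)) k.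
Proof.
rewrite /hamil rmorph_sum; apply: eq_bigr => i _ /=.
rewrite /act rmorph_sum; apply: eq_bigr => S _ /=.
by rewrite rmorphM hio jm_mtdw.
Qed.

Lemma jm_wbracket p q :
  h (wbracket io P w p q) = wbracket io' P w' (h p) (h q).
Proof.
rewrite /wbracket jm_evol; apply: eq_evol => // k; rewrite jm_hamil.
by apply: eq_hamil => // i; exact: jm_vari.
Qed.

End JetMorphisms.

Section WeightedJacobi.
Variables (d n : nat) (B C : jetRing d n) (io : jetMor B C).
Variable P : 'M[mpoly d B]_n.
Hypothesis Psk : skew_adjoint io P.

(** Both sides are evolutionary derivatives of [h], and their characteristics differ by [jac]. *)
Lemma wbracket_jacobi w w' f g h : const_weight w -> const_weight w' ->
  (forall k xi eta, jac io P w w' xi eta k = 0) ->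
  wbracket io P w f (wbracket io P w' g h) - wbracket io P w' g (wbracket io P w f h) =
  wbracket io P (wadd w w') (wbracket io P w f g) h.
Proof.
move=> wc wc' J0; rewrite /wbracket (@evol_comm _ _ _ w w' (wadd w w'))//.
apply: eq_evol => // k; apply/eqP; rewrite -subr_eq0.
by rewrite jacobiator// J0.
Qed.

End WeightedJacobi.

(* Composition and formal adjoint of the symbols of differential operators; they
   are axiomatized because conversion is too slow on concrete polynomials. *)
Record symbol_calculus (d n : nat) (B C : jetRing d n) (io : jetMor B C)
    (w : 'I_d -> C) (cmp : C -> C -> C) (adj : C -> C) : Prop := SymbolCalculus {
  cmpDl : forall r, addf (cmp^~ r);
  cmpDr : forall p, addf (cmp p);
  cmpA : forall p q r, cmp (cmp p q) r = cmp p (cmp q r);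
  cmp_tdw : forall a p r, cmp (tdw w a p) r = tdw w a (cmp p r);
  cmp_w : forall a p r, cmp (w a * p) r = cmp p (tdw w a r);
  cmpCM : forall c p r, cmp (io c * p) r = io c * cmp p r;
  cmpC : forall c r, cmp (io c) r = io c * r;
  adjD : addf adj;
  adj_tdw : forall a p, adj (tdw w a p) = - (w a * adj p);
  adjCM : forall c p, adj (io c * p) = cmp (adj p) (io c);
  adjC : forall c, adj (io c) = io c }.

Section SymbolBracket.
Variables (d n : nat) (B C : jetRing d n) (io : jetMor B C).
Variables (P : 'M[mpoly d B]_n) (w : 'I_d -> C) (cmp : C -> C -> C) (adj : C -> C).
Hypotheses (wc : const_weight w) (SC : symbol_calculus io w cmp adj).
Implicit Types (f g h c : B) (p q r : C) (a : 'I_d) (i j l : 'I_n).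
Implicit Types (I S : multinom d) (X xi : 'I_n -> C).

Lemma dsum_io (V : zmodType) (phi : jet d n -> C -> V) f :
  (forall v, addf (phi v)) ->
  dsum phi (io f) = dsum (fun v c => phi v (io c)) f.
Proof.
move=> phiD; rewrite (dsumE phiD (fset_uniq (dsupp f))).
  by apply: eq_bigr => v _; rewrite -jm_par.
move=> v; rewrite !mem_dsupp -jm_par; apply: contraNneq => ->.
by rewrite rmorph0.
Qed.

Lemma evol_io X f : evol w X (io f) =
  dsum (fun v c => mpow (tdw w) v.2 (X v.1) * io c) f.
Proof. exact: dsum_io (evol_addf w X). Qed.

Lemma vari_io l f : vari w l (io f) =
  dsum (fun v c => if v.1 == l then mpow (ntdw w) v.2 (io c) else 0) f.
Proof.
rewrite /vari /gvar dsum_io; last exact: gvar_addf.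
by apply: eq_dsum => v c; rewrite mul1r.
Qed.

Lemma cmp_ntdw a p r : cmp (ntdw w a p) r = ntdw w a (cmp p r).
Proof. by rewrite /ntdw (addfN _ (cmpDl SC r)) (cmp_tdw SC). Qed.

Lemma cmp_mtdw I p r : cmp (mpow (tdw w) I p) r = mpow (tdw w) I (cmp p r).
Proof. by apply: (mpow_morph (h := cmp^~ r)) => a q; exact: (cmp_tdw SC). Qed.

Lemma cmp_mntdw I p r : cmp (mpow (ntdw w) I p) r = mpow (ntdw w) I (cmp p r).
Proof. by apply: (mpow_morph (h := cmp^~ r)) => a q; exact: cmp_ntdw. Qed.

Lemma cmp_evol X h r : cmp (evol w X (io h)) r =
  evol w (fun j => cmp (X j) r) (io h).
Proof.
rewrite !evol_io (dsum_morph _ _ (cmpDl SC r)); apply: eq_dsum => v c.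
by rewrite mulrC (cmpCM SC) cmp_mtdw mulrC.
Qed.

Lemma cmp_vari i f g : cmp (vari w i (io f)) (io g) = gvar w i (io g) (io f).
Proof.
rewrite vari_io (dsum_morph _ _ (cmpDl SC _)) /gvar dsum_io; last exact: gvar_addf.
apply: eq_dsum => v c; case: eqP => _; last exact: (addf0 (cmpDl SC _)).
by rewrite cmp_mntdw (cmpC SC) mulrC.
Qed.

Lemma cmp_hamil xi k r :
  cmp (hamil io P w xi k) r = hamil io P w (fun i => cmp (xi i) r) k.
Proof.
rewrite /hamil (addf_sum _ _ _ (cmpDl SC r)); apply: eq_bigr => i _.
rewrite /act (addf_sum _ _ _ (cmpDl SC r)); apply: eq_bigr => S _.
by rewrite (cmpCM SC) cmp_mtdw.
Qed.

(** Right composition passes through all outer derivatives down to the variational derivative; there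
    it inserts a factor under [(- D)^I], which gives the two terms of the product rule [gvarM]. *)
Lemma wbracketMl f g h : wbracket io P w (io (f * g)) (io h) =
  cmp (wbracket io P w (io f) (io h)) (io g) +
  cmp (wbracket io P w (io g) (io h)) (io f).
Proof.
rewrite /wbracket !cmp_evol -evol_DX; apply: eq_evol => // k.
rewrite !cmp_hamil -hamilD; apply: eq_hamil => // i.
by rewrite !cmp_vari rmorphM /vari gvarM !mul1r addrC.
Qed.

Lemma adj_mtdw I p :
  adj (mpow (tdw w) I p) = mpow (fun a q => - (w a * q)) I (adj p).
Proof. by apply: mpow_morph => a q; exact: (adj_tdw SC). Qed.

Lemma adj_mntdw I p : adj (mpow (ntdw w) I p) = mpow (fun a q => w a * q) I (adj p).
Proof.
apply: mpow_morph => a q.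
by rewrite /ntdw (addfN _ (adjD SC)) (adj_tdw SC) opprK.
Qed.

Lemma cmp_mw I p r :
  cmp (mpow (fun a q => w a * q) I p) r = cmp p (mpow (tdw w) I r).
Proof.
elim/mnm_ind: I p r => [|a I IH] p r; first by rewrite !mpow0.
rewrite mpowS => [|b c q]; last by ring.
by rewrite mpowSr ?(cmp_w SC) ?IH//; exact: tdwC.
Qed.

Lemma cmp_mnw I p r :
  cmp (mpow (fun a q => - (w a * q)) I p) r = cmp p (mpow (ntdw w) I r).
Proof.
elim/mnm_ind: I p r => [|a I IH] p r; first by rewrite !mpow0.
rewrite mpowS => [|b c q]; last by ring.
rewrite mpowSr; last exact: ntdwC.
rewrite (addfN _ (cmpDl SC r)) (cmp_w SC) IH /ntdw (addfN _ (@mntdwD _ _ _ _ _)).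
by rewrite (addfN _ (cmpDr SC p)).
Qed.

(* The adjoint of [g_M \partial^M P \partial^S (-\partial)^L f_L] is
   [f_L \partial^L (-\partial)^S P (-\partial)^M g_M]. *)
Lemma wbracket_skew f g : skew_adjoint io P ->
  wbracket io P w (io g) (io f) = - adj (wbracket io P w (io f) (io g)).
Proof.
move=> Psk; pose xi i := vari w i (io f); pose eta j := vari w j (io g).
have E1 : adj (wbracket io P w (io f) (io g)) =
    \sum_j cmp (adj (hamil io P w xi j)) (eta j).
  rewrite /wbracket evol_io (dsum_morph _ _ (adjD SC)).
  have E j : cmp (adj (hamil io P w xi j)) (eta j) =
      dsum (fun v c => if v.1 == j then cmp (adj (hamil io P w xi j))
        (mpow (ntdw w) v.2 (io c)) else 0) g.
    rewrite {1}/eta vari_io (dsum_morph _ _ (cmpDr SC _)).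
    by apply: eq_dsum => v c; case: eqP => _ //; exact: (addf0 (cmpDr SC _)).
  under [RHS]eq_bigr do rewrite E.
  rewrite -dsum_sum; apply: eq_dsum => v c.
  rewrite (bigD1 v.1)//= eqxx big1 ?addr0 => [|i /negPf]; last by rewrite eq_sym => ->.
  by rewrite mulrC (adjCM SC) adj_mtdw cmp_mnw.
have E2 j : adj (hamil io P w xi j) =
    \sum_i \sum_(S <- msupp (P j i))
      cmp (adj (xi i)) (mpow (ntdw w) S (io (mcoeff S (P j i)))).
  rewrite /hamil (addf_sum _ _ _ (adjD SC)); apply: eq_bigr => i _.
  rewrite /act (addf_sum _ _ _ (adjD SC)); apply: eq_bigr => S _.
  by rewrite (adjCM SC) adj_mtdw cmp_mnw.
have E3 : adj (wbracket io P w (io f) (io g)) =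
    - \sum_i cmp (adj (xi i)) (hamil io P w eta i).
  rewrite E1 (eq_bigr (fun j => \sum_i - cmp (adj (xi i)) (act io w (P i j) (eta j)))).
    rewrite exchange_big -sumrN; apply: eq_bigr => i _ /=.
    by rewrite sumrN /hamil (addf_sum _ _ _ (cmpDr SC _)).
  move=> j _; rewrite E2 (addf_sum _ _ _ (cmpDl SC _)); apply: eq_bigr => i _.
  rewrite (addf_sum _ _ _ (cmpDl SC _)) -(addfN _ (cmpDr SC _)) -Psk//.
  rewrite (addf_sum _ _ _ (cmpDr SC _)); apply: eq_bigr => S _.
  by rewrite (cmpA SC) cmp_mntdw (cmpC SC) mulrC.
rewrite E3 opprK /wbracket evol_io -/eta.
have E i : cmp (adj (xi i)) (hamil io P w eta i) =
   dsum (fun v c => if v.1 == i then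
     mpow (tdw w) v.2 (hamil io P w eta i) * io c else 0) f.
  rewrite /xi vari_io (dsum_morph _ _ (adjD SC)).
  rewrite (dsum_morph _ _ (cmpDl SC _)); apply: eq_dsum => v c.
  case: eqP => _; last by rewrite (addf0 (adjD SC)) (addf0 (cmpDl SC _)).
  by rewrite adj_mntdw (adjC SC) cmp_mw (cmpC SC) mulrC.
under [RHS]eq_bigr do rewrite E.
rewrite -dsum_sum; apply: eq_dsum => v c.
by rewrite (bigD1 v.1)//= eqxx big1 ?addr0 => [|i /negPf]; last by rewrite eq_sym => ->.
Qed.

End SymbolBracket.

Section PolynomialSymbols.
Variables (d n : nat) (B : jetRing d n).

Lemma poly_symbol_calculus :
  @symbol_calculus d n B (polyB B) (polyC B) (@lam d n B) (@symbol_comp d n B) (@symbol_adj d n B).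
Proof.
have wc := lam_const B.
split.
- exact: (@symbol_compDl d n B).
- exact: (@symbol_compDr d n B).
- exact: (@symbol_compA d n B).
- by move=> a p r; exact: (@act_lamd d n B (polyB B) (polyC B) _ wc).
- by move=> a p r; exact: (@act_lam d n B (polyB B) (polyC B) _ wc).
- by move=> c p r; exact: (@actCM d n B (polyB B) (polyC B)).
- by move=> c r; exact: (@actC d n B (polyB B) (polyC B)).
- exact: (@symbol_adjD d n B).
- exact: (@adj_lamd d n B).
- exact: (@symbol_adjCM d n B).
- exact: (@symbol_adjC d n B).
Qed.

Section Substitution.
Variables (k : nat).
Local Notation C2 := (mpoly_jetRing k B).
Variable z : 'I_d -> mpoly k B.
Hypothesis zc : @const_weight d n C2 z.

Definition psubst (p : mpoly d B) : mpoly k B := mmap (@mpolyC k B) z p.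

Definition derivation (R : pzRingType) (D : R -> R) :=
  addf D /\ forall x y, D (x * y) = D x * y + x * D y.

Lemma derivation1 (R : pzRingType) (D : R -> R) : derivation D -> D 1 = 0.
Proof.
move=> [DD DM]; have := DM 1 1; rewrite !mulr1 mul1r => E.
by apply: (addrI (D 1)); rewrite -E addr0.
Qed.

Lemma derivationX0 (R : comPzRingType) (D : R -> R) x m : derivation D ->
  D x = 0 -> D (x ^+ m) = 0.
Proof.
move=> DP x0; elim: m => [|m IH]; first exact: derivation1.
by rewrite exprS DP.2 x0 IH mul0r mulr0 addr0.
Qed.

Lemma derivation_mmap1 (R : comNzRingType) (D : R -> R) (y : 'I_d -> R) m :
  derivation D -> (forall a, D (y a) = 0) -> D (mmap1 y m) = 0.
Proof.
move=> DP y0; rewrite /mmap1; apply: (big_ind (fun x => D x = 0)) => [|x x' x0 x'0|a _].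
- exact: derivation1.
- by rewrite DP.2 x0 x'0 mul0r mulr0 addr0.
- exact: derivationX0.
Qed.

Lemma par_derivation v : derivation (@par _ C2 v).
Proof. by split; [exact: par_add|exact: parM]. Qed.

Lemma tdr_derivation a : derivation (@tdr _ _ C2 a).
Proof. by split; [exact: tdr_add|exact: tdrM]. Qed.

Lemma jconst_mmap1 m : @jconst d n C2 (mmap1 z m).
Proof.
by split=> [v|a]; apply: derivation_mmap1 => [|b];
  [exact: par_derivation|exact: (zc b).1|exact: tdr_derivation|exact: (zc b).2].
Qed.

Lemma psubst_mder (D : B -> B) (p : mpoly d B) : derivation D ->
  (forall m, mder D (mmap1 z m) = 0) -> psubst (mder D p) = mder D (psubst p).
Proof.
move=> [DD DM] Dz; move: p; apply: mpoly_addf_eq => [p q|p q|b I].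
- by rewrite mderD// /psubst rmorphD.
- by rewrite /psubst rmorphD/= mderD.
- rewrite mderZX// /psubst !mmapZ !mmapX mderM// mderC// Dz mulr0 addr0.
  by [].
Qed.

Lemma psubst_par v p : psubst (@par _ (polyB B) v p) = @par _ C2 v (psubst p).
Proof.
apply: psubst_mder; first by split; [exact: par_add|exact: parM].
by move=> m; exact: (jconst_mmap1 m).1.
Qed.

Lemma psubst_tdr a p : psubst (@tdr _ _ (polyB B) a p) = @tdr _ _ C2 a (psubst p).
Proof.
apply: psubst_mder; first by split; [exact: tdr_add|exact: tdrM].
by move=> m; exact: (jconst_mmap1 m).2.
Qed.

Definition psubst_jetMor : jetMor (polyB B) C2 :=
  @JetMor d n (polyB B) C2 (mmap (@mpolyC k B) z : {rmorphism mpoly d B -> mpoly k B})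
    psubst_par psubst_tdr.

Lemma psubst_lam a : psubst (lam B a) = z a.
Proof. by rewrite /psubst /lam mmapX mmap1U. Qed.

Lemma psubst_C c : psubst (mpolyC d c) = mpolyC k c.
Proof. exact: mmapC. Qed.

(** The bracket in [lam] thus determines the brackets at every constant weight, in particular those
    at [mu] and at [lam + mu]. *)
Lemma psubst_wbracket (P : 'M[mpoly d B]_n) f g :
  psubst (@wbracket d n B (polyB B) (polyC B) P (@lam d n B) (mpolyC d f) (mpolyC d g)) =
  @wbracket d n B C2 (mpolyC_jetMor k B) P z (mpolyC k f) (mpolyC k g).
Proof.
rewrite -!psubst_C.
exact: (@jm_wbracket d n (polyB B) C2 psubst_jetMor (@lam d n B) z psubst_lam
  B (polyC B) (mpolyC_jetMor k B) psubst_C).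
Qed.

End Substitution.

Section BracketSums.
Variables (C : jetRing d n) (io : jetMor B C) (P : 'M[mpoly d B]_n) (w : 'I_d -> C).

(** Monomials in the parameters are constants, so the coefficientwise sums of the PVA-Jacobi
    identity collapse to a single bracket of polynomials. *)
Lemma wbracket_sumr (J : Type) (s : seq J) (p : C) (F e : J -> C) :
  (forall j, jconst (e j)) ->
  \sum_(j <- s) wbracket io P w p (F j) * e j =
  wbracket io P w p (\sum_(j <- s) F j * e j).
Proof.
move=> ec; rewrite (addf_sum _ _ _ (wbracketDr io P w p)); apply: eq_bigr => j _.
by rewrite mulrC -wbracket_cstr// mulrC.
Qed.

Lemma wbracket_suml (J : Type) (s : seq J) (q : C) (F e : J -> C) :
  (forall j, jconst (e j)) ->
  \sum_(j <- s) e j * wbracket io P w (F j) q =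
  wbracket io P w (\sum_(j <- s) F j * e j) q.
Proof.
move=> ec; rewrite (addf_sum _ _ _ (wbracketDl io P w q)); apply: eq_bigr => j _.
by rewrite -wbracket_cstl// mulrC.
Qed.

End BracketSums.
End PolynomialSymbols.

(** * The Fourier transform of the bracket of densities *)

Section FourierTerms.
Variables (d n : nat) (B C : jetRing d n) (io : jetMor B C) (w : 'I_d -> C).
Variables (cmp : C -> C -> C) (adj : C -> C).
Hypotheses (wc : const_weight w) (SC : symbol_calculus io w cmp adj).
Implicit Types (f g c e : B) (p q r : C) (a b : 'I_d) (I L M : multinom d).

Lemma addf_sgn (V W : pzRingType) (D : V -> W) k x : addf D ->
  D ((-1) ^+ k * x) = (-1) ^+ k * D x.
Proof.
move=> DD; rewrite -(signr_odd V) -(signr_odd W); case: odd.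
  by rewrite !mulN1r addfN.
by rewrite !mul1r.
Qed.

Definition fterm c e L M : C := (-1) ^+ mdeg M * ((-1) ^+ mdeg (mnm_add L M) *
    (io e * mpow (tdw w) (mnm_add L M) (io c))).

(** Raising [M] flips both signs, so the two terms form the Leibniz rule for [e] times a derivative
    of [c]. *)
Lemma fterm_dy a c e L M : fterm c (tdr a e) L M + fterm c e L (mnm_add M (mnm1 a)) =
  tdw w a (fterm c e L M).
Proof.
rewrite /fterm !(addf_sgn _ _ (@tdwD _ _ _ w a)) addmA mpowS; last exact: tdwC.
rewrite !mdegD !mdeg1 !exprD !expr1; move: (mpow _ _ _) => x.
by rewrite /tdw tdrM jm_tdr; ring.
Qed.

(** Raising [L] flips only one sign, so the second term cancels the [tdw w a c] contained in
    [tdr a c = tdw w a c - w a * c]. *)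
Lemma fterm_dx a c e L M : fterm (tdr a c) e L M + fterm c e (mnm_add L (mnm1 a)) M =
  - (w a * fterm c e L M).
Proof.
rewrite /fterm -addmA (addmC (mnm1 a)) addmA mpowSr; last exact: tdwC.
rewrite !mdegD !mdeg1 !exprD !expr1 [tdw w a _]/tdw mtdwD jm_tdr mtdw_cst; last exact: wc.
ring.
Qed.

Lemma fterm_my g c e L M : fterm c (g * e) L M = io g * fterm c e L M.
Proof. by rewrite /fterm rmorphM; ring. Qed.

Lemma fterm_mx f c e L M : fterm (f * c) e L M = cmp (fterm c e L M) (io f).
Proof.
rewrite /fterm !(addf_sgn _ _ (cmpDl SC _)) (cmpCM SC) (cmp_mtdw SC) (cmpC SC).
by rewrite rmorphM (mulrC (io f)).
Qed.

(* The kernel [b(x) c(y) (P(y, \partial_y) \partial_y^M \partial_x^L \delta(x - y))]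
   gives the symbol of the operator [c \partial^M P (-\partial)^L b]. *)
Lemma cmp_term f g I L p :
  cmp (io g * mpow (fun a q => - (w a * q)) L (mpow (tdw w) I p)) (io f) =
  mpow (tdw w) I (cmp p (mpow (ntdw w) L (io f))) * io g.
Proof. by rewrite (cmpCM SC) (cmp_mnw wc SC) (cmp_mtdw SC) mulrC. Qed.

(** Unfolds the variational derivative of [f] so that the bracket runs over pairs of jet variables,
    as the bracket of densities does. *)
Lemma wbracket_dsum (P : 'M[mpoly d B]_n) f g : wbracket io P w (io f) (io g) =
  dsum (fun v e => dsum (fun u c => mpow (tdw w) u.2
     (act io w (P u.1 v.1) (mpow (ntdw w) v.2 (io e))) * io c) g) f.
Proof.
rewrite /wbracket evol_io /dsum [RHS]exchange_big; apply: eq_bigr => u _ /=.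
rewrite -mulr_suml; congr (_ * _); rewrite -(addf_sum _ _ _ (@mtdwD _ _ _ w u.2)).
congr mpow; rewrite /hamil.
rewrite (eq_bigr (fun i => \sum_(v <- dsupp f | v.1 == i)
    act io w (P u.1 v.1) (mpow (ntdw w) v.2 (io (par v f))))) => [|i _].
  rewrite (exchange_big_dep xpredT)//=; apply: eq_bigr => v _.
  by rewrite (big_pred1 v.1)// => i; rewrite eq_sym.
rewrite vari_io /dsum (addf_sum _ _ _ (@actD _ _ _ _ _ _ _)) [RHS]big_mkcond /=.
apply: eq_bigr => v _; case: eqP => [->//|_]; exact: (addf0 (@actD _ _ _ _ _ _ _)).
Qed.

End FourierTerms.

Section Fourier.
Variables (d : nat) (R : realType) (n : nat) (U : chart R n).
Local Notation A := (Ahat d U).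
Local Notation B := (Ahat_jetRing d U).
Local Notation MP := (mpoly d A).
Local Notation lamD := (@Defs.lamD d R n U).
Local Notation lamX := (@Defs.lamX d R n U).
Implicit Types (f g c e : A) (p q r : MP) (a b : 'I_d) (I L M : multinom d).
Implicit Types (K : Defs.kernel d U).
Local Notation kernel1 := (A * A * multinom d * multinom d)%type.

Lemma lamD_add a : addf (lamD a).
Proof. exact: (@lamdD d n B a). Qed.

Let wc := lam_const B.
Let SC := poly_symbol_calculus B.

Lemma fourier_cat K K' : fourier (K ++ K') = fourier K + fourier K'.
Proof. exact: big_cat. Qed.

Lemma fourier_flatten (s : seq (Defs.kernel d U)) :
  fourier (flatten s) = \sum_(K <- s) fourier K.
Proof.
elim: s => [|K s IH]; first by rewrite big_nil; exact: big_nil.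
by rewrite big_cons -IH; exact: fourier_cat.
Qed.

Lemma fourier_cons t K : fourier (t :: K) = fourier_term t + fourier K.
Proof. exact: big_cons. Qed.

Lemma fourier_nil : fourier ([::] : Defs.kernel d U) = 0.
Proof. exact: big_nil. Qed.

Lemma fourier2 t t' K : fourier ([:: t; t'] ++ K) =
  fourier_term t + fourier_term t' + fourier K.
Proof.
apply: etrans (fourier_cons _ _) _; apply: etrans (addrA _ _ _).
by congr (_ + _); exact: fourier_cons.
Qed.

Lemma fourier_map (F : kernel1 -> Defs.kernel d U) (D : MP -> MP) K : addf D ->
  (forall t K, fourier (F t ++ K) = D (fourier_term t) + fourier K) ->
  fourier (flatten [seq F t | t <- K]) = D (fourier K).
Proof.
move=> DD DF; elim: K => [|t K IH].
  by rewrite fourier_nil (addf0 DD).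
rewrite fourier_cons DD -IH; exact: DF.
Qed.

Lemma fourier_kdy a K : fourier (kdy a K) = lamD a (fourier K).
Proof.
apply: fourier_map => [|[[[c e] L] M] K']; first exact: lamD_add.
apply: etrans (fourier2 _ _ _) _; congr (_ + _).
exact: (fterm_dy (polyC B) wc a c e L M).
Qed.

Lemma fourier_kdx a K : fourier (kdx a K) = - (lamX a * fourier K).
Proof.
apply: (fourier_map (D := fun p => - (lamX a * p))) => [p q|[[[c e] L] M] K'].
  by rewrite mulrDr opprD.
apply: etrans (fourier2 _ _ _) _; congr (_ + _).
exact: (fterm_dx (polyC B) wc a c e L M).
Qed.

Lemma fourier_map1 (F : kernel1 -> kernel1) (D : MP -> MP) K : addf D ->
  (forall t, fourier_term (F t) = D (fourier_term t)) ->
  fourier [seq F t | t <- K] = D (fourier K).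
Proof.
move=> DD DF; elim: K => [|t K IH]; first by rewrite fourier_nil (addf0 DD).
by rewrite fourier_cons DD -IH -DF; exact: fourier_cons.
Qed.

Lemma fourier_kmuly g K : fourier (kmuly g K) = mpolyC d g * fourier K.
Proof.
apply: (fourier_map1 (D := *%R (mpolyC d g))) => [|[[[c e] L] M]].
  exact: mulrDr.
exact: (fterm_my (polyC B) _ g c e L M).
Qed.

Lemma fourier_kmulx f K : fourier (kmulx f K) = plusD (fourier K) f.
Proof.
apply: (fourier_map1 (D := fun p => plusD p f)) => [|[[[c e] L] M]].
  exact: (@symbol_compDl d n B (mpolyC d f)).
exact: (fterm_mx SC f c e L M).
Qed.

Lemma fourier_delta : fourier (Defs.delta d U) = 1.
Proof.
rewrite /Defs.delta fourier_cons fourier_nil addr0 /fourier_term add0m mpow0 mdeg0.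
by rewrite !expr0 !mul1r mpolyC1.
Qed.

(** The transform of the delta function is [1], and [(lam + D)^N 1] is the monomial [lam^N], so the
    symbol is recovered. *)
Lemma fourier_coord (P : 'M[diffop d U]_n) (i j : 'I_n) :
  fourier (coord_bracket P i j) = P j i.
Proof.
rewrite /coord_bracket fourier_flatten big_map [RHS]mpolyE; apply: eq_bigr => N _.
rewrite fourier_kmuly.
have -> : fourier (mpow (@kdy d R n U) N (Defs.delta d U)) = mpow lamD N 1.
  by rewrite -fourier_delta; apply: mpow_morph => a K; exact: fourier_kdy.
by rewrite mul_mpolyC; congr (_ *: _); exact: (mpow_lamd1 B N).
Qed.

(** The transform turns [x]-derivatives into multiplication by [- lam], [y]-derivatives into
    [lam + D], and multiplication by a function of [x] or [y] into right or left composition; the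
    result is the master formula. *)
Lemma induced_wbracket (P : 'M[diffop d U]_n) f g :
  induced_lambda_bracket P f g =
  @wbracket d n B (polyB B) (polyC B) P (@lam d n B) (mpolyC d f) (mpolyC d g).
Proof.
apply: etrans _ (esym (@wbracket_dsum d n B (polyB B) (polyC B) (@lam d n B) P f g)).
rewrite /induced_lambda_bracket /density_bracket fourier_flatten big_allpairs_dep.
apply: eq_bigr => v _; apply: eq_bigr => u _.
apply: etrans (fourier_kmulx _ _) _.
apply: etrans _ (cmp_term wc SC (pd v f) (pd u g) u.2 v.2 (P u.1 v.1)).
apply: (congr1 (fun p : MP => plusD p (pd v f))).
apply: etrans (fourier_kmuly _ _) _; apply: (congr1 (fun p : MP => _ * p)).
apply: etrans (mpow_morph (h := @fourier d R n U)
  (D' := fun a (q : MP) => - (lamX a * q)) _ _ fourier_kdx) _.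
congr mpow; apply: etrans (mpow_morph (h := @fourier d R n U)
  (D' := lamD) _ _ fourier_kdy) _.
by congr mpow; exact: fourier_coord.
Qed.

End Fourier.

(** * Bidifferential operators *)

Section BidifferentialOperators.
Variables (d n : nat) (B : jetRing d n).
Local Notation jet := (jet d n).
Implicit Types (c : B) (u v : jet) (i j k l : 'I_n) (a : 'I_d) (S T : multinom d).

(* A term [(c, (i, S), (j, T))] stands for
   [c \partial^S xi_i \partial^T eta_j]. *)
Definition bidiff := seq (B * jet * jet).

Definition bd_term (C : jetRing d n) (io : jetMor B C) (w w' : 'I_d -> C)
    (xi eta : 'I_n -> C) (t : B * jet * jet) : C :=
  io t.1.1 * mpow (tdw w) t.1.2.2 (xi t.1.2.1) * mpow (tdw w') t.2.2 (eta t.2.1).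

Definition bd_eval (C : jetRing d n) (io : jetMor B C) w w' xi eta (s : bidiff) : C :=
  \sum_(t <- s) bd_term io w w' xi eta t.

Definition biop := forall (C : jetRing d n) (io : jetMor B C) (w w' : 'I_d -> C)
  (xi eta : 'I_n -> C), C.

(** The list is chosen before the ring, the morphism and the weights. This uniformity carries
    vanishing from weight zero over to formal weights. *)
Definition is_bidiff (F : biop) := exists s : bidiff,
  forall (C : jetRing d n) (io : jetMor B C) (w w' : 'I_d -> C) (xi eta : 'I_n -> C),
  const_weight w -> const_weight w' ->
  F C io w w' xi eta = bd_eval io w w' xi eta s.

Lemma eq_bidiff (F G : biop) : is_bidiff F ->
  (forall C io w w' xi eta, const_weight w -> const_weight w' ->
     G C io w w' xi eta = F C io w w' xi eta) -> is_bidiff G.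
Proof. by move=> [s sE] FG; exists s => *; rewrite FG// sE. Qed.

Lemma bidiff0 : is_bidiff (fun C io w w' xi eta => 0).
Proof. by exists [::] => *; rewrite /bd_eval big_nil. Qed.

Lemma bidiffD (F G : biop) : is_bidiff F -> is_bidiff G ->
  is_bidiff (fun C io w w' xi eta => F C io w w' xi eta + G C io w w' xi eta).
Proof.
by move=> [s sE] [t tE]; exists (s ++ t) => *; rewrite sE// tE// /bd_eval big_cat.
Qed.

Lemma bidiff_sum (I : Type) (r : seq I) (Q : pred I) (F : I -> biop) :
  (forall x, is_bidiff (F x)) ->
  is_bidiff (fun C io w w' xi eta => \sum_(x <- r | Q x) F x C io w w' xi eta).
Proof.
move=> FB; elim: r => [|x r IH].
  by apply: eq_bidiff bidiff0 _ => *; rewrite big_nil.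
case Qx: (Q x).
  by apply: eq_bidiff (bidiffD (FB x) IH) _ => *; rewrite big_cons Qx.
by apply: eq_bidiff IH _ => *; rewrite big_cons Qx.
Qed.

Lemma bidiffM c (F : biop) : is_bidiff F ->
  is_bidiff (fun C io w w' xi eta => io c * F C io w w' xi eta).
Proof.
move=> [s sE]; exists [seq (c * t.1.1, t.1.2, t.2) | t <- s] => *.
rewrite sE// /bd_eval mulr_sumr big_map; apply: eq_bigr => t _.
by rewrite /bd_term rmorphM !mulrA.
Qed.

Lemma bidiffN (F : biop) : is_bidiff F ->
  is_bidiff (fun C io w w' xi eta => - F C io w w' xi eta).
Proof.
move=> FB; apply: eq_bidiff (bidiffM (-1) FB) _ => *.
by rewrite rmorphN1 mulN1r.
Qed.

Lemma bidiff_tdw a (F : biop) : is_bidiff F ->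
  is_bidiff (fun C io w w' xi eta => tdw (wadd w w') a (F C io w w' xi eta)).
Proof.
move=> [s sE].
exists (flatten [seq [:: (tdr a t.1.1, t.1.2, t.2);
    (t.1.1, (t.1.2.1, mnm_add t.1.2.2 (mnm1 a)), t.2);
    (t.1.1, t.1.2, (t.2.1, mnm_add t.2.2 (mnm1 a)))] | t <- s]).
move=> C io w w' xi eta wc wc'; rewrite sE// /bd_eval big_flatten big_map.
rewrite (addf_sum _ _ _ (@tdwD _ _ _ (wadd w w') a)); apply: eq_bigr => t _.
rewrite !big_cons big_nil /= addr0 /bd_term /= !mpowS; [|exact: tdwC..].
by rewrite /tdw /wadd !tdrM jm_tdr; ring.
Qed.

Lemma bidiff_ntdw a (F : biop) : is_bidiff F ->
  is_bidiff (fun C io w w' xi eta => ntdw (wadd w w') a (F C io w w' xi eta)).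
Proof. by move=> /(bidiff_tdw a)/bidiffN. Qed.

Lemma bidiff_mtdw S (F : biop) : is_bidiff F ->
  is_bidiff (fun C io w w' xi eta => mpow (tdw (wadd w w')) S (F C io w w' xi eta)).
Proof.
move=> FB; elim/mnm_ind: S => [|a S IH].
  by apply: eq_bidiff FB _ => *; rewrite mpow0.
apply: eq_bidiff (bidiff_tdw a IH) _ => C io w w' xi eta wc wc'.
by rewrite mpowS//; exact: tdwC (const_wadd wc wc').
Qed.

Lemma bidiff_mntdw S (F : biop) : is_bidiff F ->
  is_bidiff (fun C io w w' xi eta => mpow (ntdw (wadd w w')) S (F C io w w' xi eta)).
Proof.
move=> FB; elim/mnm_ind: S => [|a S IH].
  by apply: eq_bidiff FB _ => *; rewrite mpow0.
apply: eq_bidiff (bidiff_ntdw a IH) _ => C io w w' xi eta wc wc'.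
by rewrite mpowS//; exact: ntdwC (const_wadd wc wc').
Qed.

Lemma bidiff_basic u v : is_bidiff (fun C io w w' xi eta =>
  mpow (tdw w) u.2 (xi u.1) * mpow (tdw w') v.2 (eta v.1)).
Proof.
exists [:: (1, u, v)] => *.
by rewrite /bd_eval big_seq1 /bd_term rmorph1 mul1r.
Qed.

Definition diff_eval (C : jetRing d n) (io : jetMor B C) w xi (s : seq (B * jet)) : C :=
  \sum_(t <- s) io t.1 * mpow (tdw w) t.2.2 (xi t.2.1).

Lemma diff_mtdw S (s : seq (B * jet)) : exists s' : seq (B * jet),
  forall (C : jetRing d n) (io : jetMor B C) w xi, const_weight w ->
  mpow (tdw w) S (diff_eval io w xi s) = diff_eval io w xi s'.
Proof.
elim/mnm_ind: S => [|a S [s' sE]]; first by exists s => *; rewrite mpow0.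
exists (flatten [seq [:: (tdr a t.1, t.2);
    (t.1, (t.2.1, mnm_add t.2.2 (mnm1 a)))] | t <- s']).
move=> C io w xi wc; rewrite mpowS; last exact: tdwC.
rewrite sE// /diff_eval big_flatten big_map (addf_sum _ _ _ (@tdwD _ _ _ w a)).
apply: eq_bigr => t _; rewrite !big_cons big_nil /= addr0 !mpowS; last exact: tdwC.
by rewrite /tdw !tdrM jm_tdr; ring.
Qed.

Variable P : 'M[mpoly d B]_n.

Lemma hamil_diff k : exists s : seq (B * jet),
  forall (C : jetRing d n) (io : jetMor B C) w xi,
  hamil io P w xi k = diff_eval io w xi s.
Proof.
exists (flatten [seq [seq (mcoeff T (P k i), (i, T) : jet) | T <- msupp (P k i)]
  | i <- enum 'I_n]) => C io w xi.
rewrite /diff_eval big_flatten big_map /hamil big_enum; apply: eq_bigr => i _.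
by rewrite big_map.
Qed.

Lemma evol_diff c : exists s : seq (B * jet),
  forall (C : jetRing d n) (io : jetMor B C) w xi, const_weight w ->
  evol w (hamil io P w xi) (io c) = diff_eval io w xi s.
Proof.
have /choice[s sE] : forall v : jet, exists s : seq (B * jet),
    forall (C : jetRing d n) (io : jetMor B C) w xi, const_weight w ->
    mpow (tdw w) v.2 (hamil io P w xi v.1) = diff_eval io w xi s.
  move=> v; have [s sE] := hamil_diff v.1; have [s' sE'] := diff_mtdw v.2 s.
  by exists s' => C io w xi wc; rewrite sE sE'.
exists (flatten [seq [seq (par v c * t.1, t.2) | t <- s v] | v <- (dsupp c : seq jet)]).
move=> C io w xi wc; rewrite evol_io /dsum /diff_eval big_flatten big_map.
apply: eq_bigr => v _; rewrite sE// /diff_eval big_map mulr_suml.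
by apply: eq_bigr => t _; rewrite rmorphM; ring.
Qed.

(** In the first two sums only a coefficient of [P] is differentiated, along a field linear in one
    argument; in the third, the outer derivatives have weight [wadd w w'] and are expanded by the
    Leibniz rule. *)
Lemma bidiff_jac k : is_bidiff (fun C io w w' xi eta => jac io P w w' xi eta k).
Proof.
apply: bidiffD; first apply: bidiffD.
- apply: bidiff_sum => j; apply: bidiff_sum => S.
  have [s sE] := evol_diff (mcoeff S (P k j)).
  apply: (@eq_bidiff (fun C io w w' xi eta => \sum_(t <- s) io t.1 *
     (mpow (tdw w) t.2.2 (xi t.2.1) * mpow (tdw w') S (eta j)))).
    by apply: bidiff_sum => t; apply: bidiffM; exact: bidiff_basic t.2 (j, S).
  move=> C io w w' xi eta wc wc'; rewrite sE// /diff_eval mulr_suml.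
  by apply: eq_bigr => t _; rewrite mulrA.
- apply: bidiffN; apply: bidiff_sum => i; apply: bidiff_sum => S.
  have [s sE] := evol_diff (mcoeff S (P k i)).
  apply: (@eq_bidiff (fun C io w w' xi eta => \sum_(t <- s) io t.1 *
     (mpow (tdw w) S (xi i) * mpow (tdw w') t.2.2 (eta t.2.1)))).
    by apply: bidiff_sum => t; apply: bidiffM; exact: bidiff_basic (i, S) t.2.
  move=> C io w w' xi eta wc wc'; rewrite sE// /diff_eval mulr_suml.
  by apply: eq_bigr => t _; ring.
- apply: bidiffN; apply: bidiff_sum => l; apply: bidiff_sum => S; apply: bidiffM.
  apply: bidiff_mtdw; apply: bidiff_sum => j; apply: bidiff_sum => i.
  apply: bidiff_sum => S'; set c := mcoeff S' _.
  apply: (@eq_bidiff (fun C io w w' xi eta => \sum_(v <- dsupp c | v.1 == l)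
    mpow (ntdw (wadd w w')) v.2 (io (par v c) *
      (mpow (tdw w) S' (xi i) * mpow (tdw w') (@mnm0 d) (eta j))))).
    apply: bidiff_sum => v; apply: bidiff_mntdw; apply: bidiffM.
    exact: bidiff_basic (i, S') (j, @mnm0 d).
  move=> C io w w' xi eta wc wc'.
  rewrite /gvar dsum_io; last exact: gvar_addf.
  rewrite /dsum [RHS]big_mkcond; apply: eq_bigr => v _; case: eqP => // _.
  by congr mpow; rewrite mpow0; ring.
Qed.

End BidifferentialOperators.

(** * Bidifferential operators tested on variational derivatives *)

Section Coordinates.
Variables (d n : nat) (B : jetRing d n).
Local Notation jet := (jet d n).

Record jet_coordinates (uv : jet -> B) : Prop := JetCoordinates {
  par_coord : forall u v, par u (uv v) = (u == v)%:R;
  tdr_coord : forall a v, tdr a (uv v) = uv (jshift a v) }.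

Definition torsion_free := forall (x : B) k, (0 < k)%N -> x *+ k = 0 -> x = 0.

Definition w0 : 'I_d -> B := fun=> 0.

Lemma w0_const : const_weight w0.
Proof. by move=> a; split=> [v|b]; [exact: par0|exact: addf0 (@tdr_add _ _ _ _)]. Qed.

Lemma tdw0 a x : tdw w0 a x = tdr a x.
Proof. by rewrite /tdw mul0r add0r. Qed.

Definition idJ : jetMor B B :=
  @JetMor d n B B idfun (fun v p => erefl) (fun a p => erefl).

Variables (uv : jet -> B).
Hypotheses (uvP : jet_coordinates uv) (tf : torsion_free) (d_gt0 : (0 < d)%N).
Implicit Types (c x y p : B) (u v : jet) (i j k l : 'I_n) (a : 'I_d).
Implicit Types (I K S T : multinom d).

Lemma mtdw_coord I u : mpow (tdw w0) I (uv u) = uv (u.1, mnm_add u.2 I).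
Proof.
elim/mnm_ind: I => [|a I IH]; first by rewrite mpow0 addm0; case: u.
by rewrite mpowS ?IH ?tdw0 ?(tdr_coord uvP) /jshift /= ?addmA//; exact: tdwC w0_const.
Qed.

Lemma mntdwE w I x : const_weight w ->
  mpow (ntdw w) I x = (-1) ^+ mdeg I * mpow (tdw w) I x :> B.
Proof. by move=> wc; apply: mpowN => [a|a b y]; [exact: tdwD|exact: tdwC]. Qed.

Lemma evol_coord w X u : evol w X (uv u) = mpow (tdw w) u.2 (X u.1).
Proof.
rewrite /evol (@dsumE _ _ _ _ _ [:: u])//; first last.
- move=> v; rewrite mem_dsupp (par_coord uvP).
  by have [->|_] := eqVneq v u; rewrite ?mem_head// eqxx.
- exact: evol_addf.
by rewrite big_seq1 (par_coord uvP) eqxx mulr1.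
Qed.

Lemma gvar_coord w l x u :
  gvar w l x (uv u) = if u.1 == l then mpow (ntdw w) u.2 x else 0.
Proof.
rewrite /gvar (@dsumE _ _ _ _ _ [:: u])//; first last.
- move=> v; rewrite mem_dsupp (par_coord uvP).
  by have [->|_] := eqVneq v u; rewrite ?mem_head// eqxx.
- exact: gvar_addf.
by rewrite big_seq1 (par_coord uvP) eqxx mulr1.
Qed.

(** The test densities: their variational derivatives have a single nonzero component, and that one
    is a multiple of a coordinate. *)
Lemma vari_square l u : vari w0 l (uv u * uv u) =
  if u.1 == l then ((-1) ^+ mdeg u.2 * uv (u.1, mnm_add u.2 u.2)) *+ 2 else 0.
Proof.
rewrite /vari gvarM mul1r -mulr2n gvar_coord; case: eqP => _; last by rewrite mul0rn.
by rewrite mntdwE ?mtdw_coord//; exact: w0_const.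
Qed.

Lemma order_bound x : exists N, forall v, (N <= mdeg v.2)%N -> par v x = 0.
Proof.
exists (\max_(v <- (dsupp x : seq jet)) (mdeg v.2).+1)%N => v vN.
apply/eqP; apply: contraTT vN => xv; rewrite -ltnNge.
have vx : v \in (dsupp x : seq jet).
  by rewrite -[_ \in _]/(v \in dsupp x) mem_dsupp.
exact: (@leq_bigmax_seq _ (dsupp x : seq jet) xpredT
  (fun v : jet => (mdeg v.2).+1) v vx isT).
Qed.

Lemma bidiff_bound (s : bidiff B) : exists N, forall t, t \in s ->
  [/\ (mdeg t.1.2.2 <= N)%N, (mdeg t.2.2 <= N)%N &
      forall v, (N <= mdeg v.2)%N -> par v t.1.1 = 0].
Proof.
elim: s => [|t s [N sN]]; first by exists 0%N.
have [M tM] := order_bound t.1.1.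
exists (maxn N (maxn M (maxn (mdeg t.1.2.2) (mdeg t.2.2)))) => t'.
rewrite inE => /orP[/eqP->|/sN[h1 h2 h3]]; split; rewrite ?leq_max ?leqnn ?orbT ?h1 ?h2//.
  by move=> v vN; apply: tM; apply: leq_trans vN; rewrite !leq_max leqnn !orbT.
by move=> v vN; apply: h3; apply: leq_trans vN; rewrite leq_max leqnn.
Qed.

Lemma par2M u v c x y : par u c = 0 -> par v c = 0 -> par u y = 0 ->
  par v x = 0 -> par v (par u (c * x * y)) = c * par u x * par v y.
Proof.
move=> uc vc uy vx; rewrite (parM u (c * x)) uy mulr0 addr0 (parM u c) uc mul0r add0r.
by rewrite !parM vc parC vx par0 !(mul0r, mulr0, add0r).
Qed.

Let e0 (m : nat) : multinom d := mnm_muln (mnm1 (Ordinal d_gt0)) m.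

Lemma mdeg_e0 m : mdeg (e0 m) = m.
Proof. by rewrite mdegMn mdeg1 mul1n. Qed.

Variable s : bidiff B.
Hypothesis s_low : forall f g u, (1 < mdeg u.2)%N ->
  par u (bd_eval idJ w0 w0 (fun i => vari w0 i f) (fun j => vari w0 j g) s) = 0.


(** A sum, because the list may contain a pair several times. Evaluating on two squares and
    differentiating in the jet variables that [u] and [v] produce isolates this coefficient, up to
    sign and a factor [4]. *)
Lemma bidiff_key u v : \sum_(t <- s | (t.1.2 == u) && (t.2 == v)) t.1.1 = 0.
Proof.
(* The dummy term makes the bound cover the orders of [u] and [v] as well. *)
have [N sN] := bidiff_bound ((0, u, v) :: s).
have [M NM M1] : exists2 M, (N < M)%N & (1 < M)%N by exists N.+2.
have sM t : t \in (0, u, v) :: s -> [/\ (mdeg t.1.2.2 < M)%N, (mdeg t.2.2 < M)%N &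
    forall v, (M <= mdeg v.2)%N -> par v t.1.1 = 0].
  move=> /sN[h1 h2 h3]; split=> [||z zM];
    [exact: leq_ltn_trans h1 NM|exact: leq_ltn_trans h2 NM|].
  exact: h3 _ (leq_trans (ltnW NM) zM).
(* The derivatives of the two variational derivatives have orders in the ranges from [2M] to below
   [3M] and from [4M] to below [5M], while the coefficients have order below [M]. The ranges are
   disjoint, so each partial derivative meets only one factor. *)
pose K1 := e0 M; pose K2 := e0 (2 * M)%N.
pose u' : jet := (u.1, mnm_add (mnm_add K1 K1) u.2).
pose v' : jet := (v.1, mnm_add (mnm_add K2 K2) v.2).
have [uM vM _] := sM _ (mem_head _ _); rewrite /= in uM vM.
have low := @s_low (uv (u.1, K1) * uv (u.1, K1)) (uv (v.1, K2) * uv (v.1, K2)) u'.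
have {low} : par v' (par u' (bd_eval idJ w0 w0
   (fun i => vari w0 i (uv (u.1, K1) * uv (u.1, K1)))
   (fun j => vari w0 j (uv (v.1, K2) * uv (v.1, K2))) s)) = 0.
  by rewrite low ?par0// /u' /= !mdegD mdeg_e0; move: (mdeg _) => ?; lia.
have E w K S i : mpow (tdw w0) S (vari w0 i (uv (w, K) * uv (w, K))) =
    if w == i then ((-1) ^+ mdeg K * uv (w, mnm_add (mnm_add K K) S)) *+ 2 else 0.
  rewrite vari_square /=; case: eqP => _; last exact: addf0 (@mtdwD _ _ _ _ _).
  rewrite (addfMn _ _ (@mtdwD _ _ _ _ _)) (addf_sgn _ _ (@mtdwD _ _ _ _ _)).
  by rewrite mtdw_coord.
have psgn z K x : par z ((-1) ^+ mdeg K * x *+ 2) = (-1) ^+ mdeg K * par z x *+ 2 :> B.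
  by rewrite (addfMn _ _ (@par_add _ _ _)) (addf_sgn _ _ (@par_add _ _ _)).
rewrite /bd_eval (addf_sum _ _ _ (@par_add _ _ _)) (addf_sum _ _ _ (@par_add _ _ _)).
pose s1 : B := (-1) ^+ mdeg K1 *+ 2; pose s2 : B := (-1) ^+ mdeg K2 *+ 2.
rewrite big_seq (eq_bigr (fun t => (if (t.1.2 == u) && (t.2 == v) then t.1.1 else 0)
    * s1 * s2)) => [|t ts].
  rewrite -big_seq -!mulr_suml -big_mkcond /= => x0.
  have sgn b (x : B) : x * ((-1) ^+ b *+ 2) = 0 -> x = 0.
    rewrite mulrnAr => /(tf (isT : 0 < 2)%N); rewrite -signr_odd; case: odd.
      by rewrite mulrN1 => /eqP; rewrite oppr_eq0 => /eqP.
    by rewrite mulr1.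
  by apply: (sgn (mdeg K1)); apply: (sgn (mdeg K2)); exact: x0.
have [t1 t2 t3] := sM t (mem_behead (s := (0, u, v) :: s) ts).
rewrite /bd_term /= par2M; first last.
- rewrite E; case: eqP => _; last exact: par0.
  rewrite psgn (par_coord uvP); case: eqP => [h|_]; last by rewrite mulr0 mul0rn.
  have := congr1 (fun z : jet => mdeg z.2) h.
  rewrite /= !mdegD !mdeg_e0; move: t1 vM; move: (mdeg _) (mdeg _) => ? ?; lia.
- rewrite E; case: eqP => _; last exact: par0.
  rewrite psgn (par_coord uvP); case: eqP => [h|_]; last by rewrite mulr0 mul0rn.
  have := congr1 (fun z : jet => mdeg z.2) h.
  rewrite /= !mdegD !mdeg_e0; move: t2 uM; move: (mdeg _) (mdeg _) => ? ?; lia.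
- by apply: t3; rewrite /= !mdegD !mdeg_e0; move: (mdeg _) => ?; lia.
- by apply: t3; rewrite /= !mdegD !mdeg_e0; move: (mdeg _) => ?; lia.
have F z w K T : par (w.1, mnm_add (mnm_add K K) w.2)
    (mpow (tdw w0) T (vari w0 z (uv (w.1, K) * uv (w.1, K)))) =
    if (z, T) == w then (-1) ^+ mdeg K *+ 2 else 0.
  rewrite E; case: w => w I /=; rewrite xpair_eqE eq_sym; case: eqP => _ /=;
    last exact: par0.
  rewrite psgn (par_coord uvP) xpair_eqE eqxx eqm_add2l eq_sym.
  by case: eqP => _; rewrite ?mulr1// mulr0 mul0rn.
rewrite /u' /v' !F; case: t {ts t1 t2 t3} => [[c [i I]] [j J]] /=.
by do 2!case: eqP => _ //=; rewrite ?mulr0 ?mul0r.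
Qed.

(** Terms are grouped by their pair of jet variables; each group has total coefficient zero already
    in [B], hence in every ring and for all weights. *)
Lemma bidiff_vanish (C : jetRing d n) (io : jetMor B C) w w' xi eta :
  bd_eval io w w' xi eta s = 0.
Proof.
rewrite /bd_eval big_seq (eq_bigr (fun t => \sum_(k <- undup [seq (t.1.2, t.2) | t <- s] |
   (t.1.2 == k.1) && (t.2 == k.2)) io t.1.1 *
     (mpow (tdw w) k.1.2 (xi k.1.1) * mpow (tdw w') k.2.2 (eta k.2.1)))).
  rewrite -big_seq (exchange_big_dep xpredT)//= big1// => -[u v] _ /=.
  by rewrite -mulr_suml -(addf_sum _ _ _ (jm_addf io)) bidiff_key rmorph0 mul0r.
move=> t ts; rewrite -big_filter.
have -> : [seq k <- undup [seq (t.1.2, t.2) | t <- s] | (t.1.2 == k.1) && (t.2 == k.2)]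
    = [:: (t.1.2, t.2)].
  apply/perm_small_eq => //; apply: uniq_perm => //.
    by rewrite filter_uniq ?undup_uniq.
  move=> k; rewrite mem_filter mem_undup inE; case: k => u v /=.
  rewrite xpair_eqE [u == _]eq_sym [v == _]eq_sym; apply/andb_idr => /andP[/eqP<- /eqP<-].
  by apply/mapP; exists t.
by rewrite big_seq1 /bd_term mulrA.
Qed.

End Coordinates.

(** * Vector fields preserving total divergences *)

(* The [p]-th iterate of [fdelta] at [0] of the values [r |-> T (v ^+ r)] of an
   operator [T] is the value at [1] of its [p]-fold commutator with [v]. *)
Section FiniteDifferences.
Variables (R : comNzRingType) (v : R).
Implicit Types g h : nat -> R.

Definition fdelta g r := g r.+1 - v * g r.
(** Models the factor [r v^(r-1)] from differentiating [v^r]; at [r = 0] the multiplicity is zero,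
    so the truncated predecessor is harmless. *)
Definition fshift g r := g r.-1 *+ r.
Local Notation fdeltas p := (iter p fdelta).

Lemma eq_fdeltas p g h r : g =1 h -> fdeltas p g r = fdeltas p h r.
Proof. by move=> gh; elim: p r => //= p IH r; rewrite /fdelta !IH. Qed.

Lemma fdeltasD p g h r :
  fdeltas p (fun r => g r + h r) r = fdeltas p g r + fdeltas p h r.
Proof. by elim: p r => //= p IH r; rewrite /fdelta !IH; ring. Qed.

Lemma fdeltas0 p g r : (forall r, g r = 0) -> fdeltas p g r = 0.
Proof.
by move=> g0; elim: p r => //= p IH r; rewrite /fdelta !IH mulr0 subrr.
Qed.

Lemma fdeltasN p g r : fdeltas p (fun r => - g r) r = - fdeltas p g r.
Proof.
apply/eqP; rewrite -addr_eq0 -fdeltasD; apply/eqP/fdeltas0 => r'.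
exact: addNr.
Qed.

Lemma fdeltas_sum (I : Type) (s : seq I) (Q : pred I) (g : I -> nat -> R) p r :
  fdeltas p (fun r => \sum_(i <- s | Q i) g i r) r =
  \sum_(i <- s | Q i) fdeltas p (g i) r.
Proof.
elim: s => [|i s IH]; first by rewrite big_nil fdeltas0// => r'; rewrite big_nil.
rewrite big_cons; case Qi: (Q i).
  rewrite -IH -fdeltasD; apply: eq_fdeltas => r'; by rewrite big_cons Qi.
by rewrite -IH; apply: eq_fdeltas => r'; rewrite big_cons Qi.
Qed.

(** The Heisenberg relation: [fdelta] and [fshift] commute up to the identity, so [p] iterations
    yield [p] copies of the iterate of order [p - 1]. *)
Lemma fdeltas_shift p g r : fdeltas p (fshift g) r =
  fshift (fdeltas p g) r + fdeltas p.-1 g r *+ p.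
Proof.
elim: p r => [|p IH] r; first by rewrite mulr0n addr0.
rewrite /= {1}/fdelta !IH.
case: p {IH} => [|p].
  rewrite !mulr0n !addr0 /= /fshift /fdelta; case: r => [|r] /=; last first.
    by rewrite !mulrS; ring.
  by rewrite !mulr1n !mulr0n; ring.
set G := fdeltas p.+1 g; set H := fdeltas p.+1.-1 g.
have -> : G r = fdelta H r by [].
have GE r' : G r' = H r'.+1 - v * H r' by [].
rewrite /fshift /fdelta; case: r => [|r] /=.
  by rewrite !GE; ring.
by rewrite !GE; ring.
Qed.

End FiniteDifferences.

Section OrderBound.
Variables (d n : nat) (B : jetRing d n) (uv : jet d n -> B).
Hypotheses (uvP : jet_coordinates uv) (tf : torsion_free B) (d_gt0 : (0 < d)%N).
Local Notation jet := (jet d n).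
Local Notation td0 := (tdw (@w0 d n B)).
Local Notation ntd0 := (ntdw (@w0 d n B)).
Implicit Types (c x y z : B) (u v : jet) (i j k l : 'I_n) (a b : 'I_d).
Implicit Types (I K L S T : multinom d) (p q r : nat).

Let wc := @w0_const d n B.

Definition alpha x L c r := mpow ntd0 L (x ^+ r * c).

Lemma tdrX a x r : tdr a (x ^+ r) = (x ^+ r.-1 * tdr a x) *+ r.
Proof.
elim: r => [|r IH].
  rewrite mulr0n expr0; have := tdrM a (1 : B) 1; rewrite !mulr1 mul1r => E.
  by apply: (addrI (tdr a 1)); rewrite -E addr0.
by case: r IH => [_|r IH]; [rewrite expr0 mul1r|rewrite exprS tdrM IH /= exprS !mulrS; ring].
Qed.

Lemma alphaS x L a c r : alpha x (mnm_add L (mnm1 a)) c r =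
  alpha x L (ntd0 a c) r + - fshift (alpha x L (tdr a x * c)) r.
Proof.
rewrite /alpha /fshift mpowSr; last exact: ntdwC.
rewrite -(addfMn _ _ (@mntdwD _ _ _ _ _)) -(addfN _ (@mntdwD _ _ _ _ _)) -mntdwD.
congr mpow; rewrite /ntdw !tdw0 tdrM tdrX mulrnAl mulrA; ring.
Qed.

(** A [p]-fold commutator kills operators of order below [p], and at order [p] leaves [p!] times the
    principal symbol evaluated at the total derivatives of [x]. *)
Lemma fdeltas_alpha x L c p r : (mdeg L <= p)%N ->
  iter p (fdelta x) (alpha x L c) r = if p == mdeg L then
    (x ^+ r * mpow (fun a y => - tdr a x * y) L c) *+ p`! else 0.
Proof.
elim/mnm_ind: L c p r => [|a L IH] c p r.
  rewrite mdeg0 mpow0; case: p => [|p] _ /=; first by rewrite /alpha mpow0.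
  rewrite -[LHS]/(iter p.+1 (fdelta x) (alpha x (@mnm0 d) c) r) iterSr.
  by apply: fdeltas0 => r'; rewrite /fdelta /alpha !mpow0 exprS mulrA subrr.
rewrite mdegD mdeg1 addn1 => Lp.
rewrite (eq_fdeltas x p r (alphaS x L a c)) fdeltasD fdeltasN fdeltas_shift.
rewrite IH ?(ltnW Lp)// (gtn_eqF Lp) add0r {1}/fshift IH ?(ltnW Lp)//.
rewrite (gtn_eqF Lp) mul0rn add0r; case: p Lp => // p Lp.
rewrite IH//= eqSS; case: eqP => [->|_]; last by rewrite mul0rn oppr0.
rewrite mpowSr; last by move=> b e y; ring.
have XD : addf (mpow (fun b y => - tdr b x * y) L).
  by apply: mpow_addf => b y z; rewrite mulrDr.
by rewrite mulNr (addfN _ XD) mulrN mulNrn factS mulnC mulrnA.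
Qed.

Lemma gvarX w l y x r : gvar w l y (x ^+ r) = gvar w l (y * x ^+ r.-1) x *+ r.
Proof.
elim: r y => [|r IH] y.
  by rewrite mulr0n expr0; apply: gvar_const => v; exact: par1.
case: r IH => [_|r IH]; first by rewrite expr1 expr0 mulr1.
by rewrite exprS gvarM IH /= -mulrA -exprS -mulrSr.
Qed.

Lemma evolX w X x r : evol w X (x ^+ r) = (x ^+ r.-1 * evol w X x) *+ r.
Proof.
elim: r => [|r IH]; first by rewrite mulr0n; apply: evol_const => v; exact: par1.
by case: r IH => [_|r IH]; [rewrite expr0 mul1r|rewrite exprS evolM IH /= exprS !mulrS; ring].
Qed.

Definition order_le z q := forall u, (q < mdeg u.2)%N -> par u z = 0.

Lemma par_td0 i I a z : par (i, I) (td0 a z) = td0 a (par (i, I) z) +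
  (if (0 < I a)%N then par (i, mnm_sub I (mnm1 a)) z else 0).
Proof. exact: par_tdw wc _ _ _ _. Qed.

Lemma mpow_td0S K a z : mpow td0 (mnm_add K (mnm1 a)) z = td0 a (mpow td0 K z).
Proof. by apply: mpowS; exact: tdwC. Qed.

Lemma td00 a : td0 a 0 = 0. Proof. exact: addf0 (@tdwD _ _ _ _ _). Qed.

Lemma mdeg_sub1 I a : (0 < I a)%N -> (mdeg (mnm_sub I (mnm1 a))).+1 = mdeg I.
Proof.
move=> Ia; rewrite -[in RHS](@submK _ (mnm1 a) I); last by rewrite lep1mP -lt0n.
by rewrite mdegD mdeg1 addn1.
Qed.

Lemma order_td z q K : order_le z q -> order_le (mpow td0 K z) (q + mdeg K).
Proof.
move=> zq; elim/mnm_ind: K => [|a K IH]; first by rewrite mpow0 mdeg0 addn0.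
move=> [i I] /=; rewrite mdegD mdeg1 addnA addn1 => KI.
rewrite mpow_td0S par_td0 IH ?(ltnW KI)// td00 add0r.
by case: ifP => // Ia; rewrite IH//= -ltnS mdeg_sub1.
Qed.

(** Above the order of the differentiated element, only the index shift in the commutator of partial
    and total derivatives survives. *)
Lemma par_top z q i L K : order_le z q -> (q <= mdeg L)%N ->
  par (i, mnm_add L K) (mpow td0 K z) = par (i, L) z.
Proof.
move=> zq qL; elim/mnm_ind: K => [|a K IH]; first by rewrite mpow0 addm0.
rewrite mpow_td0S par_td0 (order_td zq) /= ?td00 ?add0r; last first.
  by rewrite !mdegD mdeg1; lia.
by rewrite addmA mnmDE mnm1E eqxx addn1 /= addmK IH.
Qed.

(** Two jet variables occurring together have order at most [q] each in [z], and then share the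
    [|K|] derivatives between them. *)
Lemma par_two z q u v K : order_le z q -> (q + q + mdeg K < mdeg u.2 + mdeg v.2)%N ->
  par u (par v (mpow td0 K z)) = 0.
Proof.
move=> zq; elim/mnm_ind: K u v => [|a K IH] [i I] [j J] /=.
  rewrite mpow0 mdeg0 addn0 => qIJ.
  have [qJ|Jq] := ltnP q (mdeg J); first by rewrite (zq (j, J)) ?par0.
  by rewrite parC (zq (i, I)) ?par0//=; lia.
rewrite mdegD mdeg1 => qIJ; rewrite mpow_td0S par_td0 parD par_td0.
rewrite (IH (i, I) (j, J)) ?td00 ?add0r/=; last lia.
rewrite [X in X + _](_ : _ = 0) ?add0r; last first.
  by case: ifP => // Ia; rewrite IH//=; have := mdeg_sub1 Ia; lia.
case: ifP => [Ja|_]; last exact: par0.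
by rewrite IH//=; have := mdeg_sub1 Ja; lia.
Qed.

Section Isolation.
Variables (Q : 'I_d -> B -> B) (xx : 'I_d -> B).
Hypotheses (QD : forall a, addf (Q a))
  (QM : forall a x y, Q a (x * y) = Q a x * y + x * Q a y)
  (QC : forall a b x, Q a (Q b x) = Q b (Q a x))
  (Qx : forall a b, Q a (xx b) = (a == b)%:R).
Local Notation X := (fun b y => xx b * y).

Lemma XC a b y : xx a * (xx b * y) = xx b * (xx a * y).
Proof. exact: mulrCA. Qed.

Lemma Q_mono a L c : Q a c = 0 ->
  Q a (mpow X L c) = mpow X (mnm_sub L (mnm1 a)) c *+ L a.
Proof.
move=> c0; elim/mnm_ind: L => [|b L IH].
  by rewrite mpow0 c0 mnm0E mulr0n.
rewrite mpowS; last exact: XC.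
rewrite QM Qx IH mnmDE mnm1E eq_sym; case: eqVneq => [->|ab] /=.
  rewrite mul1r addmK addn1 mulrS; congr (_ + _).
  have [->|La] := posnP (L a); first by rewrite !mulr0n mulr0.
  have LE : L = mnm_add (mnm_sub L (mnm1 a)) (mnm1 a).
    by rewrite submK// lep1mP -lt0n.
  by rewrite mulrnAr; congr (_ *+ _); rewrite [in RHS]LE mpowS//; exact: XC.
rewrite mul0r add0r addn0 mulrnAr; congr (_ *+ _).
have -> : mnm_sub (mnm_add L (mnm1 b)) (mnm1 a) =
    mnm_add (mnm_sub L (mnm1 a)) (mnm1 b).
  apply/mnmP => e; rewrite !(mnmBE, mnmDE, mnm1E).
  have [<-|ae] := eqVneq a e; last by rewrite !subn0.
  by rewrite (negPf ab) !addn0.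
by rewrite mpowS//; exact: XC.
Qed.

(** The [Q a] act as partial derivatives in the [xx a], so [mpow Q K] extracts the coefficient of
    one monomial; [N] is the factorial of the multi-index [K]. *)
Lemma Q_mpow K : exists2 N, (0 < N)%N & forall L c, mdeg L = mdeg K ->
  (forall a, Q a c = 0) -> mpow Q K (mpow X L c) = if L == K then c *+ N else 0.
Proof.
elim/mnm_ind: K => [|a K [N N0 IH]].
  exists 1%N => // L c; rewrite mdeg0 => /eqP; rewrite mdeg_eq0 => /eqP-> _.
  by rewrite eqxx !mpow0 mulr1n.
exists (N * (K a).+1)%N => [|L c LK c0]; first by rewrite muln_gt0 N0.
rewrite mpowSr// Q_mono// (addfMn _ _ (mpow_addf K QD)).
have [La|La] := posnP (L a).
  rewrite La mulr0n; case: eqP => // LE.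
  by move: La; rewrite LE mnmDE mnm1E eqxx addn1.
rewrite IH//; last by apply: succn_inj; rewrite mdeg_sub1// LK mdegD mdeg1 addn1.
rewrite -(eqm_add2r (mnm1 a)) submK; last by rewrite lep1mP -lt0n.
case: eqP => [->|_]; last by rewrite mul0rn.
by rewrite mnmDE mnm1E eqxx addn1 -mulrnA.
Qed.

End Isolation.

Variable Z : 'I_n -> B.
Hypothesis Z0 : forall h l, vari (@w0 d n B) l (evol (@w0 d n B) Z h) = 0.

Lemma order_step k q : (1 < q)%N -> order_le (Z k) q -> order_le (Z k) q.-1.
Proof.
move=> q1 Zq [l L] /=; rewrite prednK ?(ltnW q1)// => qL.
have [qL'|Lq] := ltnP q (mdeg L); first exact: Zq.
have {qL Lq} Lq : mdeg L = q by apply/eqP; rewrite eqn_leq qL Lq.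
pose a0 : 'I_d := Ordinal d_gt0.
(* Only the length of [K] matters, not its direction: it must be large enough for [par_two] to
   exclude the variables [u^k_{K + E_a}] from the derivatives of [Y] of order [p]. *)
pose K := mnm_muln (mnm1 a0) q.+1.
have mK : mdeg K = q.+1 by rewrite mdegMn mdeg1 mul1n.
pose v := uv (k, K); pose Y := mpow td0 K (Z k); pose p := (q + q.+1)%N.
have Yq : order_le Y p by rewrite /p -mK; exact: order_td.
have EY r : vari (@w0 d n B) l (v ^+ r * Y) = 0.
  have := Z0 (v ^+ r.+1) l; rewrite evolX /= (evol_coord uvP) -/Y.
  by rewrite /vari (addfMn _ _ (@gvarD _ _ _ _ _ _)) => /tf; apply.
(* [ga] collects the contributions of the jet variables in [Y], and [gb] that of [v] itself. *)
pose ga r := \sum_(u <- dsupp Y | u.1 == l) alpha v u.2 (par u Y) r.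
pose gb r := if k == l then fshift (alpha v K Y) r else 0.
have gab r : ga r + gb r = 0.
  rewrite -(EY r) /vari gvarM !mul1r; congr (_ + _).
    by rewrite /gvar /dsum /ga big_mkcond.
  rewrite gvarX (gvar_coord uvP) /gb /=; case: eqP => _; last by rewrite mul0rn.
  by rewrite mulrC.
have := fdeltasD v p ga gb 0.
rewrite (fdeltas0 v p (g := fun r => ga r + gb r))// [iter p _ gb _](_ : _ = 0).
  rewrite addr0 /ga fdeltas_sum => /esym.
  rewrite big_seq_cond (eq_bigr (fun u => if mdeg u.2 == p then
     mpow (fun a y => - tdr a v * y) u.2 (par u Y) *+ p`! else 0)); last first.
    move=> u /andP[uY _]; rewrite fdeltas_alpha; last first.
      rewrite leqNgt; apply: contraTN uY => pu.
      by rewrite -[_ \in _]/(u \in dsupp Y) mem_dsupp (Yq _ pu) eqxx.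
    by rewrite expr0 mul1r eq_sym.
  rewrite -big_seq_cond -big_mkcondr /= sumrMnl => /tf -/(_ (fact_gt0 p)) S0.
  (* The factors [- tdr a v] are minus the coordinates [u^k_{K + E_a}], so [Q] is dual to them; the
     remaining coefficients are annihilated by [Q], and the monomial of index [L + K] can be
     isolated. *)
  pose Q a y := - par (k, mnm_add K (mnm1 a)) y : B.
  have QD a : addf (Q a) by move=> y z; rewrite /Q parD opprD.
  have QM a y z : Q a (y * z) = Q a y * z + y * Q a z by rewrite /Q parM; ring.
  have QC a b y : Q a (Q b y) = Q b (Q a y) by rewrite /Q !parN parC.
  have Qx a b : Q a (- tdr b v) = (a == b)%:R.
    rewrite /Q parN opprK (tdr_coord uvP) (par_coord uvP) /jshift /=.
    by rewrite xpair_eqE eqxx eqm_add2l eq_mnm1.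
  have [N N0 QN] := Q_mpow QD QM QC Qx (mnm_add L K).
  have LKp : mdeg (mnm_add L K) = p by rewrite mdegD Lq mK.
  have := congr1 (mpow Q (mnm_add L K)) S0.
  have mQD : addf (mpow Q (mnm_add L K)) := mpow_addf _ QD.
  rewrite (addf0 mQD) (addf_sum _ _ _ mQD).
  rewrite (eq_bigr (fun u => if u.2 == mnm_add L K then par u Y *+ N else 0)); last first.
    move=> u /andP[_ /eqP up]; rewrite QN ?up// => a.
    by rewrite /Q (par_two Zq) ?oppr0//= mdegD mdeg1 mK up /p; lia.
  rewrite -big_mkcondr /= => LK0.
  rewrite -(@par_top _ q l L K Zq) ?Lq// -/Y; apply/eqP; apply: contrapT => /negP Y0.
  have uY : (l, mnm_add L K) \in (dsupp Y : seq jet).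
    by rewrite -[_ \in _]/(_ \in dsupp Y) mem_dsupp.
  case/eqP: Y0; apply: (tf N0); rewrite -[RHS]LK0 -big_filter.
  rewrite (_ : [seq _ <- _ | _] = [:: (l, mnm_add L K)]) ?big_seq1//.
  apply/perm_small_eq => //; apply: uniq_perm; rewrite ?filter_uniq ?fset_uniq// => u.
  rewrite mem_filter inE; case: u => j J /=; apply/idP/eqP => [|[-> ->]].
    by move=> /andP[/andP[/andP[/eqP-> _] /eqP->] _].
  by rewrite !eqxx LKp eqxx.
(* At [r = 0] only [p] copies of a commutator of length [p - 1 = 2q] remain, applied to an operator
   of order [q + 1]. This is where [q > 1] is needed. *)
rewrite /gb; case: eqP => _; last exact: fdeltas0.
rewrite fdeltas_shift /fshift mulr0n add0r fdeltas_alpha mK /p; last lia.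
by case: eqP => [|_]; [lia|rewrite mul0rn].
Qed.

Lemma order_le1 k u : (1 < mdeg u.2)%N -> par u (Z k) = 0.
Proof.
have [N ZN] := order_bound (Z k).
have {}ZN : order_le (Z k) N by move=> v vN; apply: ZN; exact: ltnW.
suff H : order_le (Z k) 1 by exact: H.
elim: N ZN => [|[|N] IH] ZN //; last by apply: IH; exact: (@order_step k N.+2).
by move=> v v1; apply: ZN; exact: ltnW.
Qed.

End OrderBound.

(** * From functionals to densities *)

Section LocalFunctionals.
Variables (d n : nat) (B : jetRing d n) (P : 'M[mpoly d B]_n).
Implicit Types (f g h p q x y : B) (i j k l : 'I_n) (a b : 'I_d) (I L : multinom d).
Local Notation w0 := (@w0 d n B).
Local Notation id0 := (idJ B).
Let wc := @w0_const d n B.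

Definition null p := exists h : 'I_d -> B, p = \sum_a tdr a (h a).

Lemma tdr0 a : tdr a (0 : B) = 0. Proof. exact: addf0 (@tdr_add _ _ _ _). Qed.

Lemma null0 : null 0.
Proof. by exists (fun=> 0); rewrite big1// => a _; exact: tdr0. Qed.

Lemma nullD p q : null p -> null q -> null (p + q).
Proof.
move=> [s ->] [t ->]; exists (fun a => s a + t a).
by rewrite -big_split; apply: eq_bigr => a _; rewrite tdr_add.
Qed.

Lemma nullN p : null p -> null (- p).
Proof.
move=> [s ->]; exists (fun a => - s a).
by rewrite -sumrN; apply: eq_bigr => a _; rewrite tdrN.
Qed.

Lemma nullB p q : null p -> null q -> null (p - q).
Proof. by move=> np nq; apply: nullD => //; exact: nullN. Qed.

Lemma null_sum (J : Type) (s : seq J) (Q : pred J) (F : J -> B) :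
  (forall z, null (F z)) -> null (\sum_(z <- s | Q z) F z).
Proof.
by move=> FN; apply: (big_ind null) => [|x y|z _]; [exact: null0|exact: nullD|exact: FN].
Qed.

Lemma null_td a x : null (tdr a x).
Proof.
exists (fun b => if b == a then x else 0).
rewrite (bigD1 a)//= eqxx big1 ?addr0// => b /negPf->; exact: tdr0.
Qed.

Lemma vari_null l p : null p -> vari w0 l p = 0.
Proof.
move=> [s ->]; rewrite /vari (addf_sum _ _ _ (@gvarD _ _ _ _ _ _)) big1// => a _.
by rewrite -tdw0; exact: vari_tdw.
Qed.

Lemma null_parts L x y :
  null (mpow (tdw w0) L x * y - x * mpow (ntdw w0) L y).
Proof.
elim/mnm_ind: L x y => [|a L IH] x y; first by rewrite !mpow0 subrr; exact: null0.
rewrite mpowS; last exact: tdwC.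
rewrite mpowSr; last exact: ntdwC.
move: (mpow (tdw w0) L x) (IH x (ntdw w0 a y)) => z nz.
rewrite (_ : _ - _ = (z * ntdw w0 a y - x * mpow (ntdw w0) L (ntdw w0 a y)) +
  tdr a (z * y)); first by apply: nullD => //; exact: null_td.
by rewrite tdrM /ntdw !tdw0; ring.
Qed.

Lemma null_evol X g : null (evol w0 X g - \sum_j vari w0 j g * X j).
Proof.
have -> : \sum_j vari w0 j g * X j =
    dsum (fun v y => X v.1 * mpow (ntdw w0) v.2 y) g.
  rewrite (eq_bigr (fun j => dsum (fun v y => if v.1 == j then
      X v.1 * mpow (ntdw w0) v.2 y else 0) g)) => [|j _].
    rewrite -dsum_sum; apply: eq_dsum => v y.
    by rewrite (bigD1 v.1)//= eqxx big1 ?addr0// => i /negPf; rewrite eq_sym => ->.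
  rewrite /vari /gvar (@dsum_morph _ _ _ _ (fun x => x * X j)); last first.
    by move=> x y; rewrite mulrDl.
  by apply: eq_dsum => v y; case: eqP => [->|_]; rewrite ?mul0r// mul1r mulrC.
rewrite /evol /dsum -sumrB; apply: null_sum => v; exact: null_parts.
Qed.

Definition fbracket f g :=
  \sum_i \sum_j vari w0 j g * act id0 w0 (P j i) (vari w0 i f).

Local Notation W := (wbracket id0 P w0).

(** Replaces the functional bracket by a derivation of densities, for which the commutator formula
    is available. *)
Lemma null_fbracket f g : null (fbracket f g - W f g).
Proof.
rewrite -opprB; apply: nullN; rewrite /fbracket exchange_big /=.
rewrite (eq_bigr (fun j => vari w0 j g * hamil id0 P w0 (fun i => vari w0 i f) j)).
  exact: null_evol.
by move=> j _; rewrite -mulr_sumr.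
Qed.

Lemma fbracketDl g : addf (fbracket^~ g).
Proof.
move=> f f'; rewrite -big_split; apply: eq_bigr => i _; rewrite -big_split.
by apply: eq_bigr => j _; rewrite /vari gvarD actD mulrDr.
Qed.

Lemma fbracketDr f : addf (fbracket f).
Proof.
move=> g g'; rewrite -big_split; apply: eq_bigr => i _; rewrite -big_split.
by apply: eq_bigr => j _; rewrite /vari gvarD mulrDl.
Qed.

Hypotheses (Psk : skew_adjoint id0 P)
  (wd : forall f f' g g', null (f - f') -> null (g - g') ->
     null (fbracket f g - fbracket f' g'))
  (alt : forall f, null (fbracket f f))
  (jacobi : forall f g h, null (fbracket f (fbracket g h) +
     fbracket g (fbracket h f) + fbracket h (fbracket f g))).

Lemma null_anti f g : null (fbracket f g + fbracket g f).
Proof.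
have := nullB (nullB (alt (f + g)) (alt f)) (alt g).
rewrite fbracketDl !fbracketDr.
by rewrite (_ : _ - _ - _ = fbracket f g + fbracket g f)//; ring.
Qed.

Lemma null_subrr f : null (f - f).
Proof. by rewrite subrr; exact: null0. Qed.

Lemma null_fbracket2 f g h : null (fbracket f (fbracket g h) - W f (W g h)).
Proof.
have := nullD (wd (null_subrr f) (null_fbracket g h)) (null_fbracket f (W g h)).
by rewrite subrKA.
Qed.

(** Well-definedness allows inner brackets to be changed by divergences, and anticommutativity
    brings the cyclic sum to commutator form. *)
Lemma null_wbracket_jacobi f g h :
  null (W f (W g h) - W g (W f h) - W (W f g) h).
Proof.
have n1 := null_fbracket2 f g h.
have n2 : null (fbracket g (fbracket h f) + W g (W f h)).
  have a1 : null (fbracket h f - - fbracket f h) by rewrite opprK; exact: null_anti.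
  have := nullB (wd (null_subrr g) a1) (null_fbracket2 g f h).
  by rewrite (addfN _ (fbracketDr g)) (_ : _ - _ - _ =
    fbracket g (fbracket h f) + W g (W f h))//; ring.
have n3 : null (fbracket h (fbracket f g) + W (W f g) h).
  have := nullB (nullB (null_anti h (fbracket f g))
    (wd (null_fbracket f g) (null_subrr h))) (null_fbracket (W f g) h).
  by rewrite (_ : _ - _ - _ = fbracket h (fbracket f g) + W (W f g) h)//; ring.
have := nullB (nullB (nullB (jacobi f g h) n1) n2) n3.
by rewrite (_ : _ - _ - _ - _ = W f (W g h) - W g (W f h) - W (W f g) h)//; ring.
Qed.

(** By [evol_comm] and [jacobiator], the null density of the weight-zero Jacobi identity is the
    derivative of [h] along [jac]. *)
Lemma vari_jac f g h l : vari w0 l (evol w0 (jac id0 P w0 w0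
  (fun i => vari w0 i f) (fun j => vari w0 j g)) h) = 0.
Proof.
apply: vari_null; have := null_wbracket_jacobi f g h.
rewrite (_ : W f (W g h) - W g (W f h) - W (W f g) h = evol w0 (jac id0 P w0 w0
  (fun i => vari w0 i f) (fun j => vari w0 j g)) h)//.
have ww : w0 =1 wadd w0 w0 by move=> a; rewrite /wadd addr0.
rewrite {1 2}/wbracket (@evol_comm _ _ _ w0 w0 w0)//.
apply/eqP; rewrite subr_eq; apply/eqP; rewrite /wbracket -evol_DX.
apply: eq_evol => // k; rewrite -jacobiator//.
(* [jacobiator] yields the weight [wadd w0 w0], which agrees with [w0] only pointwise. *)
have E x : hamil id0 P w0 (fun i => vari w0 i x) k =
    hamil id0 P (wadd w0 w0) (fun i => vari (wadd w0 w0) i x) k.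
  apply: eq_hamil => // i; apply: eq_dsum => v y; case: eqP => // _.
  by apply: eq_mpow => a z; rewrite /ntdw (@eq_tdw _ _ _ w0 (wadd w0 w0)).
by rewrite [X in _ = _ + X]E subrK.
Qed.

End LocalFunctionals.

(** * Vanishing of the Jacobiator and the axioms of the bracket *)

Section PoissonBivector.
Variables (d n : nat) (B : jetRing d n) (P : 'M[mpoly d B]_n) (uv : jet d n -> B).
Hypotheses (uvP : jet_coordinates uv) (tf : torsion_free B) (d_gt0 : (0 < d)%N).
Hypothesis Psk : skew_symbols P.
Local Notation fb := (fbracket P).
Hypotheses
  (wd : forall f f' g g', null (f - f') -> null (g - g') -> null (fb f g - fb f' g'))
  (alt : forall f, null (fb f f))
  (jacobi : forall f g h, null (fb f (fb g h) + fb g (fb h f) + fb h (fb f g))).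
Implicit Types (f g h c : B) (a : 'I_d).

(** Here [xi], [eta] and the weights are arbitrary: the order bound, tested on variational
    derivatives of weight zero, makes the coefficients of the operator cancel. *)
Lemma jac_eq0 (C : jetRing d n) (io : jetMor B C) w w' xi eta k :
  const_weight w -> const_weight w' -> jac io P w w' xi eta k = 0.
Proof.
have [s sE] := bidiff_jac P k; move=> wc wc'; rewrite sE//.
apply: (bidiff_vanish uvP tf d_gt0) => f g u u1.
rewrite -sE; [|exact: w0_const|exact: w0_const].
apply: (order_le1 uvP tf d_gt0 (Z := jac (idJ B) P (@w0 d n B) (@w0 d n B)
  (fun i => vari (@w0 d n B) i f) (fun j => vari (@w0 d n B) j g))) u1 => h l.
apply: vari_jac => //; exact: skew_symbols_adjoint.
Qed.

Definition lbracket f g : mpoly d B :=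
  @wbracket d n B (polyB B) (polyC B) P (@lam d n B) (mpolyC d f) (mpolyC d g).

Lemma jconstC c : jconst c -> @jconst d n (polyB B) (mpolyC d c).
Proof.
by move=> [pc tc]; split=> [v|a]; rewrite -?(jm_par (polyC B)) -?(jm_tdr (polyC B));
  [rewrite /= pc mpolyC0|rewrite /= tc mpolyC0].
Qed.

Lemma lbracket_linl c f f' g : jconst c ->
  lbracket (c * f + f') g = mpolyC d c * lbracket f g + lbracket f' g.
Proof.
move=> cc; rewrite /lbracket mpolyCD mpolyCM wbracketDl wbracket_cstl//.
exact: jconstC.
Qed.

Lemma lbracket_linr c f g g' : jconst c ->
  lbracket f (c * g + g') = mpolyC d c * lbracket f g + lbracket f g'.
Proof.
move=> cc; rewrite /lbracket mpolyCD mpolyCM wbracketDr wbracket_cstr//.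
exact: jconstC.
Qed.

Lemma lbracket_tdl a f g : lbracket (tdr a f) g = - (lam B a * lbracket f g).
Proof.
rewrite /lbracket -[mpolyC d (tdr a f)]/(polyC B (tdr a f)) jm_tdr.
exact: (@wbracket_tdl d n B (polyB B) (polyC B) P (@lam d n B) (lam_const B)).
Qed.

Lemma lbracket_tdr a f g : lbracket f (tdr a g) = lamd a (lbracket f g).
Proof.
rewrite /lbracket -[mpolyC d (tdr a g)]/(polyC B (tdr a g)) jm_tdr.
exact: (@wbracket_tdr d n B (polyB B) (polyC B) P (@lam d n B) (lam_const B)).
Qed.

Lemma lbracketMr f g h :
  lbracket f (g * h) = lbracket f g * mpolyC d h + lbracket f h * mpolyC d g.
Proof. by rewrite /lbracket mpolyCM wbracketMr. Qed.

Lemma lbracketMl f g h :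
  lbracket (f * g) h = symbol_comp (lbracket f h) (mpolyC d g) +
    symbol_comp (lbracket g h) (mpolyC d f).
Proof. exact: (@wbracketMl d n B (polyB B) (polyC B) P _ _ _ (poly_symbol_calculus B)). Qed.

Lemma lbracket_skew f g : lbracket g f = - symbol_adj (lbracket f g).
Proof.
apply: (@wbracket_skew d n B (polyB B) (polyC B) P _ _ _ (lam_const B) (poly_symbol_calculus B)).
exact: skew_symbols_adjoint.
Qed.

Definition lamN a : mpoly (d + d) B := mpolyX B (mnm1 (lshift d a)).
Definition muN a : mpoly (d + d) B := mpolyX B (mnm1 (rshift d a)).

(** Substitution turns all the brackets into brackets of weights [lamN], [muN] and their sum over
    one polynomial ring, where the weighted Jacobi identity applies. *)
Lemma lbracket_jacobi f g h :
  \sum_(N <- msupp (lbracket g h))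
     psubst lamN (lbracket f (mcoeff N (lbracket g h))) * mmap1 muN N
  - \sum_(N <- msupp (lbracket f h))
      psubst muN (lbracket g (mcoeff N (lbracket f h))) * mmap1 lamN N
  = \sum_(N <- msupp (lbracket f g))
      mmap1 lamN N * psubst (fun a => lamN a + muN a) (lbracket (mcoeff N (lbracket f g)) h).
Proof.
pose MP2 := mpoly (d + d) B; pose cw := @const_weight d n (mpoly_jetRing (d + d) B).
have lc : cw lamN.
  by apply: const_weightX => a; exists (mnm1 (lshift d a)).
have mc : cw muN.
  by apply: const_weightX => a; exists (mnm1 (rshift d a)).
have sc := const_wadd lc mc.
have psubstE (z : 'I_d -> MP2) (p : mpoly d B) :
    psubst z p = \sum_(N <- msupp p) mpolyC (d + d) (mcoeff N p) * mmap1 z N by [].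
have psE (z : 'I_d -> MP2) (zc : cw z) f' g' :
    psubst z (lbracket f' g') =
    wbracket (mpolyC_jetMor (d + d) B) P z (mpolyC _ f') (mpolyC _ g').
  exact: psubst_wbracket.
have sumr (w e : 'I_d -> MP2) (wc : cw w) (ec : cw e) f' p :
    \sum_(N <- msupp p) psubst w (lbracket f' (mcoeff N p)) * mmap1 e N =
    wbracket (mpolyC_jetMor (d + d) B) P w (mpolyC _ f') (psubst e p).
  rewrite psubstE -wbracket_sumr => [|N]; last exact: jconst_mmap1.
  by apply: eq_bigr => N _; rewrite psE.
have suml (w e : 'I_d -> MP2) (wc : cw w) (ec : cw e) p h' :
    \sum_(N <- msupp p) mmap1 e N * psubst w (lbracket (mcoeff N p) h') =
    wbracket (mpolyC_jetMor (d + d) B) P w (psubst e p) (mpolyC _ h').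
  rewrite psubstE -wbracket_suml => [|N]; last exact: jconst_mmap1.
  by apply: eq_bigr => N _; rewrite psE.
apply: etrans (congr2 (fun p q => p - q) (sumr _ _ lc mc f _) (sumr _ _ mc lc g _)) _.
apply: etrans (esym (suml _ _ sc lc _ h)).
rewrite (psE _ mc g h) (psE _ lc f h) (psE _ lc f g).
apply: (@wbracket_jacobi d n B (mpoly_jetRing (d + d) B) (mpolyC_jetMor (d + d) B) P
  _ lamN muN _ _ _ lc mc) => [|k xi eta]; first exact: skew_symbols_adjoint.
exact: jac_eq0.
Qed.

End PoissonBivector.

(** * Specialization to differential polynomials *)

Section Unweighted.
Variables (d n : nat) (B : jetRing d n).
Implicit Types (f : B) (i : 'I_n).

Lemma mtdw0 I f : mpow (tdw (@w0 d n B)) I f = mpow (@tdr d n B) I f.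
Proof. by apply: eq_mpow => a x; exact: tdw0. Qed.

Lemma vari0E i f : vari (@w0 d n B) i f =
  \sum_(v <- dsupp f | v.1 == i) (-1) ^+ mdeg v.2 * mpow (@tdr d n B) v.2 (par v f).
Proof.
rewrite [RHS]big_mkcond; apply: eq_bigr => v _; case: eqP => // _.
by rewrite mul1r mntdwE ?mtdw0//; exact: w0_const.
Qed.

Lemma act0E Q f : act (idJ B) (@w0 d n B) Q f =
  \sum_(S <- msupp Q) mcoeff S Q * mpow (@tdr d n B) S f.
Proof. by apply: eq_bigr => S _; rewrite mtdw0. Qed.

Lemma fbracketE (P : 'M[mpoly d B]_n) f g : fbracket P f g =
  \sum_i \sum_j vari (@w0 d n B) j g *
   (\sum_(S <- msupp (P j i)) mcoeff S (P j i) *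
      mpow (@tdr d n B) S (vari (@w0 d n B) i f)).
Proof. by apply: eq_bigr => i _; apply: eq_bigr => j _; rewrite act0E. Qed.

End Unweighted.

Section Instantiation.
Variables (d : nat) (R : realType) (n : nat) (U : chart R n).
Local Notation A := (Ahat d U).
Local Notation B := (Ahat_jetRing d U).
Implicit Types (f g h : A) (i j : 'I_n).

Lemma Ahat_coordinates : @jet_coordinates d n B (uvar U).
Proof. split; [exact: pd_uvar|exact: td_uvar]. Qed.

Lemma vder_vari i f : vder i f = @vari d n B (@w0 d n B) i f.
Proof. exact: esym (@vari0E d n B i f). Qed.

Lemma functional_fbracket (P : 'M[diffop d U]_n) f g :
  functional_bracket P f g = @fbracket d n B P f g.
Proof.
apply: etrans (esym (@fbracketE d n B P f g)).
apply: eq_bigr => i _; apply: eq_bigr => j _.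
apply: (congr2 (fun x y : A => x * y)); first exact: vder_vari.
exact: (congr1 (dapp (P j i)) (vder_vari i f)).
Qed.

Lemma eqF0_null f : eqF f 0 <-> @null d n B f.
Proof. by rewrite -[X in @null _ _ _ X]subr0. Qed.

Lemma jconst_realc (c : R) : @jconst d n B (realc d U c).
Proof. by split=> [v|a]; [exact: pd_realc|exact: td_realc]. Qed.

End Instantiation.

Section InducedBracket.
Variables (d : nat) (R : realType) (n : nat) (U : chart R n).
Variables (P : 'M[diffop d U]_n) (d_gt0 : (0 < d)%N).
Hypothesis PP : local_poisson_bivector P.
Local Notation B := (Ahat_jetRing d U).
Local Notation br := (@lbracket d n B P).

Let Psk : @skew_symbols d n B P := PP.1.

Lemma fbracket_lie : lie_bracketF (@fbracket d n B P).
Proof.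
have <- : functional_bracket P = @fbracket d n B P.
  by apply/funext => f; apply/funext => g; exact: functional_fbracket.
exact: PP.2.
Qed.

Lemma br_jacobi f g h :
    \sum_(N <- msupp (br g h))
       subst2 (@lam2 d R n U) (br f (mcoeff N (br g h))) * mmap1 (@mu2 d R n U) N
    - \sum_(N <- msupp (br f h))
        subst2 (@mu2 d R n U) (br g (mcoeff N (br f h))) * mmap1 (@lam2 d R n U) N
    = \sum_(N <- msupp (br f g))
        mmap1 (@lam2 d R n U) N *
        subst2 (fun a => @lam2 d R n U a + @mu2 d R n U a) (br (mcoeff N (br f g)) h).
Proof.
have [wd _ _ alt jac] := fbracket_lie.
apply: (@lbracket_jacobi d n B P (uvar U)) => //.
- exact: Ahat_coordinates.
- exact: Ahat_mulIn.
- exact: (fun f => (eqF0_null _).1 (alt f)).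
- exact: (fun f g h => (eqF0_null _).1 (jac f g h)).
Qed.

Lemma br_skew f g : br g f = - \sum_(N <- msupp (br f g))
  mpow (fun a p => - Defs.lamD a p) N (mpolyC d (mcoeff N (br f g))).
Proof. exact: (@lbracket_skew d n B P Psk). Qed.

Lemma br_lambda_bracket : is_lambda_bracket br.
Proof.
split.
- move=> c f f' g; exact: (@lbracket_linl d n B P _ _ _ _ (jconst_realc d U c)).
- move=> c f g g'; exact: (@lbracket_linr d n B P _ _ _ _ (jconst_realc d U c)).
- exact: (@lbracket_tdl d n B P).
- exact: (@lbracket_tdr d n B P).
- exact: (@lbracketMr d n B P).
- exact: (@lbracketMl d n B P).
Qed.

End InducedBracket.

Theorem theorem3 (R : realType) (d n : nat) (d_gt0 : (0 < d)%N)
    (n_gt0 : (0 < n)%N) (U : chart R n) (P : 'M[diffop d U]_n) :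
  local_poisson_bivector P -> is_PVA (induced_lambda_bracket P).
Proof.
move=> PP; have -> : induced_lambda_bracket P = @lbracket d n (Ahat_jetRing d U) P.
  by apply/funext => f; apply/funext => g; exact: induced_wbracket.
split; [exact: br_lambda_bracket|exact: br_skew|exact: br_jacobi].
Qed.
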